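(* Denote by $\mathcal C$ the C$^*$-algebra of all functions $f\in C(\mathbb T\times I_q)$ such that (1) $f_x$ converges uniformly to $0$ as $x\to0$ and (2) $f_x$ converges uniformly to a constant function as $x\to\infty$. Then $A_q$ is the norm closed linear span, in $B(H)$, of the set $\{\rho_p\,M_f \mid f\in\mathcal C,\ p\in -q^{\mathbb Z}\cup q^{\mathbb Z}\}$.
   Context: Fix $0<q<1$. Let $\mathbb N=\{1,2,\dots\}$, $\mathbb T$ the unit circle with normalized Haar measure, $I_q=\{-q^k: k\in\mathbb N\}\cup\{q^k:k\in\mathbb Z\}$ with the discrete topology and counting measure. $(a;q^2)_n=\prod_{i=0}^{n-1}(1-q^{2i}a)$, $(a;q^2)_\infty=\lim_n (a;q^2)_n$, $(a_1,\dots,a_j;q^2)_k=(a_1;q^2)_k\cdots(a_j;q^2)_k$, and for $a,b,z\in\mathbb C$, $\Psi(a;b;z)=\sum_{n=0}^\infty \frac{(a;q^2)_n(bq^{2n};q^2)_\infty}{(q^2;q^2)_n}(-1)^nq^{n(n-1)}z^n$. Put $\chi(x)=\log_q|x|$ and $\nu(x)=q^{\frac12(\chi(x)-1)(\chi(x)-2)}$ for $x\in -q^{\mathbb Z}\cup q^{\mathbb Z}$; $\kappa(x)=\mathrm{sgn}(x)x^2$ for $x\in\mathbb R$; $s(x,y)=-1$ if $x>0$ and $y<0$, $s(x,y)=1$ otherwise ($x,y\in\mathbb R\setminus\{0\}$); $c_q=(\sqrt2\,q\,(q^2,-q^2;q^2)_\infty)^{-1}$. For $p\in I_q$ define $a_p:I_q\times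 I_q\to\mathbb R$ by $a_p(x,y)=0$ if $\mathrm{sgn}(xy)\neq\mathrm{sgn}(p)$ and, if $\mathrm{sgn}(xy)=\mathrm{sgn}(p)$, $$a_p(x,y)=c_q\,s(x,y)(-1)^{\chi(p)}(-\mathrm{sgn}(y))^{\chi(x)}|y|\,\nu(py/x)\sqrt{\frac{(-\kappa(p),-\kappa(y);q^2)_\infty}{(-\kappa(x);q^2)_\infty}}\;\Psi\big(-q^2/\kappa(y);\,q^2\kappa(x/y);\,q^2\kappa(x/p)\big).$$ $H=L^2(\mathbb T)\otimes L^2(I_q)=L^2(\mathbb T\times I_q)$, with orthonormal basis $\zeta^m\otimes\delta_p$ ($m\in\mathbb Z$, $p\in I_q$), $\zeta$ the identity function on $\mathbb T$, $\delta_p$ the indicator function of $p$. $M_q=L^\infty(\mathbb T)\otimes B(L^2(I_q))$, acting on $H$. For $p\in -q^{\mathbb Z}\cup q^{\mathbb Z}$, $\rho_p\in M_q$ is the partial isometry $(\rho_pf)(\lambda,x)=f(\lambda,px)$ if $px\in I_q$ and $0$ otherwise. $M_f$ is multiplication by $f$ on $L^2(\mathbb T\times I_q)$. For $f\in C(\mathbb T\times I_q)$ and $x\in I_q$, $f_x\in C(\mathbb T)$ is $f_x(\lambda)=f(\lambda,x)$. $K=H\otimes L^2(I_q)$, $f_{m,p,t}=\zeta^m\otimes\delta_p\otimes\delta_t$ ($m\in\mathbb Z$, $p,t\in I_q$; an orthonormal basis of $K$), $\pi:M_q\to B(K)$, $\pi(a)=a\otimes1$. $W$ is the unitary on $K\otimes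 K$ (the multiplicative unitary of $\widetilde{SU}_q(1,1)$) with $$W^*(f_{m_1,p_1,t_1}\otimes f_{m_2,p_2,t_2})=\sum_{y,z}|t_2/y|\,a_{t_2}(p_1,y)\,a_{p_2}\big(z,\mathrm{sgn}(p_2t_2)(yz/p_1)q^{m_2}\big)\,f_{m_1+m_2-\chi(p_1p_2/t_2z),\,z,\,t_1}\otimes f_{\chi(p_1p_2/t_2z),\,\mathrm{sgn}(p_2t_2)(yz/p_1)q^{m_2},\,y},$$ the sum being over $y,z\in I_q$ with $\mathrm{sgn}(p_2t_2)(yz/p_1)q^{m_2}\in I_q$ (here $\chi(p_1p_2/t_2z)$ means $\chi(p_1p_2/(t_2z))$). $A_q$ is the C$^*$-subalgebra of $M_q$ (the underlying reduced C$^*$-algebra of $\widetilde{SU}_q(1,1)$) such that $\pi(A_q)$ is the norm closure in $B(K)$ of $\{(\iota\otimes\omega)(W^* )\mid\omega\in B(K)_*\}$. *)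

(* Defs.v *)
From HB Require Import structures.
From mathcomp Require Import all_boot all_order all_algebra finmap.
From mathcomp Require Import generic_quotient ring_quotient complex ring lra zify.
From mathcomp Require Import all_classical all_reals all_analysis measurable_realfun.

Set Implicit Arguments.
Unset Strict Implicit.
Unset Printing Implicit Defensive.

Import Order.TTheory GRing.Theory Num.Theory.
Import numFieldNormedType.Exports.

Local Open Scope classical_set_scope.
Local Open Scope ring_scope.
Local Open Scope quotient_scope.

Definition abs2 (R : realType) (z : R[i]) : R :=
  complex.Re z ^+ 2 + complex.Im z ^+ 2.

(* modulus, with values in R rather than in R[i] *)
Definition cabs (R : realType) (z : R[i]) : R := Num.sqrt (abs2 z).

Section SquareIntegrable.
Context (R : realType) d (X : measurableType d) (mu : {measure set X -> \bar R}).

Definition cmeasurable (f : X -> R[i]) : Prop :=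
  measurable_fun setT (fun x => complex.Re (f x)) /\
  measurable_fun setT (fun x => complex.Im (f x)).

Definition sqint : {pred (X -> R[i])} := mem [set f : X -> R[i] |
  cmeasurable f /\ (\int[mu]_x (abs2 (f x))%:E < +oo)%E].

Lemma abs2_ge0 (z : R[i]) : 0 <= abs2 z.
Proof. by rewrite addr_ge0 ?sqr_ge0. Qed.

Lemma abs2D (z w : R[i]) : abs2 (z + w) <= 2 * abs2 z + 2 * abs2 w.
Proof.
case: z w => [a b] [c e]; rewrite /abs2 /=.
have h (x y : R) : (x + y) ^+ 2 <= 2 * x ^+ 2 + 2 * y ^+ 2.
  by rewrite -subr_ge0 [leRHS](_ : _ = (x - y) ^+ 2) ?sqr_ge0//; ring.
by have := lerD (h a c) (h b e); lra.
Qed.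

Lemma abs2M (a z : R[i]) : abs2 (a * z) = abs2 a * abs2 z.
Proof. by case: a z => [a b] [c e]; rewrite /abs2 /=; ring. Qed.

Lemma measurable_abs2 (f : X -> R[i]) : cmeasurable f ->
  measurable_fun setT (fun x => (abs2 (f x))%:E).
Proof.
move=> [mR mI]; apply/measurable_EFinP.
by apply: measurable_funD; exact: measurable_funX.
Qed.

Lemma sqintP (f : X -> R[i]) : reflect
  (cmeasurable f /\ (\int[mu]_x (abs2 (f x))%:E < +oo)%E) (f \in sqint).
Proof. by apply: (iffP idP); rewrite inE. Qed.

Lemma sqint_submod : submod_closed sqint.
Proof.
split=> [|a f g /sqintP[[mRf mIf] sf] /sqintP[[mRg mIg] sg]].
  apply/sqintP; split; first by split; exact: measurable_cst.
  rewrite (eq_integral (cst 0%E)) ?integral0// => x _.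
  by rewrite /abs2 /= expr0n addr0.
have mh : cmeasurable (a *: f + g).
  split.
    rewrite (_ : (fun _ => _) = (fun x => complex.Re a * complex.Re (f x) -
        complex.Im a * complex.Im (f x) + complex.Re (g x))).
      by apply: measurable_funD => //; apply: measurable_funB;
        apply: measurable_funM.
    apply/funext => x; rewrite [(_ + _) x]/(a * f x + g x).
    by case: (a) (f x) (g x) => ? ? [? ?] [].
  rewrite (_ : (fun _ => _) = (fun x => complex.Re a * complex.Im (f x) +
      complex.Im a * complex.Re (f x) + complex.Im (g x))).
    by apply: measurable_funD => //; apply: measurable_funD;
      apply: measurable_funM.
  apply/funext => x; rewrite [(_ + _) x]/(a * f x + g x).
  by case: (a) (f x) (g x) => ? ? [? ?] [].
apply/sqintP; split => //.
have k0 (z : R[i]) : (0 <= (abs2 z)%:E)%E by rewrite lee_fin abs2_ge0.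
have c0 : (0 <= 2 * abs2 a)%R by rewrite mulr_ge0 ?abs2_ge0.
have mf := measurable_abs2 (conj mRf mIf).
have mg := measurable_abs2 (conj mRg mIg).
apply: (@le_lt_trans _ _ (\int[mu]_x ((2 * abs2 a)%:E * (abs2 (f x))%:E +
    2%:E * (abs2 (g x))%:E))%E).
  apply: ge0_le_integral => //.
  - exact: measurable_abs2.
  - by apply: emeasurable_funD;
      [exact: (measurable_funeM _ mf)|exact: (measurable_funeM _ mg)].
  - move=> x _; rewrite -!EFinM -EFinD lee_fin (le_trans (abs2D _ _))//.
    by rewrite abs2M mulrA.
have mkf := measurable_funeM (2 * abs2 a)%:E mf.
have mkg := measurable_funeM 2%:E mg.
have pf x : setT x -> (0 <= (2 * abs2 a)%:E * (abs2 (f x))%:E)%E.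
  by move=> _; apply: mule_ge0; rewrite ?k0 ?lee_fin.
have pg x : setT x -> (0 <= 2%:E * (abs2 (g x))%:E)%E.
  by move=> _; apply: mule_ge0; rewrite ?k0 ?lee_fin.
rewrite ge0_integralD// !ge0_integralZl_EFin//.
by apply: lte_add_pinfty; exact: lte_mul_pinfty.
Qed.

HB.instance Definition _ :=
  GRing.isSubmodClosed.Build R[i] (X -> R[i]) sqint sqint_submod.

Definition L2fun : Type := {f : X -> R[i] | f \in sqint}.
HB.instance Definition _ := SubChoice.on L2fun.
HB.instance Definition _ := [SubChoice_isSubLmodule of L2fun by <:].

(* L^2(mu) is the quotient of the square integrable functions by the almost
   everywhere null ones *)
Definition L2null : {pred L2fun} :=
  mem [set f : L2fun | {ae mu, forall x, val f x = 0}].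

Lemma L2null_submod : submod_closed L2null.
Proof.
split=> [|a f g]; rewrite !inE /=; first exact: aeW.
move=> hf hg; apply: filterS2 hf hg => x fx gx.
change (a * sval f x + sval g x = 0).
by rewrite fx gx mulr0 addr0.
Qed.

HB.instance Definition _ :=
  GRing.isSubmodClosed.Build R[i] L2fun L2null L2null_submod.

Definition L2 : Type := {ideal_quot L2null}.
HB.instance Definition _ := GRing.Zmodule.on L2.
HB.instance Definition _ := EqQuotient.on L2.

Definition L2scale (a : R[i]) (u : L2) : L2 := \pi_L2 (a *: repr u).

Lemma pi_L2scale (a : R[i]) (f : L2fun) :
  L2scale a (\pi_L2 f) = \pi_L2 (a *: f).
Proof.
apply/eqP; rewrite -Quotient.idealrBE -scalerBr; apply: rpredZ.
by rewrite Quotient.idealrBE; apply/eqP; exact: (reprK (\pi_L2 f)).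
Qed.

Lemma pi_L2D (f g : L2fun) : \pi_L2 f + \pi_L2 g = \pi_L2 (f + g) :> L2.
Proof. exact: esym (Quotient.pi_add _ f g). Qed.

Lemma L2scaleA a b u : L2scale a (L2scale b u) = L2scale (a * b) u.
Proof.
elim/quotW: u => f.
by rewrite (pi_L2scale b) (pi_L2scale a) (pi_L2scale (a * b)) scalerA.
Qed.

Lemma L2scale1 : left_id 1 L2scale.
Proof. by elim/quotW => f; rewrite pi_L2scale scale1r. Qed.

Lemma L2scaleDr : right_distributive L2scale +%R.
Proof.
move=> a; elim/quotW => f; elim/quotW => g.
rewrite (pi_L2scale a f) (pi_L2scale a g).
by rewrite !pi_L2D (pi_L2scale a (f + g)) scalerDr.
Qed.

Lemma L2scaleDl u : {morph L2scale^~ u : a b / a + b}.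
Proof.
elim/quotW: u => f a b.
rewrite (pi_L2scale a f) (pi_L2scale b f) (pi_L2scale (a + b) f).
by rewrite pi_L2D scalerDl.
Qed.

HB.instance Definition _ := GRing.Zmodule_isLmodule.Build R[i] L2
  L2scaleA L2scale1 L2scaleDr L2scaleDl.

Definition L2_repr (u : L2) : X -> R[i] := val (repr u).

(* the class of f; 0 when f is not square integrable *)
Definition L2class (f : X -> R[i]) : L2 := \pi_L2 (insubd (0 : L2fun) f).

Definition cintegral (f : X -> R[i]) : R[i] :=
  Complex (\int[mu]_x complex.Re (f x))%R (\int[mu]_x complex.Im (f x))%R.

(* linear in the first variable *)
Definition inner (u v : L2) : R[i] :=
  cintegral (fun x => L2_repr u x * conjc (L2_repr v x)).

Definition norm2 (u : L2) : R := Num.sqrt (complex.Re (inner u u)).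

End SquareIntegrable.

Arguments L2class {R d X} mu f.

Section Operators.
Context (R : realType) d (X : measurableType d) (mu : {measure set X -> \bar R}).
Local Notation E := (L2 mu).
Implicit Types (T : E -> E) (A S : set (E -> E)).

Definition bounded_op T : Prop :=
  linear T /\ exists C : R, forall u, norm2 (T u) <= C * norm2 u.

Definition unitary_op T : Prop :=
  [/\ linear T, forall u v, inner (T u) (T v) = inner u v
    & forall v, exists u, T u = v].

Definition adjoint_op T : E -> E :=
  xget (fun=> 0) [set S : E -> E |
    bounded_op S /\ forall u v, inner (T u) v = inner u (S v)].

(* closure in B(E) for the operator norm *)
Definition op_closure S : set (E -> E) := [set T |
  bounded_op T /\ forall e : R, 0 < e ->
    exists2 T', S T' & forall u, norm2 (T u - T' u) <= e * norm2 u].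

Definition op_span S : set (E -> E) := [set T |
  exists n (c : 'I_n -> R[i]) (F : 'I_n -> E -> E),
    (forall i, S (F i)) /\ T = (fun u => \sum_(i < n) c i *: F i u)].

Definition op_commutant S : set (E -> E) := [set T |
  bounded_op T /\ forall T', S T' -> T \o T' = T' \o T].

Definition cstar_subalgebra A : Prop :=
  [/\ A `<=` bounded_op /\ A (fun=> 0),
      forall (c : R[i]) T T', A T -> A T' -> A (fun u => c *: T u + T' u),
      forall T T', A T -> A T' -> A (T \o T'),
      forall T, A T -> A (adjoint_op T)
    & op_closure A `<=` A].

Definition mul_op (f : X -> R[i]) : E -> E :=
  fun u => L2class mu (fun x => f x * L2_repr u x).

Definition essentially_bounded (f : X -> R[i]) : Prop :=
  cmeasurable f /\ exists C : R, {ae mu, forall x, cabs (f x) <= C}.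

(* unconditional convergence in norm of the family (F i)_(i in P) to v *)
Definition has_sum (I : choiceType) (P : set I) (F : I -> E) (v : E) : Prop :=
  forall e : R, 0 < e -> exists2 J : {fset I}, [set` J] `<=` P &
    forall J' : {fset I}, [set` J] `<=` [set` J'] -> [set` J'] `<=` P ->
      norm2 (\sum_(i <- enum_fset J') F i - v) < e.

(* elements of the predual of B(E): functionals sum_n <. xi_n, eta_n> with
   square-summable xi and eta *)
Definition normal_functional (w : (E -> E) -> R[i]) : Prop :=
  exists xi eta : nat -> E,
  [/\ cvgn (series (fun n => norm2 (xi n) ^+ 2)),
      cvgn (series (fun n => norm2 (eta n) ^+ 2))
    & forall T, bounded_op T ->
      series (fun n => inner (T (xi n)) (eta n) : R[i]^o) @ \oo --> (w T : R[i]^o)].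

End Operators.

Arguments mul_op {R d X} mu f.

Section ProductMeasure.
Context (R : realType) d1 d2 (X : measurableType d1) (Y : measurableType d2).
Variables (mu : {sigma_finite_measure set X -> \bar R}).
Variables (nu : {sigma_finite_measure set Y -> \bar R}).

(* The product of the library under a name of its own, so that the product of
   two sigma-finite measures is recognized as sigma-finite. *)
Definition prod_measure : set (X * Y) -> \bar R := (mu \x nu)%E.

HB.instance Definition _ := Measure.on prod_measure.

Lemma sigma_finite_prod_measure : sigma_finite setT prod_measure.
Proof.
have /sigma_finiteP[F [TF ndF Foo]] := sigma_finiteT mu.
have /sigma_finiteP[G [TG ndG Goo]] := sigma_finiteT nu.
exists (fun n => F n `*` G n).
  rewrite -setXTT TF TG predeqE => -[x y]; split.
    move=> [/= [n _ Fnx] [k _ Gky]]; exists (maxn n k) => //; split.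
    - by move: x Fnx; exact/subsetPset/ndF/leq_maxl.
    - by move: y Gky; exact/subsetPset/ndG/leq_maxr.
  by move=> [n _ []/= ? ?]; split; exists n.
move=> k; have [? ?] := Foo k; have [? ?] := Goo k.
split; first exact: measurableX.
by rewrite /prod_measure product_measure1E// lte_mul_pinfty// ge0_fin_numE.
Qed.

HB.instance Definition _ :=
  @Measure_isSigmaFinite.Build _ _ _ prod_measure sigma_finite_prod_measure.

End ProductMeasure.

Section Tensor.
Context (R : realType) d1 d2 (X : measurableType d1) (Y : measurableType d2).
Context (mu : {sigma_finite_measure set X -> \bar R}).
Context (nu : {sigma_finite_measure set Y -> \bar R}).
Local Notation EF := (L2 (prod_measure mu nu)).

(* L^2(X) (x) L^2(Y), identified with L^2(X * Y) *)
Definition tensor (u : L2 mu) (v : L2 nu) : EF :=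
  L2class (prod_measure mu nu) (fun xy => L2_repr u xy.1 * L2_repr v xy.2).

(* a (x) 1 *)
Definition amplify (a : L2 mu -> L2 mu) : EF -> EF :=
  xget (fun=> 0) [set T : EF -> EF |
    bounded_op T /\ forall u v, T (tensor u v) = tensor (a u) v].

(* S = (iota (x) w)(T): <S u, u'> = w(T_(u,u')), where T_(u,u') is the
   operator on the second leg with <T_(u,u') v, v'> = <T(u (x) v), u' (x) v'> *)
Definition is_slice (w : (L2 nu -> L2 nu) -> R[i]) (T : EF -> EF)
    (S : L2 mu -> L2 mu) : Prop :=
  bounded_op S /\ forall u u' : L2 mu, exists T' : L2 nu -> L2 nu,
    [/\ bounded_op T',
        forall v v', inner (T' v) v' = inner (T (tensor u v)) (tensor u' v')
      & inner (S u) u' = w T'].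

(* the von Neumann algebra L^oo(X) (x) B(L^2(Y)), as the bicommutant of the
   elementary tensors *)
Definition Linfty_tensor_B : set (EF -> EF) :=
  op_commutant (op_commutant [set T : EF -> EF | bounded_op T /\
    exists (g : X -> R[i]) (b : L2 nu -> L2 nu),
      [/\ essentially_bounded mu g, bounded_op b &
        forall u v, T (tensor u v) = tensor (mul_op mu g u) (b v)]]).

End Tensor.

Definition circle (R : realType) : Type :=
  set_type [set z : R[i]^o | `|z| = 1].

Section Circle.
Variable R : realType.

HB.instance Definition _ := Topological.on (circle R).

(* t |-> exp(2 i pi t) *)
Definition circle_exp_val (t : R) : R[i]^o :=
  Complex (cos (2 * pi * t)) (sin (2 * pi * t)).

Lemma circle_exp_subproof (t : R) :
  circle_exp_val t \in [set z : R[i]^o | `|z| = 1].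
Proof. by rewrite inE /= normc_def /= cos2Dsin2 sqrtr1. Qed.

Definition circle_exp (t : measurableTypeR R) : circle R := 
  exist (fun z => z \in [set z : R[i]^o | `|z| = 1]) _ (circle_exp_subproof t).

HB.instance Definition _ := isPointed.Build (circle R) (circle_exp 0).
HB.instance Definition _ := @isMeasurable.Build (sigma_display (@open (circle R)))
  (circle R) <<s @open (circle R) >> (@sigma_algebra0 _ setT _)
  (@sigma_algebraC _ _) (@sigma_algebra_bigcup _ setT _).

Lemma continuous_circle_exp_val : continuous circle_exp_val.
Proof.
move=> t; apply/cvgrPdist_lt => e e0.
have [r r0 ->] : exists2 r : R, 0 < r & e = (r%:C)%C.
  have eR : e = ((complex.Re e)%:C)%C by rewrite RRe_real// gtr0_real.
  by exists (complex.Re e) => //; rewrite -ltcR -eR.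
have r20 : 0 < r / 2 by rewrite divr_gt0.
have mC : {for t, continuous (fun s : R => 2 * pi * s)}.
  by apply: cvgM; [exact: cvg_cst|exact: cvg_id].
have /cvgrPdist_lt/(_ _ r20) hc :=
  continuous_comp mC (@continuous_cos R (2 * pi * t)).
have /cvgrPdist_lt/(_ _ r20) hs :=
  continuous_comp mC (@continuous_sin R (2 * pi * t)).
near=> s.
have hcs : `|cos (2 * pi * t) - cos (2 * pi * s)| < r / 2 by near: s; exact: hc.
have hss : `|sin (2 * pi * t) - sin (2 * pi * s)| < r / 2 by near: s; exact: hs.
rewrite normc_def ltcR /=.
rewrite -(ger0_norm (ltW r0)) -sqrtr_sqr ltr_sqrt ?exprn_gt0//.
rewrite -[ltLHS](_ : `|cos (2 * pi * t) - cos (2 * pi * s)| ^+ 2 +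
  `|sin (2 * pi * t) - sin (2 * pi * s)| ^+ 2 = _); last first.
  by rewrite !real_normK ?num_real.
have := normr_ge0 (cos (2 * pi * t) - cos (2 * pi * s)).
have := normr_ge0 (sin (2 * pi * t) - sin (2 * pi * s)).
by nra.
Unshelve. all: by end_near. Qed.

Lemma measurable_circle_exp : measurable_fun setT circle_exp.
Proof.
apply: (measurability (@open (circle R))) => //.
move=> _ [U /= oU <-]; rewrite setTI.
case: oU => V oV <-.
apply: open_measurable; rewrite -[X in open X]/(circle_exp_val @^-1` V).
by apply: open_comp => // t _; exact: continuous_circle_exp_val.
Qed.

HB.instance Definition _ :=
  isMeasurableFun.Build _ _ (measurableTypeR R) (circle R) circle_exp measurable_circle_exp.

Definition haar : probability (circle R) R :=
  distribution (uniform_prob (@ltr01 R)) circle_exp.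

End Circle.

Definition Iq_set (R : realType) (q : R) : set R :=
  [set x | (exists2 k : nat, (0 < k)%N & x = - q ^+ k) \/
           (exists k : int, x = q ^ k)].

Definition Iq (R : realType) (q : R) : Type :=
  discrete_topology (set_type (Iq_set q)).

Definition qpowers (R : realType) (q : R) : set R :=
  [set x | exists k : int, x = q ^ k \/ x = - q ^ k].

Section IqStructures.
Variables (R : realType) (q : R).

HB.instance Definition _ := DiscreteTopology.on (Iq q).
HB.instance Definition _ :=
  SubChoice.copy (Iq q) (set_type (Iq_set q)).

Lemma Iq_one_subproof : (1 : R) \in Iq_set q.
Proof. by rewrite inE; right; exists 0; rewrite expr0z. Qed.

HB.instance Definition _ := isPointed.Build (Iq q)
  (exist (fun x : R => x \in Iq_set q) _ Iq_one_subproof).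

HB.instance Definition _ := @isMeasurable.Build default_measure_display
  (Iq q) discrete_measurable discrete_measurable0
  discrete_measurableC discrete_measurableU.

Definition mu_I : set (Iq q) -> \bar R := @counting (Iq q) R.

HB.instance Definition _ := Measure.on mu_I.

Lemma sigma_finite_mu_I : sigma_finite [set: Iq q] mu_I.
Proof.
pose s n : seq R := [seq q ^ (i%:Z - n%:Z) | i <- iota 0 (n + n).+1] ++
  [seq - q ^+ i | i <- iota 0 n.+1].
exists (fun n => (val : Iq q -> R) @^-1` [set` s n]).
  apply/seteqP; split => // -[x xI] _.
  have := xI; rewrite inE => -[[k k0 xk]|[k xk]].
    exists k => //=; rewrite mem_cat; apply/orP; right.
    by apply/mapP; exists k => //; rewrite mem_iota ltnSn.
  exists (absz k) => //=; rewrite mem_cat; apply/orP; left; apply/mapP.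
  exists (absz (k + (absz k)%:Z)%R); last by rewrite xk; congr (q ^ _); lia.
  by rewrite mem_iota; lia.
move=> n; split=> //; rewrite /mu_I /counting asboolT ?ltry//.
by apply: finite_preimage => // x y _ _; exact: val_inj.
Qed.

HB.instance Definition _ :=
  @Measure_isSigmaFinite.Build _ _ _ mu_I sigma_finite_mu_I.

End IqStructures.

Arguments mu_I {R} q.

Section SpecialFunctions.
Variables (R : realType) (q : R).
Implicit Types (a b z x y p : R).

(* (a; q^2)_n and (a; q^2)_oo *)
Definition qpoch a (n : nat) : R := \prod_(i < n) (1 - q ^+ (2 * i) * a).
Definition qpoch_inf a : R := limn (qpoch a).

Definition Psi a b z : R :=
  limn (series (fun n : nat =>
    qpoch a n * qpoch_inf (b * q ^+ (2 * n)) / qpoch (q ^+ 2) n *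
    (-1) ^+ n * q ^+ (n * n.-1) * z ^+ n)).

(* log_q |x|, read off as an integer: it is only used on -q^Z and q^Z, where
   log_q |x| is an integer and the floor does nothing *)
Definition chi x : int := Num.floor (ln `|x| / ln q).

Definition nu x : R := q `^ (2^-1 * (chi x - 1)%:~R * (chi x - 2)%:~R).

Definition kappa x : R := Num.sg x * x ^+ 2.

Definition ssign x y : R := if (0 < x) && (y < 0) then -1 else 1.

Definition c_q : R :=
  (Num.sqrt 2 * q * (qpoch_inf (q ^+ 2) * qpoch_inf (- q ^+ 2)))^-1.

Definition afun p x y : R :=
  if Num.sg (x * y) == Num.sg p then
    c_q * ssign x y * (-1) ^ chi p * (- Num.sg y) ^ chi x * `|y| *
    nu (p * y / x) *
    Num.sqrt (qpoch_inf (- kappa p) * qpoch_inf (- kappa y) /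
              qpoch_inf (- kappa x)) *
    Psi (- q ^+ 2 / kappa y) (q ^+ 2 * kappa (x / y)) (q ^+ 2 * kappa (x / p))
  else 0.

End SpecialFunctions.

Section QuantumGroup.
Variables (R : realType) (q : R).

Definition mu_H : {sigma_finite_measure set (circle R * Iq q)%type -> \bar R} :=
  prod_measure (haar R) (mu_I q).

Definition mu_K :
    {sigma_finite_measure set (circle R * Iq q * Iq q)%type -> \bar R} :=
  prod_measure mu_H (mu_I q).

Local Notation H := (L2 mu_H).
Local Notation K := (L2 mu_K).
Local Notation KK := (L2 (prod_measure mu_K mu_K)).

Definition zeta (m : int) : L2 (haar R) :=
  L2class (haar R) (fun l => (val l : R[i]) ^ m).

Definition delta (p : R) : L2 (mu_I q) :=
  L2class (mu_I q) (fun x : Iq q => (val x == p)%:R).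

(* p and t range over I_q; outside of I_q, delta p and delta t are 0 *)
Definition fbasis (m : int) (p t : R) : K :=
  tensor (tensor (zeta m) (delta p)) (delta t).

Definition W_point (m2 : int) (p1 p2 t2 y z : R) : R :=
  Num.sg (p2 * t2) * (y * z / p1) * q ^ m2.

Definition W_term (m1 m2 : int) (p1 t1 p2 t2 y z : R) : KK :=
  let w := W_point m2 p1 p2 t2 y z in
  let c := chi q (p1 * p2 / (t2 * z)) in
  ((`|t2 / y| * afun q t2 p1 y * afun q p2 z w)%:C)%C *:
    tensor (fbasis (m1 + m2 - c) z t1) (fbasis c w y).

Definition multiplicative_unitary (W : KK -> KK) : Prop :=
  unitary_op W /\
  forall (m1 m2 : int) (p1 t1 p2 t2 : Iq q),
    has_sum
      [set yz : Iq q * Iq q |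
        Iq_set q (W_point m2 (val p1) (val p2) (val t2) (val yz.1) (val yz.2))]
      (fun yz => W_term m1 m2 (val p1) (val t1) (val p2) (val t2)
                   (val yz.1) (val yz.2))
      (adjoint_op W (tensor (fbasis m1 (val p1) (val t1))
                            (fbasis m2 (val p2) (val t2)))).

Definition M_q : set (H -> H) := @Linfty_tensor_B R _ _ _ _ (haar R) (mu_I q).

Definition pi_rep (a : H -> H) : K -> K := @amplify R _ _ _ _ mu_H (mu_I q) a.

(* the operators (iota (x) w)(adjoint_op W), for w in the predual of B(K) *)
Definition W_slices (W : KK -> KK) : set (K -> K) := [set S |
  exists2 w, normal_functional w &
    @is_slice R _ _ _ _ mu_K mu_K w (adjoint_op W) S].

Definition reduced_cstar_algebra (W : KK -> KK) (A : set (H -> H)) : Prop :=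
  [/\ A `<=` M_q, cstar_subalgebra A
    & pi_rep @` A = op_closure (W_slices W)].

(* (rho_p f)(l, x) = f(l, p x) if p x is in I_q, and 0 otherwise *)
Definition rho (p : R) : H -> H := fun u => L2class mu_H
  (fun lx => if (insub (p * val lx.2) : option (Iq q)) is Some y
             then L2_repr u (lx.1, y) else 0).

(* I_q is discrete; it accumulates only at 0 and at +oo, so the second and
   third conditions are the limits of f_x, uniform on the circle, at 0 and oo *)
Definition C_algebra : set (circle R * Iq q -> R[i]) := [set f |
  [/\ continuous (f : circle R * Iq q -> R[i]^o),
      forall e : R, 0 < e -> exists2 r : R, 0 < r &
        forall (l : circle R) (x : Iq q), `|val x| < r -> cabs (f (l, x)) < e
    & exists c : R[i], forall e : R, 0 < e -> exists r : R,
        forall (l : circle R) (x : Iq q), r < `|val x| ->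
          cabs (f (l, x) - c) < e]].

End QuantumGroup.

(* Main.v *)
(* The basis vectors of K give the slices of W^* by vector functionals: they are
   the operators on H sending zeta^j (x) delta_x to
     |t/y| a_t(x,y) a_p(cx,w) zeta^(j+k) (x) delta_(cx),
   with c = sgn(pt) w q^(-m) / y and k = chi(tw / (py)), that is, rho_(1/c) M_f with
   f(l,x) = |t/y| a_t(x,y) a_p(cx,w) l^k.  They span a dense subspace of A_q.

   Inclusion of A_q: such an f lies in C.  It tends to 0 at x = 0 by the
   asymptotics of Psi.  At oo, the q-binomial theorem and Euler's identities give
   a_t(x,t) -> 1, and Bessel's inequality for the unitary W^* forces the other
   coefficients a_t(x,y), y <> t, to tend to 0; for y = t and w = p the exponent k
   vanishes, so that the limit does not depend on l.

   Converse: with t = p = 1 and c = 1, k = 0, the multiplications by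
   x |-> a_1(x,y)^2 belong to A_q; as functions of x they separate points and, for
   y <> 1, vanish at 0 and at oo, so A_q contains the multiplication by every
   delta_x.  Composing with the slices having t = p = 1 gives all
   rho_(1/c) M_(zeta^k delta_x), and the slice with t = p = y = w = 1 accounts for
   the limit of f at oo.  Uniform approximation by Laurent polynomials on T does
   the rest. *)

Require Import Defs.
From HB Require Import structures.
From mathcomp Require Import all_boot all_order all_algebra finmap.
From mathcomp Require Import generic_quotient ring_quotient complex ring lra zify.
From mathcomp Require Import all_classical all_reals all_analysis measurable_realfun.

Set Implicit Arguments.
Unset Strict Implicit.
Unset Printing Implicit Defensive.

Import Order.TTheory GRing.Theory Num.Theory.
Import numFieldNormedType.Exports.

Local Open Scope classical_set_scope.
Local Open Scope ring_scope.
Local Open Scope quotient_scope.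
Local Notation Re := complex.Re.
Local Notation Im := complex.Im.

(** * Hilbert spaces L^2 *)

(** The adjoint, [pi_rep] and the slices are specified by matrix coefficients or by elementary
    tensors, so operators are compared on total families, and a general slice is approximated as a
    sesquilinear form before any operator is named. This requires the totality of the characters in
    [L2 (haar R)]. Limits of [a_p] are obtained for its square, which is free of signs, of the
    square root and of the 1/2 in the exponent of [nu]; the sign of [a_t(x,t)] is then read off from
    [Psi]. That the limit is exactly 1 reflects the choice of [c_q]: its sqrt 2 answers the 2 in
    (-1; q^2)_oo = 2 (-q^2; q^2)_oo, which enters through a theta identity. Points are separated in
    the regime y -> 0, where a_1(x,y)^2 has Gaussian decay with an exponent that depends on x. A
    negative p calls for no correction at oo, because x / p in I_q then bounds |x|. Only for
    positive p must the limit of f be subtracted. *)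

Section Modulus.
Variable R : realType.
Implicit Types z w : R[i].

Lemma Re_add z w : Re (z + w) = Re z + Re w. Proof. by case: z w => ? ? []. Qed.
Lemma Im_add z w : Im (z + w) = Im z + Im w. Proof. by case: z w => ? ? []. Qed.
Lemma Re_mul z w : Re (z * w) = Re z * Re w - Im z * Im w.
Proof. by case: z w => ? ? []. Qed.
Lemma Im_mul z w : Im (z * w) = Re z * Im w + Im z * Re w.
Proof. by case: z w => ? ? [] ? ? /=; rewrite addrC. Qed.
Lemma Re_conj z : Re (conjc z) = Re z. Proof. by case: z. Qed.
Lemma Im_conj z : Im (conjc z) = - Im z. Proof. by case: z. Qed.
Lemma eq_cplx z w : Re z = Re w -> Im z = Im w -> z = w.
Proof. by case: z w => ? ? [? ?] /= -> ->. Qed.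

Lemma cabsE z : `|z| = ((cabs z)%:C)%C.
Proof. by rewrite normc_def. Qed.
Lemma cabs_ge0 z : 0 <= cabs z. Proof. exact: sqrtr_ge0. Qed.
Lemma sqr_cabs z : cabs z ^+ 2 = abs2 z.
Proof. by rewrite sqr_sqrtr // addr_ge0 ?sqr_ge0. Qed.
Lemma abs2E z : ((abs2 z)%:C)%C = z * conjc z.
Proof. by rewrite -sqr_normc -add_Re2_Im2. Qed.
Lemma conjcM z w : conjc (z * w) = conjc z * conjc w. Proof. exact: rmorphM. Qed.
Lemma conjcD z w : conjc (z + w) = conjc z + conjc w. Proof. exact: rmorphD. Qed.
Lemma conjcB z w : conjc (z - w) = conjc z - conjc w. Proof. exact: rmorphB. Qed.
Lemma abs2_real (a : R) : abs2 (a%:C)%C = a ^+ 2.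
Proof. by rewrite /abs2 /= expr0n addr0. Qed.
Lemma abs2J z : abs2 (conjc z) = abs2 z.
Proof. by rewrite /abs2 Re_conj Im_conj sqrrN. Qed.
Lemma cabsJ z : cabs (conjc z) = cabs z.
Proof. by rewrite /cabs abs2J. Qed.
Lemma cabs_real (a : R) : cabs (a%:C)%C = `|a|.
Proof. by rewrite /cabs abs2_real sqrtr_sqr. Qed.
Lemma cabs0 : cabs (0 : R[i]) = 0.
Proof. by rewrite (cabs_real 0) normr0. Qed.
Lemma cabsM z w : cabs (z * w) = cabs z * cabs w.
Proof. by apply: complexI; rewrite -cabsE normrM !cabsE -rmorphM. Qed.
Lemma cabsN z : cabs (- z) = cabs z.
Proof. by apply: complexI; rewrite -!cabsE normrN. Qed.
Lemma cabsD z w : cabs (z + w) <= cabs z + cabs w.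
Proof. by rewrite -lecR rmorphD /= -!cabsE ler_normD. Qed.
Lemma cabsB z w : cabs (z - w) = cabs (w - z).
Proof. by rewrite -cabsN opprB. Qed.
Lemma cabs_eq0 z : (cabs z == 0) = (z == 0).
Proof. by rewrite -[RHS]normr_eq0 cabsE -(inj_eq (@complexI R)). Qed.
Lemma cabs1 : cabs (1 : R[i]) = 1. Proof. by rewrite (cabs_real 1) normr1. Qed.
Lemma Re_le_cabs z : `|Re z| <= cabs z.
Proof. by rewrite -sqrtr_sqr ler_wsqrtr // lerDl sqr_ge0. Qed.
Lemma Im_le_cabs z : `|Im z| <= cabs z.
Proof. by rewrite -sqrtr_sqr ler_wsqrtr // lerDr sqr_ge0. Qed.
Lemma cabs_sum I (s : seq I) (P : pred I) (F : I -> R[i]) :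
  cabs (\sum_(i <- s | P i) F i) <= \sum_(i <- s | P i) cabs (F i).
Proof.
elim/big_rec2: _ => [|i y1 y2 _ h]; first by rewrite cabs0.
by rewrite (le_trans (cabsD _ _)) // lerD2l.
Qed.

End Modulus.

Section ComplexIntegral.
Context (R : realType) d (X : measurableType d) (mu : {measure set X -> \bar R}).
Implicit Types f g : X -> R[i].

Lemma cmeasurable_cst (c : R[i]) : cmeasurable (fun _ : X => c).
Proof. by split; exact: measurable_cst. Qed.

Lemma cmeasurableD f g : cmeasurable f -> cmeasurable g ->
  cmeasurable (fun x => f x + g x).
Proof.
move=> [? ?] [? ?]; split; [under eq_fun do rewrite Re_add|under eq_fun do rewrite Im_add];
  exact: measurable_funD.
Qed.

Lemma cmeasurableM f g : cmeasurable f -> cmeasurable g ->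
  cmeasurable (fun x => f x * g x).
Proof.
move=> [? ?] [? ?]; split; [under eq_fun do rewrite Re_mul|under eq_fun do rewrite Im_mul].
  by apply: measurable_funB; exact: measurable_funM.
by apply: measurable_funD; exact: measurable_funM.
Qed.

Lemma cmeasurableJ f : cmeasurable f -> cmeasurable (fun x => conjc (f x)).
Proof.
move=> [? mI]; split; [by under eq_fun do rewrite Re_conj|under eq_fun do rewrite Im_conj].
exact: measurable_funN.
Qed.

Definition cintegrable f : Prop :=
  mu.-integrable setT (fun x => (Re (f x))%:E) /\
  mu.-integrable setT (fun x => (Im (f x))%:E).

Lemma cintegrableZ (a : R[i]) f : cintegrable f -> cintegrable (fun x => a * f x).
Proof.
move=> [f1 f2]; split.
  under eq_fun do rewrite Re_mul EFinB !EFinM.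
  by apply: integrableB => //; exact: integrableZl.
under eq_fun do rewrite Im_mul EFinD !EFinM.
by apply: integrableD => //; exact: integrableZl.
Qed.

Lemma cintegralD f g : cintegrable f -> cintegrable g ->
  cintegral mu (fun x => f x + g x) = cintegral mu f + cintegral mu g.
Proof.
move=> [f1 f2] [g1 g2]; apply: eq_cplx => /=.
  by under eq_Rintegral do rewrite Re_add; rewrite RintegralD.
by under eq_Rintegral do rewrite Im_add; rewrite RintegralD.
Qed.

Lemma cintegralZ (a : R[i]) f : cintegrable f ->
  cintegral mu (fun x => a * f x) = a * cintegral mu f.
Proof.
move=> [f1 f2]; apply: eq_cplx; rewrite ?Re_mul ?Im_mul /=.
  under eq_Rintegral do rewrite Re_mul.
  rewrite RintegralB //; last 2 first.
    exact: (integrableZl measurableT (Re a) f1).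
    exact: (integrableZl measurableT (Im a) f2).
  by rewrite !RintegralZl.
under eq_Rintegral do rewrite Im_mul.
rewrite RintegralD //; last 2 first.
  exact: (integrableZl measurableT (Re a) f2).
  exact: (integrableZl measurableT (Im a) f1).
by rewrite !RintegralZl.
Qed.

Lemma cintegralJ f : cintegrable f ->
  cintegral mu (fun x => conjc (f x)) = conjc (cintegral mu f).
Proof.
move=> [f1 f2]; apply: eq_cplx; rewrite ?Re_conj ?Im_conj /=.
  by under eq_Rintegral do rewrite Re_conj.
under eq_Rintegral do rewrite Im_conj -mulN1r.
by rewrite RintegralZl // mulN1r.
Qed.

Lemma eq_cintegral_ae f g : cmeasurable f -> cmeasurable g ->
  {ae mu, forall x, f x = g x} -> cintegral mu f = cintegral mu g.
Proof.
move=> [? ?] [? ?] fg; congr Complex; congr fine; apply: ae_eq_integral => //;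
  try exact/measurable_EFinP; by apply: filterS fg => x ->.
Qed.

(** The pointwise bound |f| |g| <= |f|^2 + |g|^2 supplies an integrable majorant for both the real
    and the imaginary part. *)
Lemma sqint_mul_integrable f g : f \in sqint mu -> g \in sqint mu ->
  cintegrable (fun x => f x * conjc (g x)).
Proof.
move=> /sqintP[mf sf] /sqintP[mg sg].
have [m1 m2] := cmeasurableM mf (cmeasurableJ mg).
have hI : mu.-integrable setT (fun x => (abs2 (f x) + abs2 (g x))%:E).
  have h h1 (mh : cmeasurable h1) : (\int[mu]_x (abs2 (h1 x))%:E < +oo)%E ->
      mu.-integrable setT (fun x => (abs2 (h1 x))%:E).
    move=> s; apply/integrableP; split; first exact: measurable_abs2.
    by under eq_integral do rewrite gee0_abs ?lee_fin ?abs2_ge0//.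
  by under eq_fun do rewrite EFinD; apply: integrableD => //; apply: h.
split; apply: le_integrable hI => //; try exact/measurable_EFinP.
  move=> x _; rewrite !abse_EFin lee_fin [leRHS]ger0_norm ?(addr_ge0 (abs2_ge0 _) (abs2_ge0 _))//.
  rewrite (le_trans (Re_le_cabs _)) // cabsM cabsJ -!sqr_cabs.
  by have := cabs_ge0 (f x); have := cabs_ge0 (g x); nra.
move=> x _; rewrite !abse_EFin lee_fin [leRHS]ger0_norm ?(addr_ge0 (abs2_ge0 _) (abs2_ge0 _))//.
rewrite (le_trans (Im_le_cabs _)) // cabsM cabsJ -!sqr_cabs.
by have := cabs_ge0 (f x); have := cabs_ge0 (g x); nra.
Qed.

End ComplexIntegral.

Arguments inner : simpl never.

Section L2Basics.
Context (R : realType) d (X : measurableType d) (mu : {measure set X -> \bar R}).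
Implicit Types (f g : X -> R[i]) (u v : L2 mu).
Local Notation class := (L2class mu).

Lemma sqintD (a : R[i]) f g : f \in sqint mu -> g \in sqint mu ->
  (fun x => a * f x + g x) \in sqint mu.
Proof. by move=> hf hg; have [_] := sqint_submod mu; move/(_ a f g hf hg). Qed.

Lemma sqint0 : (fun _ => 0) \in sqint mu.
Proof. by have [] := sqint_submod mu. Qed.

Lemma L2_repr_sqint u : L2_repr u \in sqint mu.
Proof. by rewrite /L2_repr; case: (repr u). Qed.

Lemma L2_repr_measurable u : cmeasurable (L2_repr u).
Proof. by have /sqintP[] := L2_repr_sqint u. Qed.

Lemma L2_reprK u : class (L2_repr u) = u.
Proof.
rewrite /L2class /L2_repr (_ : insubd _ _ = repr u) ?reprK //.
exact: valKd.
Qed.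

Lemma eq_pi_L2 (f g : L2fun mu) : {ae mu, forall x, val f x = val g x} ->
  \pi_(L2 mu) f = \pi_(L2 mu) g.
Proof.
move=> fg; apply/eqP; rewrite -Quotient.idealrBE inE /=.
apply: filterS fg => x fgx; change (sval f x - sval g x = 0).
by apply/eqP; rewrite subr_eq0; apply/eqP.
Qed.

Lemma eq_L2class f g : f \in sqint mu -> g \in sqint mu ->
  {ae mu, forall x, f x = g x} -> class f = class g.
Proof.
by move=> hf hg fg; apply: eq_pi_L2; rewrite !val_insubd hf hg.
Qed.

Lemma L2class_repr f : f \in sqint mu -> {ae mu, forall x, L2_repr (class f) x = f x}.
Proof.
move=> hf; have : \pi_(L2 mu) (repr (class f)) = \pi_(L2 mu) (insubd 0 f).
  by rewrite reprK.
move/eqP; rewrite -Quotient.idealrBE inE /= => h.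
apply: filterS h => x h; apply/eqP; rewrite -subr_eq0; apply/eqP.
rewrite -[in X in _ - X](_ : val (insubd (0 : L2fun mu) f) = f) //.
by rewrite val_insubd hf.
Qed.

Lemma L2class_eq_ae f g : f \in sqint mu -> g \in sqint mu -> class f = class g ->
  {ae mu, forall x, f x = g x}.
Proof.
move=> hf hg fg; have h1 := L2class_repr hf; have h2 := L2class_repr hg.
by rewrite fg in h1; apply: filterS2 h1 h2 => x <- <-.
Qed.

Lemma L2classD (a : R[i]) f g : f \in sqint mu -> g \in sqint mu ->
  class (fun x => a * f x + g x) = a *: class f + class g.
Proof.
move=> hf hg; rewrite /L2class.
rewrite [RHS](_ : _ = L2scale a (\pi_(L2 mu) (insubd 0 f)) + \pi_(L2 mu) (insubd 0 g)) //.
rewrite pi_L2scale pi_L2D; apply: eq_pi_L2; apply: aeW => x.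
rewrite val_insubd sqintD // /=.
rewrite [RHS](_ : _ = a * val (insubd (0 : L2fun mu) f) x +
  val (insubd (0 : L2fun mu) g) x) //.
by rewrite !val_insubd hf hg.
Qed.

Lemma L2class0 : class (fun _ => 0) = 0.
Proof.
have := L2classD (- 1) sqint0 sqint0; rewrite scaleN1r addNr => <-.
by congr class; apply/funext => x; rewrite mulr0 addr0.
Qed.

Lemma L2_reprD (a : R[i]) u v :
  {ae mu, forall x, L2_repr (a *: u + v) x = a * L2_repr u x + L2_repr v x}.
Proof.
have -> : a *: u + v = class (fun x => a * L2_repr u x + L2_repr v x).
  by rewrite L2classD ?L2_repr_sqint // !L2_reprK.
by apply: L2class_repr; rewrite sqintD ?L2_repr_sqint.
Qed.

Lemma inner_class f g : f \in sqint mu -> g \in sqint mu ->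
  inner (class f) (class g) = cintegral mu (fun x => f x * conjc (g x)).
Proof.
move=> hf hg; apply: eq_cintegral_ae.
- by apply: cmeasurableM; [|apply: cmeasurableJ]; exact: L2_repr_measurable.
- by apply: cmeasurableM; [have /sqintP[] := hf|apply: cmeasurableJ; have /sqintP[] := hg].
- by apply: filterS2 (L2class_repr hf) (L2class_repr hg) => x -> ->.
Qed.

Lemma innerE u v : inner u v = cintegral mu (fun x => L2_repr u x * conjc (L2_repr v x)).
Proof. by []. Qed.

Lemma innerDl (a : R[i]) u v w : inner (a *: u + v) w = a * inner u w + inner v w.
Proof.
rewrite -(L2_reprK u) -(L2_reprK v) -(L2_reprK w) -L2classD ?L2_repr_sqint //.
rewrite !inner_class ?sqintD ?L2_repr_sqint //.
have h u' v' := sqint_mul_integrable (L2_repr_sqint u') (L2_repr_sqint v').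
rewrite -cintegralZ // -cintegralD //; last exact: cintegrableZ.
by congr cintegral; apply/funext => x; rewrite mulrDl mulrA.
Qed.

Lemma innerC u v : inner v u = conjc (inner u v).
Proof.
have h := sqint_mul_integrable (L2_repr_sqint u) (L2_repr_sqint v).
rewrite !innerE -cintegralJ //.
by congr cintegral; apply/funext => x; rewrite rmorphM /= conjcK mulrC.
Qed.



Lemma inner0l v : inner 0 v = 0.
Proof.
have := innerDl (- 1) 0 0 v; rewrite scaleN1r addNr => ->.
by rewrite mulN1r addNr.
Qed.
Lemma inner0r v : inner v 0 = 0.
Proof. by rewrite innerC inner0l conjc0. Qed.
Lemma innerZl (a : R[i]) u v : inner (a *: u) v = a * inner u v.
Proof. by have := innerDl a u 0 v; rewrite addr0 inner0l addr0. Qed.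
Lemma innerAl u u' v : inner (u + u') v = inner u v + inner u' v.
Proof. by have := innerDl 1 u u' v; rewrite scale1r mul1r. Qed.
Lemma innerBl u u' v : inner (u - u') v = inner u v - inner u' v.
Proof. by rewrite -scaleN1r innerAl innerZl mulN1r. Qed.
Lemma innerZr (a : R[i]) u v : inner u (a *: v) = conjc a * inner u v.
Proof. by rewrite innerC innerZl conjcM -innerC. Qed.
Lemma innerAr u v v' : inner u (v + v') = inner u v + inner u v'.
Proof. by rewrite innerC innerAl conjcD -!innerC. Qed.
Lemma inner_suml I (s : seq I) (P : pred I) (F : I -> L2 mu) v :
  inner (\sum_(i <- s | P i) F i) v = \sum_(i <- s | P i) inner (F i) v.
Proof.
by elim/big_rec2: _ => [|i y1 y2 _ h]; rewrite ?inner0l // innerAl h.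
Qed.
Lemma fin_num_sqint f : f \in sqint mu -> (\int[mu]_x (abs2 (f x))%:E \is a fin_num)%E.
Proof.
move=> /sqintP[mf sf]; rewrite ge0_fin_numE //.
by apply: integral_ge0 => x _; rewrite lee_fin abs2_ge0.
Qed.

Lemma inner_self f : f \in sqint mu ->
  inner (class f) (class f) = ((fine (\int[mu]_x (abs2 (f x))%:E))%:C)%C.
Proof.
move=> hf; rewrite inner_class //.
have e x : f x * conjc (f x) = ((abs2 (f x))%:C)%C by rewrite abs2E.
apply: eq_cplx => /=.
  by congr fine; apply: eq_integral => x _; rewrite e.
rewrite (_ : (\int[mu]_x _)%R = \int[mu]_(x in setT) 0); last first.
  by apply: eq_Rintegral => x _; rewrite e.
by rewrite /Rintegral integral0.
Qed.

Lemma norm2_ge0 u : 0 <= norm2 u. Proof. exact: sqrtr_ge0. Qed.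

Lemma norm2_class f : f \in sqint mu ->
  ((norm2 (class f) ^+ 2)%:E = \int[mu]_x (abs2 (f x))%:E)%E.
Proof.
move=> hf; have h := fin_num_sqint hf.
have h0 : (0 <= \int[mu]_x (abs2 (f x))%:E)%E.
  by apply: integral_ge0 => x _; rewrite lee_fin abs2_ge0.
by rewrite /norm2 inner_self // sqr_sqrtr /= ?fine_ge0 // fineK.
Qed.

Lemma norm2_sqr u : inner u u = ((norm2 u ^+ 2)%:C)%C.
Proof.
rewrite -(L2_reprK u) inner_self ?L2_repr_sqint //.
by rewrite -norm2_class ?L2_repr_sqint.
Qed.

Lemma norm2_eq0 u : norm2 u = 0 -> u = 0.
Proof.
move=> u0; rewrite -(L2_reprK u) -L2class0.
apply: eq_L2class; [exact: L2_repr_sqint|exact: sqint0|].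
have /sqintP[mu' _] := L2_repr_sqint u.
have := norm2_class (L2_repr_sqint u); rewrite L2_reprK u0 expr0n /= => /esym h.
have /(ae_eq_integral_abs mu measurableT (measurable_abs2 mu')) :
    (\int[mu]_x `|(abs2 (L2_repr u x))%:E| = 0)%E.
  by rewrite -[RHS]h; apply: eq_integral => x _; rewrite gee0_abs // lee_fin abs2_ge0.
apply: filterS => x /(_ I) [] h0; apply/eqP; rewrite -cabs_eq0.
by rewrite -sqrf_eq0 sqr_cabs h0.
Qed.

Lemma norm20 : norm2 (0 : L2 mu) = 0.
Proof. by rewrite /norm2 inner0l sqrtr0. Qed.

Lemma norm2Z (a : R[i]) u : norm2 (a *: u) = cabs a * norm2 u.
Proof.
rewrite /norm2 innerZl innerZr mulrA -abs2E norm2_sqr -rmorphM /=.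
by rewrite sqrtrM ?abs2_ge0.
Qed.

Lemma norm2N u : norm2 (- u) = norm2 u.
Proof. by rewrite -scaleN1r norm2Z cabsN cabs1 mul1r. Qed.

Lemma norm2B u v : norm2 (u - v) = norm2 (v - u).
Proof. by rewrite -norm2N opprB. Qed.

Lemma norm2D_sqr u v :
  norm2 (u + v) ^+ 2 = norm2 u ^+ 2 + 2 * Re (inner u v) + norm2 v ^+ 2.
Proof.
apply: (@complexI R); rewrite -norm2_sqr innerAl !innerAr [inner v u]innerC.
rewrite 2!rmorphD /= -!norm2_sqr.
have -> : (((2 * Re (inner u v))%:C)%C : R[i]) = inner u v + conjc (inner u v).
  by rewrite addcJ rmorphM /= rmorph_nat.
by rewrite !addrA.
Qed.

Lemma cauchy_schwarz u v : cabs (inner u v) <= norm2 u * norm2 v.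
Proof.
have [v0|v0] := eqVneq (norm2 v) 0.
  by rewrite (norm2_eq0 v0) inner0r cabs0 norm20 mulr0.
have v_gt0 : 0 < norm2 v by rewrite lt_def v0 norm2_ge0.
set c := inner u v; set t := (norm2 v ^+ 2)^-1.
(* The vector is the component of [u] orthogonal to [v]; expanding its squared norm gives |u|^2 -
   |c|^2 / |v|^2 >= 0. *)
have := sqr_ge0 (norm2 (u + (((- t)%:C)%C * c) *: v)).
rewrite norm2D_sqr innerZr -/c conjcM conjc_real norm2Z cabsM cabs_real normrN.
rewrite -mulrA [conjc c * c]mulrC -abs2E -rmorphM /= -sqr_cabs mulNr.
rewrite !exprMn ger0_norm ?invr_ge0 ?sqr_ge0 // => h.
rewrite -ler_sqr ?nnegrE ?mulr_ge0 ?norm2_ge0 ?cabs_ge0 // exprMn.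
have tv : t * norm2 v ^+ 2 = 1 by rewrite mulVf // expf_neq0.
have : 0 <= norm2 v ^+ 2 * (norm2 u ^+ 2 + 2 * - (t * cabs c ^+ 2) +
  t ^+ 2 * cabs c ^+ 2 * norm2 v ^+ 2) by rewrite mulr_ge0 ?sqr_ge0.
set N := norm2 v ^+ 2 in tv *; set M := norm2 u ^+ 2; set C := cabs c ^+ 2.
have -> : N * (M + 2 * - (t * C) + t ^+ 2 * C * N) =
  M * N - 2 * (t * N) * C + (t * N) ^+ 2 * C by ring.
by rewrite tv; lra.
Qed.

Lemma norm2D u v : norm2 (u + v) <= norm2 u + norm2 v.
Proof.
rewrite -ler_sqr ?nnegrE ?addr_ge0 ?norm2_ge0 // norm2D_sqr sqrrD.
rewrite lerD2r lerD2l -[leRHS]mulr_natl ler_pM2l //.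
by rewrite (le_trans (ler_norm _)) // (le_trans (Re_le_cabs _)) // cauchy_schwarz.
Qed.

Lemma norm2_triangle u v w : norm2 (u - w) <= norm2 (u - v) + norm2 (v - w).
Proof. by rewrite (le_trans _ (norm2D _ _)) // addrA subrK. Qed.

Lemma norm2_sum I (s : seq I) (P : pred I) (F : I -> L2 mu) :
  norm2 (\sum_(i <- s | P i) F i) <= \sum_(i <- s | P i) norm2 (F i).
Proof.
elim/big_rec2: _ => [|i y1 y2 _ h]; first by rewrite norm20.
by rewrite (le_trans (norm2D _ _)) // lerD2l.
Qed.

Lemma inner_nondeg u v : (forall w, inner u w = inner v w) -> u = v.
Proof.
move=> h; apply/eqP; rewrite -subr_eq0; apply/eqP/norm2_eq0.
apply/eqP; rewrite -sqrf_eq0; apply/eqP/(@complexI R); rewrite -norm2_sqr.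
by rewrite innerBl h subrr.
Qed.

(** Testing against [u] itself suffices. This is the passage from bounds on sesquilinear forms to
    bounds in operator norm. *)
Lemma norm2_le_inner u (C : R) : 0 <= C ->
  (forall v, cabs (inner u v) <= C * norm2 v) -> norm2 u <= C.
Proof.
move=> C0 h; have [->//|u0] := eqVneq (norm2 u) 0.
have u_gt0 : 0 < norm2 u by rewrite lt_def u0 norm2_ge0.
have := h u; rewrite norm2_sqr cabs_real ger0_norm ?sqr_ge0 // expr2.
by rewrite ler_pM2r.
Qed.

Lemma norm2_lt_eq0 u : (forall e : R, 0 < e -> norm2 u <= e) -> u = 0.
Proof.
move=> h; apply: norm2_eq0; apply/eqP; rewrite eq_le norm2_ge0 andbT.
by apply/ler_addgt0Pl => e e0; rewrite addr0 h.
Qed.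

End L2Basics.

(** * Bounded operators and adjoints of unitaries *)

Section BoundedOperators.
Context (R : realType) d (X : measurableType d) (mu : {measure set X -> \bar R}).
Context d' (Y : measurableType d') (nu : {measure set Y -> \bar R}).
Implicit Types (T : L2 mu -> L2 nu).

Lemma lin0 T : linear T -> T 0 = 0.
Proof. by move=> h; have := h (- 1) 0 0; rewrite !scaleN1r !addNr. Qed.
Lemma linZ T a u : linear T -> T (a *: u) = a *: T u.
Proof. by move=> h; have := h a u 0; rewrite lin0 // !addr0. Qed.
Lemma linD T u v : linear T -> T (u + v) = T u + T v.
Proof. by move=> h; have := h 1 u v; rewrite !scale1r. Qed.
Lemma linB T u v : linear T -> T (u - v) = T u - T v.
Proof. by move=> h; rewrite -[- v]scaleN1r linD // linZ // scaleN1r. Qed.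
Lemma lin_sum T I (s : seq I) (P : pred I) (F : I -> L2 mu) : linear T ->
  T (\sum_(i <- s | P i) F i) = \sum_(i <- s | P i) T (F i).
Proof.
move=> h; elim/big_rec2: _ => [|i y1 y2 _ e]; first exact: lin0.
by rewrite linD // e.
Qed.

End BoundedOperators.

Section Adjoint.
Context (R : realType) d (X : measurableType d) (mu : {measure set X -> \bar R}).
Implicit Types (T : L2 mu -> L2 mu).

Lemma bounded_pos T : bounded_op T ->
  exists2 C : R, 0 < C & forall u, norm2 (T u) <= C * norm2 u.
Proof.
move=> [_ [C hC]]; exists (`|C| + 1); first by rewrite ltr_pwDr.
move=> u; rewrite (le_trans (hC u)) // ler_wpM2r ?norm2_ge0 //.
by rewrite (le_trans (ler_norm _)) // lerDl.
Qed.

Lemma bounded_lincomb (a : R[i]) T T' : bounded_op T -> bounded_op T' ->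
  bounded_op (fun u => a *: T u + T' u).
Proof.
move=> bT bT'; have [C C0 hC] := bounded_pos bT; have [C' C'0 hC'] := bounded_pos bT'.
split.
  move=> b u v; rewrite (proj1 bT) (proj1 bT') !scalerDr !scalerA [b * a]mulrC.
  by rewrite !addrA; congr (_ + _); rewrite -!addrA; congr (_ + _); rewrite addrC.
exists (cabs a * C + C') => u; rewrite (le_trans (norm2D _ _)) // mulrDl lerD //.
by rewrite norm2Z -mulrA ler_wpM2l ?cabs_ge0.
Qed.

Lemma bounded0 : bounded_op (fun _ : L2 mu => 0 : L2 mu).
Proof.
split; first by move=> a u v; rewrite scaler0 addr0.
by exists 0 => u; rewrite norm20 mul0r.
Qed.

Lemma bounded_comp T T' : bounded_op T -> bounded_op T' -> bounded_op (T \o T').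
Proof.
move=> bT bT'; have [C C0 hC] := bounded_pos bT; have [C' C'0 hC'] := bounded_pos bT'.
split; first by move=> a u v /=; rewrite (proj1 bT') (proj1 bT).
exists (C * C') => u; rewrite (le_trans (hC _)) // -mulrA ler_wpM2l //.
exact: ltW.
Qed.

(** [adjoint_op] is a choice among the operators meeting a specification. The inverse of a unitary
    meets it, and nondegeneracy of the inner product shows that nothing else does. *)
Lemma adjoint_unitary T (T' : L2 mu -> L2 mu) : unitary_op T ->
  cancel T T' -> cancel T' T -> adjoint_op T = T'.
Proof.
move=> [lT iT sT] TK T'K.
have nT u : norm2 (T u) = norm2 u by rewrite /norm2 iT.
have bT' : bounded_op T'.
  split; first by move=> a u v; apply: (can_inj TK); rewrite lT !T'K.
  by exists 1 => u; rewrite mul1r -{2}(T'K u) nT.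
rewrite /adjoint_op; case: xgetP => [S _ [bS hS]|h].
  apply/funext => u; apply: inner_nondeg => w.
  by rewrite innerC -hS -{1}(T'K u) iT -innerC.
exfalso; apply: (h T'); split=> // u v.
by rewrite -{1}(T'K v) iT.
Qed.

Lemma adjoint_unitaryP T : unitary_op T ->
  unitary_op (adjoint_op T).
Proof.
move=> uT; have [lT iT sT] := uT.
have nT u : norm2 (T u) = norm2 u by rewrite /norm2 iT.
have TI : injective T.
  move=> u v e; apply/eqP; rewrite -subr_eq0; apply/eqP/norm2_eq0.
  by rewrite -nT linB // e subrr norm20.
pose T' v := xget 0 [set u | T u = v].
have T'K : cancel T' T by move=> v; rewrite /T'; case: xgetP => // h; have [u /h] := sT v.
have TK : cancel T T' by move=> u; apply: TI; rewrite T'K.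
rewrite (adjoint_unitary uT TK T'K); split.
- by move=> a u v; apply: TI; rewrite lT !T'K.
- by move=> u v; rewrite -{2}(T'K u) -{2}(T'K v) iT.
- by move=> v; exists (T v).
Qed.

End Adjoint.

(** * Tensor products *)

Section ProductIntegral.
Context (R : realType) d1 d2 (X : measurableType d1) (Y : measurableType d2).
Variables (mu : {sigma_finite_measure set X -> \bar R}).
Variables (nu : {sigma_finite_measure set Y -> \bar R}).
Local Notation pm := (prod_measure mu nu).

Lemma prod_tonelli1 (f : X * Y -> \bar R) : measurable_fun setT f ->
  (forall z, 0 <= f z)%E ->
  (\int[pm]_z f z = \int[mu]_x \int[nu]_y f (x, y))%E.
Proof. by move=> mf f0; rewrite /prod_measure fubini_tonelli1. Qed.

Lemma prod_tonelli2 (f : X * Y -> \bar R) : measurable_fun setT f ->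
  (forall z, 0 <= f z)%E ->
  (\int[pm]_z f z = \int[nu]_y \int[mu]_x f (x, y))%E.
Proof.
by move=> mf f0; rewrite /prod_measure fubini_tonelli1 // fubini_tonelli.
Qed.

Lemma ae_fst (P : X -> Prop) : {ae mu, forall x, P x} -> {ae pm, forall z, P z.1}.
Proof.
move=> [N [mN N0 sub]]; exists (N `*` setT); split; first exact: measurableX.
  by rewrite /prod_measure product_measure1E // [X in (X * _)%E](N0 : mu N = 0%E) mul0e.
by move=> [x y] /= /sub.
Qed.

Lemma ae_snd (P : Y -> Prop) : {ae nu, forall x, P x} -> {ae pm, forall z, P z.2}.
Proof.
move=> [N [mN N0 sub]]; exists (setT `*` N); split; first exact: measurableX.
  by rewrite /prod_measure product_measure1E // [X in (_ * X)%E](N0 : nu N = 0%E) mule0.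
by move=> [x y] /= /sub.
Qed.

Lemma cmeasurable_fst (f : X -> R[i]) : cmeasurable f ->
  cmeasurable (fun z : X * Y => f z.1).
Proof.
by move=> [m1 m2]; split;
  [exact: (measurableT_comp m1 measurable_fst)|exact: (measurableT_comp m2 measurable_fst)].
Qed.

Lemma cmeasurable_snd (f : Y -> R[i]) : cmeasurable f ->
  cmeasurable (fun z : X * Y => f z.2).
Proof.
by move=> [m1 m2]; split;
  [exact: (measurableT_comp m1 measurable_snd)|exact: (measurableT_comp m2 measurable_snd)].
Qed.

Lemma cmeasurable_pair2 (f : X * Y -> R[i]) y : cmeasurable f ->
  cmeasurable (fun x => f (x, y)).
Proof.
by move=> [m1 m2]; split;
  [exact: (measurableT_comp m1 (pair2_measurable y))|exact: (measurableT_comp m2 (pair2_measurable y))].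
Qed.

Lemma sqint_tensor (f : X -> R[i]) (g : Y -> R[i]) :
  f \in sqint mu -> g \in sqint nu -> (fun z => f z.1 * g z.2) \in sqint pm.
Proof.
move=> hf hg; have /sqintP[mf sf] := hf; have /sqintP[mg sg] := hg.
have mfg : cmeasurable (fun z : X * Y => f z.1 * g z.2).
  by apply: cmeasurableM; [exact: cmeasurable_fst|exact: cmeasurable_snd].
apply/sqintP; split => //.
rewrite prod_tonelli1; last 2 first.
- exact: measurable_abs2.
- by move=> z; rewrite lee_fin abs2_ge0.
rewrite (_ : (\int[mu]_x _)%E =
    (\int[mu]_x ((abs2 (f x))%:E * \int[nu]_y (abs2 (g y))%:E))%E); last first.
  apply: eq_integral => x _ /=; rewrite -ge0_integralZl_EFin ?abs2_ge0 //.
  - by apply: eq_integral => y _; rewrite abs2M EFinM.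
  - by move=> y _; rewrite lee_fin abs2_ge0.
  - exact: measurable_abs2.
rewrite -(fineK (fin_num_sqint hg)) ge0_integralZr //.
- by rewrite -(fineK (fin_num_sqint hf)) -EFinM ltry.
- exact: measurable_abs2.
- by move=> y _; rewrite lee_fin abs2_ge0.
- by rewrite lee_fin fine_ge0 // integral_ge0 // => y _; rewrite lee_fin abs2_ge0.
Qed.

Lemma integrable_prod (f : X -> R) (g : Y -> R) :
  mu.-integrable setT (EFin \o f) -> nu.-integrable setT (EFin \o g) ->
  pm.-integrable setT (fun z => (f z.1 * g z.2)%:E) /\
  (\int[pm]_z (f z.1 * g z.2) = \int[mu]_x f x * \int[nu]_y g y)%R.
Proof.
move=> If Ig; have /integrableP[mf sf] := If; have /integrableP[mg sg] := Ig.
have mfg : measurable_fun setT (fun z : X * Y => (f z.1 * g z.2)%:E).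
  apply/measurable_EFinP; apply: measurable_funM.
    by move/measurable_EFinP: mf => mf; exact: (measurableT_comp mf measurable_fst).
  by move/measurable_EFinP: mg => mg; exact: (measurableT_comp mg measurable_snd).
have I : pm.-integrable setT (fun z => (f z.1 * g z.2)%:E).
  apply/integrableP; split => //.
  rewrite prod_tonelli1 //; last exact: measurableT_comp.
  rewrite (_ : (\int[mu]_x _)%E =
      (\int[mu]_x (`|(f x)%:E| * \int[nu]_y `|(g y)%:E|))%E); last first.
    apply: eq_integral => x _ /=; rewrite -ge0_integralZl_EFin //.
      by apply: eq_integral => y _; rewrite normrM EFinM.
    by apply: measurableT_comp; [|exact: (measurableT_comp (@measurable_abse R setT) mg)] || exact: (measurableT_comp (@abse_measurable R setT) mg).
  have gfin : (\int[nu]_y `|(g y)%:E| \is a fin_num)%E.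
    by rewrite ge0_fin_numE // integral_ge0.
  have ffin : (\int[mu]_y `|(f y)%:E| \is a fin_num)%E.
    by rewrite ge0_fin_numE // integral_ge0.
  rewrite -(fineK gfin) ge0_integralZr //.
  - by rewrite -(fineK ffin) -EFinM ltry.
  - exact: measurableT_comp.
  - by rewrite lee_fin fine_ge0 // integral_ge0.
split=> //; rewrite /Rintegral -fubini1 // /fubini_F.
rewrite (_ : (\int[mu]_x _)%E =
    (\int[mu]_x ((\int[nu]_y g y)%:E * (f x)%:E))%E); last first.
  apply: eq_integral => x _ /=; rewrite muleC.
  rewrite (_ : (\int[nu]_y g y)%:E = \int[nu]_y (g y)%:E)%E; last first.
    by rewrite /Rintegral fineK // integrable_fin_num.
  by rewrite -integralZl //; apply: eq_integral => y _; rewrite EFinM.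
by rewrite integralZl // fineM ?integrable_fin_num //= mulrC.
Qed.

Lemma cintegral_prod (f : X -> R[i]) (g : Y -> R[i]) :
  cintegrable mu f -> cintegrable nu g ->
  cintegral pm (fun z => f z.1 * g z.2) = cintegral mu f * cintegral nu g.
Proof.
move=> [f1 f2] [g1 g2].
have [a1 b1] := integrable_prod f1 g1; have [a2 b2] := integrable_prod f2 g2.
have [a3 b3] := integrable_prod f1 g2; have [a4 b4] := integrable_prod f2 g1.
apply: eq_cplx; rewrite ?Re_mul ?Im_mul /=.
  rewrite -b1 -b2 -RintegralB //.
  by apply: eq_Rintegral => z _; rewrite Re_mul.
rewrite -b3 -b4 -RintegralD //.
by apply: eq_Rintegral => z _; rewrite Im_mul.
Qed.

Lemma inner_tensor (u u' : L2 mu) (v v' : L2 nu) :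
  inner (tensor u v) (tensor u' v') = inner u u' * inner v v'.
Proof.
rewrite inner_class; try by apply: sqint_tensor; exact: L2_repr_sqint.
rewrite !innerE -cintegral_prod; last 2 first.
- by apply: sqint_mul_integrable; exact: L2_repr_sqint.
- by apply: sqint_mul_integrable; exact: L2_repr_sqint.
by congr cintegral; apply/funext => z; rewrite conjcM mulrACA.
Qed.

Lemma norm2_tensor (u : L2 mu) (v : L2 nu) :
  norm2 (tensor u v) = norm2 u * norm2 v.
Proof.
apply/eqP; rewrite -(@eqrXn2 _ 2) ?mulr_ge0 ?norm2_ge0 //; apply/eqP.
by apply: (@complexI R); rewrite -norm2_sqr inner_tensor exprMn rmorphM !norm2_sqr.
Qed.

Lemma tensorDl (a : R[i]) (u u' : L2 mu) (v : L2 nu) :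
  tensor (a *: u + u') v = a *: tensor u v + tensor u' v.
Proof.
have h w z : (fun xy : X * Y => L2_repr (w : L2 mu) xy.1 * L2_repr (z : L2 nu) xy.2)
    \in sqint pm by apply: sqint_tensor; exact: L2_repr_sqint.
rewrite /tensor -L2classD //; apply: eq_L2class => //; first exact: sqintD.
by apply: filterS (ae_fst (L2_reprD a u u')) => z ->; rewrite mulrDl mulrA.
Qed.

Lemma tensorDr (a : R[i]) (u : L2 mu) (v v' : L2 nu) :
  tensor u (a *: v + v') = a *: tensor u v + tensor u v'.
Proof.
have h w z : (fun xy : X * Y => L2_repr (w : L2 mu) xy.1 * L2_repr (z : L2 nu) xy.2)
    \in sqint pm by apply: sqint_tensor; exact: L2_repr_sqint.
rewrite /tensor -L2classD //; apply: eq_L2class => //; first exact: sqintD.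
by apply: filterS (ae_snd (L2_reprD a v v')) => z ->; rewrite mulrDr mulrCA.
Qed.


(** Measurability of partial integrals is a statement on nonnegative integrands; applying it to the
    positive and the negative part gives the general case without integrability. *)
Lemma measurable_int_fst (h : X * Y -> R) : measurable_fun setT h ->
  measurable_fun setT (fun y => (\int[mu]_x (h (x, y))%:E)%E).
Proof.
move=> mh; have mh' : measurable_fun setT (EFin \o h) by exact/measurable_EFinP.
have mp : measurable_fun setT (fubini_G mu (EFin \o h)^\+%E).
  by apply: measurable_fun_fubini_tonelli_G => //; exact: measurable_funepos.
have mn : measurable_fun setT (fubini_G mu (EFin \o h)^\-%E).
  by apply: measurable_fun_fubini_tonelli_G => //; exact: measurable_funeneg.
rewrite (_ : (fun y => _) = (fun y => (fubini_G mu (EFin \o h)^\+ y -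
    fubini_G mu (EFin \o h)^\- y)%E)); first exact: emeasurable_funB.
by apply/funext => y; rewrite integralE /fubini_G; congr (_ - _)%E;
  apply: eq_integral => x _; rewrite ?funeposE ?funenegE.
Qed.

Lemma cmeasurable_int_fst (h : X * Y -> R[i]) : cmeasurable h ->
  cmeasurable (fun y => cintegral mu (fun x => h (x, y))).
Proof.
move=> [m1 m2]; split => /=; apply: (measurableT_comp (@fine_measurable R setT measurableT)).
  exact: measurable_int_fst m1.
exact: measurable_int_fst m2.
Qed.

Lemma Rintegral_fubini2 (h : X * Y -> R) : pm.-integrable setT (EFin \o h) ->
  (\int[pm]_z h z = \int[nu]_y \int[mu]_x h (x, y))%R.
Proof.
move=> Ih; have /integrableP[mh _] := Ih.
rewrite /Rintegral -[in LHS]fubini2 //; congr fine; apply: ae_eq_integral => //.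
- by apply: (measurable_int_fst (h := h)); exact/measurable_EFinP.
- apply/measurable_EFinP; apply: (measurableT_comp (@fine_measurable R setT measurableT)).
  by apply: (measurable_int_fst (h := h)); exact/measurable_EFinP.
have := ae_integrable2 Ih.
by apply: filterS => y h1 _; rewrite fineK // integrable_fin_num.
Qed.

Lemma cintegral_fubini2 (h : X * Y -> R[i]) : cintegrable pm h ->
  cintegral pm h = cintegral nu (fun y => cintegral mu (fun x => h (x, y))).
Proof.
by move=> [h1 h2]; apply: eq_cplx => /=; rewrite Rintegral_fubini2.
Qed.

Lemma sqint_section2 (f : X * Y -> R[i]) : f \in sqint pm ->
  {ae nu, forall y, (fun x => f (x, y)) \in sqint mu}.
Proof.
move=> /sqintP[mf sf]; have m2 := measurable_abs2 mf.
rewrite prod_tonelli2 // in sf; last by move=> z; rewrite lee_fin abs2_ge0.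
have : nu.-integrable setT (fun y => (\int[mu]_x (abs2 (f (x, y)))%:E)%E).
  apply/integrableP; split.
    by apply: (measurable_int_fst (h := fun z => abs2 (f z))); exact/measurable_EFinP.
  rewrite (eq_integral (fun y => (\int[mu]_x (abs2 (f (x, y)))%:E)%E)) // => y _.
  by rewrite gee0_abs // integral_ge0 // => x _; rewrite lee_fin abs2_ge0.
move/(integrable_ae measurableT); apply: filterS => y /(_ I) h.
apply/sqintP; split; first exact: cmeasurable_pair2.
by rewrite -ge0_fin_numE // integral_ge0 // => x _; rewrite lee_fin abs2_ge0.
Qed.

(** The partial inner product of [F] with [u] in the first leg: [contract u] is the adjoint of
    [v |-> tensor u v]. *)
Definition contract_fun (u : L2 mu) (F : L2 pm) (y : Y) : R[i] :=
  cintegral mu (fun x => L2_repr F (x, y) * conjc (L2_repr u x)).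

Definition contract (u : L2 mu) (F : L2 pm) : L2 nu :=
  L2class nu (contract_fun u F).

Lemma contract_fun_measurable (u : L2 mu) (F : L2 pm) : cmeasurable (contract_fun u F).
Proof.
apply: (@cmeasurable_int_fst (fun z => L2_repr F z * conjc (L2_repr u z.1))).
apply: cmeasurableM; first exact: L2_repr_measurable.
by apply: cmeasurableJ; apply: cmeasurable_fst; exact: L2_repr_measurable.
Qed.

(** Cauchy-Schwarz on the fibre over [y] bounds the value by |u| times the norm of the fibre of [F],
    and Tonelli sums these norms to that of [F]. A fibre is known to be square integrable only for
    almost every [y], hence the almost everywhere comparison. *)
Lemma contract_sqint (u : L2 mu) (F : L2 pm) : contract_fun u F \in sqint nu.
Proof.
have mc := contract_fun_measurable u F.
have hF := L2_repr_sqint F; have /sqintP[mF sF] := hF.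
have m2 := measurable_abs2 mF.
apply/sqintP; split => //.
have mN : measurable_fun setT (fun y => (\int[mu]_x (abs2 (L2_repr F (x, y)))%:E)%E).
  by apply: (measurable_int_fst (h := fun z => abs2 (L2_repr F z))); exact/measurable_EFinP.
have N0 y : (0 <= \int[mu]_x (abs2 (L2_repr F (x, y)))%:E)%E.
  by apply: integral_ge0 => x _; rewrite lee_fin abs2_ge0.
apply: (@le_lt_trans _ _ (\int[nu]_y ((norm2 u ^+ 2)%:E *
    \int[mu]_x (abs2 (L2_repr F (x, y)))%:E))%E).
  apply: ae_ge0_le_integral => //.
  - by move=> y _; rewrite lee_fin abs2_ge0.
  - exact: measurable_abs2.
  - by move=> y _; rewrite mule_ge0 // lee_fin sqr_ge0.
  - exact: measurable_funeM.
  apply: filterS (sqint_section2 hF) => y hy _.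
  have -> : contract_fun u F y = inner (L2class mu (fun x => L2_repr F (x, y))) u.
    by rewrite -[in RHS](L2_reprK u) inner_class ?L2_repr_sqint.
  rewrite -norm2_class // -EFinM lee_fin -sqr_cabs -exprMn.
  by rewrite ler_sqr ?nnegrE ?mulr_ge0 ?norm2_ge0 ?cabs_ge0 // mulrC cauchy_schwarz.
rewrite ge0_integralZl_EFin ?sqr_ge0 //.
rewrite prod_tonelli2 // in sF; last by move=> z; rewrite lee_fin abs2_ge0.
by rewrite lte_mul_pinfty ?lee_fin ?sqr_ge0.
Qed.

(** Fubini. The relation characterizes [contract], whose linearity and norm bound follow from it by
    duality. *)
Lemma inner_contract (u : L2 mu) (F : L2 pm) (v : L2 nu) :
  inner (contract u F) v = inner F (tensor u v).
Proof.
rewrite -{1}(L2_reprK v) inner_class ?contract_sqint ?L2_repr_sqint //.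
rewrite -{2}(L2_reprK F) [RHS]inner_class; last 2 first.
- exact: L2_repr_sqint.
- by apply: sqint_tensor; exact: L2_repr_sqint.
rewrite cintegral_fubini2; last first.
  apply: sqint_mul_integrable; first exact: L2_repr_sqint.
  by apply: sqint_tensor; exact: L2_repr_sqint.
apply: eq_cintegral_ae.
- apply: cmeasurableM; first exact: contract_fun_measurable.
  by apply: cmeasurableJ; exact: L2_repr_measurable.
- apply: (@cmeasurable_int_fst (fun z => L2_repr F z * conjc (L2_repr u z.1 * L2_repr v z.2))).
  apply: cmeasurableM; first exact: L2_repr_measurable.
  apply: cmeasurableJ; apply: cmeasurableM.
    by apply: cmeasurable_fst; exact: L2_repr_measurable.
  by apply: cmeasurable_snd; exact: L2_repr_measurable.
apply: filterS (sqint_section2 (L2_repr_sqint F)) => y hy /=.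
rewrite mulrC -cintegralZ; last first.
  by apply: sqint_mul_integrable => //; exact: L2_repr_sqint.
by congr cintegral; apply/funext => x; rewrite conjcM; ring.
Qed.

Lemma contract_linear (u : L2 mu) : linear (contract u).
Proof.
move=> a F G; apply: inner_nondeg => w.
rewrite (inner_contract u (a *: F + G) w) innerDl; apply: esym.
apply: etrans (innerDl _ _ _ _) _.
by apply: f_equal2 (f_equal _ (inner_contract u F w)) (inner_contract u G w).
Qed.

Lemma norm2_contract (u : L2 mu) (F : L2 pm) :
  norm2 (contract u F) <= norm2 u * norm2 F.
Proof.
apply: norm2_le_inner => [|v]; first by rewrite mulr_ge0 ?norm2_ge0.
rewrite inner_contract (le_trans (cauchy_schwarz _ _)) // norm2_tensor.
by rewrite mulrA [norm2 u * _]mulrC.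
Qed.

End ProductIntegral.

(** * The discrete leg L^2(I_q) *)

Section CountingIq.
Variables (R : realType) (q : R).
Local Notation I := (Iq q).


Lemma Iq_enumeration : exists f : nat -> I, forall t, exists n, f n = t.
Proof.
pose g (b : bool) (k : int) : R := if b then q ^ k else - q ^ k.
pose f n : I := if choice.unpickle n is Some (b, k) then insubd (point : I) (g b k)
  else point.
exists f => t; have /set_mem := valP t; case=> [[k _ tE]|[k tE]].
  exists (choice.pickle (false, Posz k)); rewrite /f choice.pickleK.
  by rewrite /g -exprnP -tE valKd.
exists (choice.pickle (true, k)); rewrite /f choice.pickleK.
by rewrite /g -tE valKd.
Qed.

Lemma mu_I_set1 (t : I) : mu_I q [set t] = 1%E.
Proof.
rewrite /mu_I /counting asboolT; last exact: finite_set1.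
by rewrite fset_set1 cardfs1.
Qed.


(** An enumeration of I_q may repeat points, so each point is attached to the first index at which
    it occurs: these sets are empty or singletons, and they partition I_q. *)
Definition Iq_fresh (f : nat -> I) (n : nat) : set I :=
  [set t | f n = t /\ forall i, (i < n)%N -> f i <> t].

Lemma integral_mu_I (phi : I -> \bar R) : (forall t, 0 <= phi t)%E ->
  (\int[mu_I q]_t phi t = \esum_(t in setT) phi t)%E.
Proof.
move=> p0; have [f fs] := Iq_enumeration.
have tF : trivIset setT (Iq_fresh f).
  move=> i j _ _ [t [[ti hi] [tj hj]]].
  by have [ij|ij|//] := ltngtP i j; [have := hj _ ij|have := hi _ ij].
have UF : \bigcup_k Iq_fresh f k = setT.
  apply/seteqP; split=> // t _; have [n nt] := fs t.
  have ex : exists n, f n == t by exists n; apply/eqP.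
  exists (ex_minn ex) => //; case: ex_minnP => m /eqP mt hm; split=> // i im it.
  by have := hm i; rewrite it eqxx leqNgt im => /(_ isT).
rewrite -UF ge0_integral_bigcup //.
rewrite esum_bigcupT // nneseries_esumT; last by move=> n; apply: integral_ge0.
apply: eq_esum => n _.
have [[t [nt ht]]|h] := pselect (exists t, Iq_fresh f n t); last first.
  have -> : Iq_fresh f n = set0 by apply/seteqP; split=> // t ?; apply: h; exists t.
  by rewrite integral_set0 esum_set0.
have -> : Iq_fresh f n = [set t].
  by apply/seteqP; split=> [s [ns _]|s -> //]; rewrite /= -nt -ns.
rewrite esum_set1 // (_ : (\int[mu_I q]_(x in _) _)%E =
    (\int[mu_I q]_(x in [set t]) cst (phi t) x)%E); last first.
  by apply: eq_integral => x; rewrite inE => ->.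
by rewrite integral_cst // [X in (_ * X)%E](mu_I_set1 t) mule1.
Qed.

(** A singleton has mass 1 for the counting measure, so a null set is empty. *)
Lemma ae_mu_I (P : I -> Prop) : {ae mu_I q, forall t, P t} -> forall t, P t.
Proof.
move=> [N [mN N0 sub]] t; apply: contrapT => nP.
have st : [set t] `<=` N by move=> _ ->; exact: sub.
have : (mu_I q [set t] <= mu_I q N)%E by apply: le_measure; rewrite ?inE.
by rewrite (mu_I_set1 t) (N0 : mu_I q N = 0%E) lee_fin ler10.
Qed.

Definition delta_fun (p : R) (x : I) : R[i] := (val x == p)%:R.

Lemma cmeasurable_Iq (f : I -> R[i]) : cmeasurable f.
Proof. by split=> _ B mB; rewrite setTI. Qed.

Lemma esum_delta (phi : I -> \bar R) (t : I) : (0 <= phi t)%E ->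
  (forall s, s <> t -> phi s = 0%E) -> (\esum_(s in setT) phi s = phi t)%E.
Proof.
move=> p0 ph; rewrite -[RHS]esum_set1 // [RHS]esum_mkcond.
apply: eq_esum => s _; case: ifPn => //; rewrite notin_setE => /= h.
exact: ph.
Qed.

Lemma esum_delta0 (phi : I -> \bar R) : (forall s, phi s = 0%E) ->
  (\esum_(s in setT) phi s = 0)%E.
Proof. by move=> h; apply: esum1 => s _. Qed.

Lemma abs2_nat_bool (b : bool) : abs2 (b%:R : R[i]) = b%:R.
Proof. by case: b; rewrite /abs2 /= ?expr0n ?expr1n ?addr0. Qed.

Lemma delta_sqint p : delta_fun p \in sqint (mu_I q).
Proof.
apply/sqintP; split; first exact: cmeasurable_Iq.
have p0 : forall t, (0 <= (abs2 (delta_fun p t))%:E)%E by move=> t; rewrite lee_fin abs2_ge0.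
rewrite integral_mu_I //; have [[t tp]|h] := pselect (exists t : I, val t = p).
  rewrite (@esum_delta _ t (p0 t)) ?ltry // => s st; rewrite /delta_fun abs2_nat_bool.
  by case: eqP => // e; case: st; apply: val_inj; rewrite tp.
rewrite esum_delta0 // => s; rewrite /delta_fun abs2_nat_bool.
by case: eqP => // e; case: h; exists s.
Qed.

Lemma delta_out p : ~ Iq_set q p -> delta q p = 0.
Proof.
move=> h; rewrite -L2class0; congr L2class; apply/funext => x.
by case: eqP => // e; case: h; rewrite -e; apply/set_mem/valP.
Qed.

Lemma inner_delta (s t : I) : inner (delta q (val s)) (delta q (val t)) = (s == t)%:R.
Proof.
rewrite inner_class ?delta_sqint //.
have [->|st] := eqVneq s t.
  rewrite -inner_class ?delta_sqint // inner_self ?delta_sqint //.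
  rewrite integral_mu_I => [|x]; last by rewrite lee_fin abs2_ge0.
  rewrite (@esum_delta _ t) => [||x xt].
  - by rewrite /delta_fun eqxx abs2_nat_bool.
  - by rewrite lee_fin abs2_ge0.
  - by rewrite abs2_nat_bool; case: eqP => // /val_inj.
rewrite (_ : (fun x => _) = (fun=> 0)); last first.
  apply/funext => x; case: eqP => [e|]; last by rewrite mul0r.
  case: eqP => [e'|]; last by rewrite conjc0 mulr0.
  by move: st; rewrite -(inj_eq val_inj) -e -e' eqxx.
by apply: eq_cplx; rewrite /= /Rintegral integral0.
Qed.

Lemma norm2_delta (t : I) : norm2 (delta q (val t)) = 1.
Proof. by rewrite /norm2 inner_delta eqxx /= sqrtr1. Qed.

End CountingIq.

(** Completeness stated as density of finite combinations, given by lists: identities between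
    bounded operators or forms extend from the family by continuity. *)
Definition total_family (R : realType) d (X : measurableType d)
  (mu : {measure set X -> \bar R}) (J : Type) (E : J -> L2 mu) : Prop :=
  forall (u : L2 mu) (e : R), 0 < e ->
    exists s : seq (R[i] * J), norm2 (u - \sum_(c <- s) c.1 *: E c.2) < e.

(** * Elements of L^2(X * I_q) as square-summable families of slices *)

Section ProductIq.
Variables (R : realType) (q : R).
Local Notation I := (Iq q).
Context d (X : measurableType d) (mu : {sigma_finite_measure set X -> \bar R}).
Local Notation pm := (prod_measure mu (mu_I q)).

(** From left to right, the section of a null set at [t] has mass at most that of the set because
    [[set t]] has mass 1; conversely the exceptional set is a countable union of null sections. *)
Lemma ae_prod_Iq (P : X * I -> Prop) :
  {ae pm, forall z, P z} <-> forall t, {ae mu, forall x, P (x, t)}.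
Proof.
split=> [[N [mN N0 sub]] t|h].
  have mS : measurable ((pair^~ t) @^-1` N).
    by rewrite -[X in measurable X]setTI; exact: pair2_measurable.
  exists ((pair^~ t) @^-1` N); split => //; last by move=> x /sub.
  have : (pm (((pair^~ t) @^-1` N) `*` [set t]) <= pm N)%E.
    apply: le_measure; rewrite ?inE //; first exact: measurableX.
    by move=> [x s] [/= ? ->].
  rewrite [pm N]N0 /prod_measure product_measure1E //.
  rewrite [X in (_ * X)%E](mu_I_set1 t) mule1 => h.
  by apply/eqP; rewrite eq_le h measure_ge0.
have [f fs] := Iq_enumeration q.
have : pm.-negligible (\bigcup_n [set z | z.2 = f n /\ ~ P z]).
  apply: negligible_bigcup => n; have [N [mN N0 sub]] := h (f n).
  exists (N `*` [set f n]); split; first exact: measurableX.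
    have e : pm (N `*` [set f n]) = (mu N * mu_I q [set f n])%E.
      by rewrite /prod_measure product_measure1E.
    by rewrite [LHS]e [mu N]N0 mul0e.
  by move=> [x t] [/= -> nP]; split=> //; exact: sub.
apply: negligibleS => -[x t] nP; have [n nt] := fs t.
by exists n => //; split.
Qed.

Lemma measurable_prod_Iq d' (Z : measurableType d') (F : X * I -> Z) :
  (forall t, measurable_fun setT (fun x => F (x, t))) -> measurable_fun setT F.
Proof.
move=> h _ B mB; rewrite setTI; have [f fs] := Iq_enumeration q.
have -> : F @^-1` B = \bigcup_n (((fun x => F (x, f n)) @^-1` B) `*` [set f n]).
  apply/seteqP; split=> [[x t] Fx|[x t] [n _ [/= ? -> //]]].
  by have [n nt] := fs t; exists n => //; rewrite /= nt.
apply: bigcup_measurable => n _; apply: measurableX => //.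
by rewrite -[X in measurable X]setTI; apply: h.
Qed.

Lemma cmeasurable_prod_Iq (F : X * I -> R[i]) :
  (forall t, cmeasurable (fun x => F (x, t))) -> cmeasurable F.
Proof. by move=> h; split; apply: measurable_prod_Iq => t; have [] := h t. Qed.

Lemma sqint_section_Iq (F : X * I -> R[i]) t : F \in sqint pm ->
  (fun x => F (x, t)) \in sqint mu.
Proof. by move/sqint_section2/ae_mu_I; exact. Qed.

Lemma sqint_prod_Iq (F : X * I -> R[i]) :
  (forall t, (fun x => F (x, t)) \in sqint mu) ->
  (\esum_(t in setT) \int[mu]_x (abs2 (F (x, t)))%:E < +oo)%E ->
  F \in sqint pm.
Proof.
move=> h s; have mF : cmeasurable F.
  by apply: cmeasurable_prod_Iq => t; have /sqintP[] := h t.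
apply/sqintP; split => //; rewrite prod_tonelli2 //.
- rewrite integral_mu_I // => t; apply: integral_ge0 => x _.
  by rewrite lee_fin abs2_ge0.
- exact: measurable_abs2.
- by move=> z; rewrite lee_fin abs2_ge0.
Qed.

Lemma norm2_prod_Iq (F : X * I -> R[i]) : F \in sqint pm ->
  ((norm2 (L2class pm F) ^+ 2)%:E =
   \esum_(t in setT) ((norm2 (L2class mu (fun x => F (x, t)))) ^+ 2)%:E)%E.
Proof.
move=> hF; have /sqintP[mF _] := hF; rewrite norm2_class // prod_tonelli2 //.
- rewrite integral_mu_I => [|t]; last first.
    by apply: integral_ge0 => x _; rewrite lee_fin abs2_ge0.
  by apply: eq_esum => t _; rewrite norm2_class // sqint_section_Iq.
- exact: measurable_abs2.
- by move=> z; rewrite lee_fin abs2_ge0.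
Qed.

(* Locked, so that unification never compares two slices by unfolding them. *)
Fact slice_at_key : unit. Proof. by []. Qed.
Definition slice_at : L2 pm -> I -> L2 mu :=
  locked_with slice_at_key (fun F t => L2class mu (fun x => L2_repr F (x, t))).

Lemma slice_atE F t : slice_at F t = L2class mu (fun x => L2_repr F (x, t)).
Proof. by rewrite /slice_at unlock. Qed.

Lemma slice_at_sqint (F : L2 pm) (t : I) : (fun x => L2_repr F (x, t)) \in sqint mu.
Proof. by apply: sqint_section_Iq; exact: L2_repr_sqint. Qed.

Lemma slice_at_class (F : X * I -> R[i]) t : F \in sqint pm ->
  slice_at (L2class pm F) t = L2class mu (fun x => F (x, t)).
Proof.
move=> hF; rewrite slice_atE; apply: eq_L2class; [exact: slice_at_sqint|exact: sqint_section_Iq|].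
exact: ((ae_prod_Iq (fun z => L2_repr (L2class pm F) z = F z)).1 (L2class_repr hF)).
Qed.

Lemma slice_atD a (F G : L2 pm) t :
  slice_at (a *: F + G) t = a *: slice_at F t + slice_at G t.
Proof.
rewrite !slice_atE -L2classD; [|exact: slice_at_sqint|exact: slice_at_sqint].
apply: eq_L2class; first exact: slice_at_sqint.
  by apply: sqintD; exact: slice_at_sqint.
have := (ae_prod_Iq (fun z => L2_repr (a *: F + G) z =
  a * L2_repr F z + L2_repr G z)).1 (L2_reprD a F G).
exact.
Qed.

Lemma slice_at_inj (F G : L2 pm) : (forall t, slice_at F t = slice_at G t) -> F = G.
Proof.
move=> h; rewrite -(L2_reprK F) -(L2_reprK G); apply: eq_L2class; try exact: L2_repr_sqint.
apply/ae_prod_Iq => t; apply: (L2class_eq_ae (slice_at_sqint F t) (slice_at_sqint G t)).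
by rewrite -!slice_atE h.
Qed.

Lemma slice_at_tensor (u : L2 mu) (v : L2 (mu_I q)) t :
  slice_at (tensor u v) t = L2_repr v t *: u.
Proof.
rewrite /tensor slice_at_class /=; last by apply: sqint_tensor; exact: L2_repr_sqint.
rewrite -[in RHS](L2_reprK u) -[RHS]addr0 -[0 in RHS]L2class0 -L2classD ?L2_repr_sqint ?sqint0 //.
by congr L2class; apply/funext => x; rewrite addr0 mulrC.
Qed.

Lemma norm2_slices (F : L2 pm) :
  ((norm2 F ^+ 2)%:E = \esum_(t in setT) (norm2 (slice_at F t) ^+ 2)%:E)%E.
Proof.
have := norm2_prod_Iq (L2_repr_sqint F); rewrite L2_reprK => ->.
by apply: eq_esum => t _; rewrite slice_atE.
Qed.

Lemma L2_repr_delta (s t : I) : L2_repr (delta q (val s)) t = (s == t)%:R.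
Proof.
rewrite (ae_mu_I (L2class_repr (delta_sqint q (val s))) t) /delta_fun.
by rewrite (inj_eq val_inj) eq_sym.
Qed.


Lemma esum_Zl (C : R) (phi : I -> R) : 0 <= C -> (forall t, 0 <= phi t) ->
  (\esum_(t in setT) (C * phi t)%:E = C%:E * \esum_(t in setT) (phi t)%:E)%E.
Proof.
move=> C0 p0; rewrite -!integral_mu_I => [|t|t]; last 2 first.
- by rewrite lee_fin.
- by rewrite lee_fin mulr_ge0.
by rewrite -ge0_integralZl_EFin // => t _; rewrite lee_fin.
Qed.

Fact slicewise_key : unit. Proof. by []. Qed.
(** An explicit model of T (x) 1. Since [amplify] chooses an operator by its specification, a
    witness is required for that choice to mean anything. *)
Definition slicewise : (L2 mu -> L2 mu) -> L2 pm -> L2 pm :=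
  locked_with slicewise_key
    (fun T F => L2class pm (fun z => L2_repr (T (slice_at F z.2)) z.1)).

Lemma slicewiseE T F :
  slicewise T F = L2class pm (fun z => L2_repr (T (slice_at F z.2)) z.1).
Proof. by rewrite /slicewise unlock. Qed.

Lemma slicewise_sqint T (F : L2 pm) : bounded_op T ->
  (fun z => L2_repr (T (slice_at F z.2)) z.1) \in sqint pm.
Proof.
move=> bT; have [C C0 hC] := bounded_pos bT.
apply: sqint_prod_Iq => [t|]; first exact: (L2_repr_sqint (T (slice_at F t))).
apply: (@le_lt_trans _ _ (\esum_(t in setT) (C ^+ 2 * norm2 (slice_at F t) ^+ 2)%:E)%E).
  apply: le_esum => t _ /=; rewrite -norm2_class ?L2_repr_sqint // L2_reprK lee_fin.
  by rewrite -exprMn ler_sqr ?nnegrE ?mulr_ge0 ?norm2_ge0 // ltW.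
rewrite esum_Zl ?sqr_ge0 // => [|t]; last exact: sqr_ge0.
by rewrite -norm2_slices -EFinM ltry.
Qed.

Lemma slice_at_slicewise T (F : L2 pm) t : bounded_op T ->
  slice_at (slicewise T F) t = T (slice_at F t).
Proof.
move=> bT; rewrite slicewiseE slice_at_class ?slicewise_sqint //=.
exact: L2_reprK.
Qed.

Lemma slicewise_bounded T : bounded_op T -> bounded_op (slicewise T).
Proof.
move=> bT; split.
  move=> a F G; apply: slice_at_inj => t.
  by rewrite slice_at_slicewise // !slice_atD !slice_at_slicewise // (proj1 bT).
have [C C0 hC] := bounded_pos bT; exists C => F.
rewrite -ler_sqr ?nnegrE ?mulr_ge0 ?norm2_ge0 //; last exact: ltW.
rewrite exprMn -lee_fin [leRHS]EFinM (norm2_slices (slicewise T F)) (norm2_slices F).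
rewrite -esum_Zl ?sqr_ge0 // => [|t]; last exact: sqr_ge0.
apply: le_esum => t _; rewrite slice_at_slicewise // lee_fin -exprMn.
by rewrite ler_sqr ?nnegrE ?mulr_ge0 ?norm2_ge0 // ltW.
Qed.

Lemma slicewise_tensor T u v : bounded_op T ->
  slicewise T (tensor u v) = tensor (T u) v.
Proof.
move=> bT; apply: slice_at_inj => t.
by rewrite slice_at_slicewise // !slice_at_tensor linZ //; case: bT.
Qed.

Lemma amplify_bounded T : bounded_op T -> bounded_op (@amplify R _ _ _ _ mu (mu_I q) T).
Proof.
move=> bT; rewrite /amplify; case: xgetP => [S _ []//|h].
by case: (h (slicewise T)); split=> [|u v]; [exact: slicewise_bounded|exact: slicewise_tensor].
Qed.

Lemma amplify_tensor T u v : bounded_op T ->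
  @amplify R _ _ _ _ mu (mu_I q) T (tensor u v) = tensor (T u) v.
Proof.
move=> bT; rewrite /amplify; case: xgetP => [S _ []//|h].
by case: (h (slicewise T)); split=> [|? ?]; [exact: slicewise_bounded|exact: slicewise_tensor].
Qed.

Lemma slice_at_delta (u : L2 mu) (t : I) : slice_at (tensor u (delta q (val t))) t = u.
Proof. by rewrite slice_at_tensor L2_repr_delta eqxx scale1r. Qed.

(** [T u] is the slice at 1 of the amplification applied to u (x) delta_1. Membership in A_q is only
    given after [pi_rep], and this brings it back to H. *)
Lemma amplify_inj T T' : bounded_op T -> bounded_op T' ->
  @amplify R _ _ _ _ mu (mu_I q) T = @amplify R _ _ _ _ mu (mu_I q) T' -> T = T'.
Proof.
move=> bT bT' e; apply/funext => u.
have h := amplify_tensor u (delta q (val (point : I))) bT.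
have h' := amplify_tensor u (delta q (val (point : I))) bT'.
rewrite -(slice_at_delta (T u) point) -h e h'; exact: slice_at_delta.
Qed.

Lemma slice_at_sum (J : Type) (s : seq J) (P : pred J) (F : J -> L2 pm) t :
  slice_at (\sum_(j <- s | P j) F j) t = \sum_(j <- s | P j) slice_at (F j) t.
Proof.
have h0 : slice_at 0 t = 0.
  by have := slice_atD (-1) 0 0 t; rewrite !scaleN1r !addNr.
elim/big_rec2: _ => [|j y1 y2 _ e]; first exact: h0.
by have := slice_atD 1 (F j) y2 t; rewrite !scale1r => ->; rewrite e.
Qed.

(** The squared norm of [F] is the sum of those of its slices, so some finite set carries all of it
    up to e^2. The remainder has zero slices on that set and the slices of [F] elsewhere. *)
Lemma slices_dense (F : L2 pm) (e : R) : 0 < e ->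
  exists E : seq I,
    norm2 (F - \sum_(t <- E) tensor (slice_at F t) (delta q (val t))) < e.
Proof.
move=> e0; pose phi t : R := norm2 (slice_at F t) ^+ 2.
have [E sE] : exists E : {fset I},
    ((norm2 F ^+ 2)%:E < \sum_(t <- E) (phi t)%:E + (e ^+ 2)%:E)%E.
  have : (ereal_sup [set \sum_(t \in A) (phi t)%:E | A in fsets (setT : set I)]
     > (norm2 F ^+ 2 - e ^+ 2)%:E)%E.
    rewrite -[ereal_sup _]/(\esum_(t in setT) (phi t)%:E)%E -norm2_slices lte_fin.
    by rewrite ltrBlDr ltrDl exprn_gt0.
  move=> /ereal_sup_gt[_ [A [fA _] <-]] h; exists (fset_set A).
  by rewrite fsbig_finite //= in h; rewrite -lteBlDr // -EFinB.
exists E; rewrite -ltr_sqr ?nnegrE ?norm2_ge0 ?(ltW e0) // -lte_fin norm2_slices.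
have sl s : slice_at (F - \sum_(t <- E) tensor (slice_at F t) (delta q (val t))) s =
    if s \in E then 0 else slice_at F s.
  rewrite -[- _]scaleN1r addrC slice_atD slice_at_sum scaleN1r.
  under eq_bigr do rewrite slice_at_tensor L2_repr_delta.
  case: ifPn => sE'.
    rewrite (big_fsetD1 s) //= eqxx scale1r big_seq big1 ?addr0 ?addNr // => t.
    by rewrite !inE => /andP[/negbTE -> _]; rewrite scale0r.
  rewrite big_seq big1 ?oppr0 ?add0r // => t tE; case: eqP => [ts|]; last by rewrite scale0r.
  by rewrite -ts tE in sE'.
have -> : (\esum_(t in setT) (norm2 (slice_at (F - \sum_(t0 <- E)
    tensor (slice_at F t0) (delta q (val t0))) t) ^+ 2)%:E =
    \esum_(t in ~` [set` E]) (phi t)%:E)%E.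
  rewrite [RHS]esum_mkcond; apply: eq_esum => t _; rewrite sl.
  case: ifPn => h; case: ifPn => //; rewrite ?notin_setE ?inE /=.
    by move=> /(_ h).
    by rewrite norm20 expr0n.
  by move=> /contrapT tE; rewrite tE in h.
have := norm2_slices F; rewrite (esumID [set` E]) => [|t _]; last by rewrite lee_fin sqr_ge0.
rewrite !setTI esum_fset; last 2 first.
- exact: finite_fset.
- by move=> t _; rewrite lee_fin sqr_ge0.
rewrite fsbig_finite /=; last exact: finite_fset.
rewrite set_fsetK => h; rewrite h in sE.
by rewrite lteD2lE // in sE; rewrite sumEFin.
Qed.

Lemma total_tensor_delta (J : Type) (E : J -> L2 mu) : total_family E ->
  total_family (fun jt : J * I => tensor (E jt.1) (delta q (val jt.2)) : L2 pm).
Proof.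
move=> tE F e e0; have e2 : 0 < e / 2 by rewrite divr_gt0.
have [A hA] := slices_dense F e2.
(* Half of the error is shared between the slices; the successor covers the case of an empty
   list. *)
have e3 : 0 < e / 2 / (size A).+1%:R by rewrite divr_gt0.
have /choice[s hs] := fun t => tE (slice_at F t) _ e3.
exists (flatten [seq [seq (c.1, (c.2, t)) | c <- s t] | t <- A]).
rewrite (le_lt_trans (norm2_triangle _ (\sum_(t <- A) tensor (slice_at F t) (delta q (val t))) _)) //.
rewrite [ltRHS]splitr ltr_leD // big_flatten big_map -sumrB.
rewrite (le_trans (norm2_sum _ _ _)) //.
rewrite (@le_trans _ _ (\sum_(t <- A) (e / 2 / (size A).+1%:R))) //.
  apply: ler_sum => t _; rewrite big_map /=.
  have -> : \sum_(c <- s t) c.1 *: (tensor (E c.2) (delta q (val t)) : L2 pm) =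
     tensor (\sum_(c <- s t) c.1 *: E c.2) (delta q (val t)).
    elim: (s t) => [|c r IH].
      rewrite !big_nil; apply: esym.
      by have := tensorDl (-1) 0 0 (delta q (val t)) (mu := mu); rewrite !scaleN1r !addNr.
    by rewrite !big_cons tensorDl IH.
  have -> : tensor (slice_at F t) (delta q (val t)) -
      tensor (\sum_(c <- s t) c.1 *: E c.2) (delta q (val t)) =
      tensor (slice_at F t - \sum_(c <- s t) c.1 *: E c.2) (delta q (val t)).
    by rewrite addrC -[- _ in RHS]scaleN1r [in RHS]addrC tensorDl scaleN1r.
  by rewrite norm2_tensor norm2_delta mulr1 ltW.
rewrite big_const_seq count_predT iter_addr_0.
have -> : (e / 2 / (size A).+1%:R) *+ size A = e / 2 * ((size A)%:R / (size A).+1%:R).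
  by rewrite -mulr_natr mulrA mulrAC.
rewrite ger_pMr ?e2 // ler_pdivrMr ?ltr0n // mul1r ler_nat.
exact: leqnSn.
Qed.

Lemma total_ext (J : Type) (E : J -> L2 mu) T T' : total_family E ->
  bounded_op T -> bounded_op T' -> (forall j, T (E j) = T' (E j)) -> T = T'.
Proof.
move=> tE bT bT' h; apply/funext => u; apply/eqP; rewrite -subr_eq0; apply/eqP.
apply: norm2_lt_eq0 => e e0.
have [C C0 hC] := bounded_pos bT; have [C' C'0 hC'] := bounded_pos bT'.
have e1 : 0 < e / (C + C') by rewrite divr_gt0 // addr_gt0.
have [s hs] := tE u _ e1; set w := (\sum_(c <- s) _) in hs.
have Tw : T w = T' w.
  rewrite /w !lin_sum; [|by case: bT'|by case: bT].
  by apply: eq_bigr => c _; rewrite !linZ ?h; [|by case: bT'|by case: bT].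
have -> : T u - T' u = T (u - w) - T' (u - w).
  rewrite (linB u w (proj1 bT)) (linB u w (proj1 bT')) Tw.
  by rewrite opprB addrA subrK.
rewrite (le_trans (norm2D _ _)) // norm2N (le_trans (lerD (hC _) (hC' _))) //.
by rewrite -mulrDl mulrC -ler_pdivlMr ?addr_gt0 // ltW.
Qed.

End ProductIq.

(** * q-series *)

Section QPochhammer.
Variables (R : realType) (q : R).
Hypothesis q01 : 0 < q < 1.
Implicit Types (a b z : R).

Let q0 : 0 < q. Proof. by case/andP: q01. Qed.
Let q1 : q < 1. Proof. by case/andP: q01. Qed.
Let q_ge0 : 0 <= q := ltW q0.

Lemma qpoch0 a : qpoch q a 0 = 1. Proof. by rewrite /qpoch big_ord0. Qed.

Lemma qpochS a n : qpoch q a n.+1 = qpoch q a n * (1 - q ^+ (2 * n) * a).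
Proof. by rewrite /qpoch big_ord_recr. Qed.

Lemma qpoch_add a m n :
  qpoch q a (m + n) = qpoch q a m * qpoch q (q ^+ (2 * m) * a) n.
Proof.
elim: n => [|n IH]; first by rewrite addn0 qpoch0 mulr1.
rewrite addnS !qpochS IH -mulrA; congr (_ * (_ * (1 - _))).
by rewrite mulrA -exprD -mulnDr addnC.
Qed.

Lemma qpow_le1 n : q ^+ n <= 1. Proof. by rewrite exprn_ile1 // ltW. Qed.

Lemma qpoch_ge1 a n : a <= 0 -> 1 <= qpoch q a n.
Proof.
move=> a0; elim: n => [|n IH]; first by rewrite qpoch0.
rewrite qpochS mulr_ege1 // lerBrDr gerDl mulr_ge0_le0 ?exprn_ge0 //.
Qed.

Lemma qpoch_homo a : a <= 0 -> {homo qpoch q a : m n / (m <= n)%N >-> m <= n}.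
Proof.
move=> a0; apply/nondecreasing_seqP => n.
rewrite qpochS ler_peMr ?(le_trans _ (qpoch_ge1 n a0)) //.
by rewrite lerBrDr gerDl mulr_ge0_le0 ?exprn_ge0.
Qed.

Definition qgeom : R := (1 - q ^+ 2)^-1.

Lemma qgeom_gt0 : 0 < qgeom.
Proof. by rewrite invr_gt0 subr_gt0 exprn_ilt1 // . Qed.

Lemma sum_qpow_le n : \sum_(i < n) q ^+ (2 * i) <= qgeom.
Proof.
have h : 0 < 1 - q ^+ 2 by rewrite subr_gt0 exprn_ilt1.
rewrite /qgeom -[leRHS]mul1r ler_pdivlMr //.
have -> : (\sum_(i < n) q ^+ (2 * i)) * (1 - q ^+ 2) = 1 - q ^+ (2 * n).
  elim: n => [|n IH]; first by rewrite big_ord0 mul0r muln0 expr0 subrr.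
  rewrite big_ord_recr /= mulrDl IH mulnS exprD; ring.
by rewrite lerBlDr lerDl exprn_ge0.
Qed.

Lemma norm_qpoch a n : `|qpoch q a n| <= qpoch q (- `|a|) n.
Proof.
elim: n => [|n IH]; first by rewrite !qpoch0 normr1.
rewrite !qpochS normrM ler_pM // mulrN opprK (le_trans (ler_normB _ _)) //.
by rewrite normr1 lerD2l normrM ger0_norm ?exprn_ge0.
Qed.

(** From 1 + x <= exp x, the exponents adding up to at most |a| / (1 - q^2). *)
Lemma qpoch_le_expR a n : qpoch q (- `|a|) n <= expR (`|a| * qgeom).
Proof.
apply: (@le_trans _ _ (expR (`|a| * \sum_(i < n) q ^+ (2 * i)))); last first.
  by rewrite ler_expR ler_wpM2l // sum_qpow_le.
elim: n => [|n IH]; first by rewrite qpoch0 big_ord0 mulr0 expR0.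
rewrite qpochS big_ord_recr /= [X in expR X]mulrDr expRD ler_pM //.
- by rewrite (le_trans _ (qpoch_ge1 _ _)) // oppr_le0.
- by rewrite mulrN opprK addr_ge0 // mulr_ge0 ?exprn_ge0.
- by rewrite mulrN opprK mulrC expR_ge1Dx.
Qed.

Lemma qpoch_cvg_le0 a : a <= 0 -> cvgn (qpoch q a).
Proof.
move=> a0; apply: nondecreasing_is_cvgn; first exact: qpoch_homo.
exists (expR (`|a| * qgeom)) => _ [n _ <-].
by have := qpoch_le_expR a n; rewrite ler0_norm // opprK.
Qed.

Lemma qpoch_01 a n : 0 <= a <= 1 -> 0 <= qpoch q a n <= 1.
Proof.
move=> /andP[a0 a1]; elim: n => [|n /andP[h1 h2]]; first by rewrite qpoch0 ler01 lexx.
have h : 0 <= q ^+ (2 * n) * a <= 1.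
  by rewrite mulr_ge0 ?exprn_ge0 // mulr_ile1 // ?exprn_ge0 // qpow_le1.
have : 0 <= 1 - q ^+ (2 * n) * a <= 1 by lra.
move=> /andP[h3 h4].
by rewrite qpochS mulr_ge0 // mulr_ile1.
Qed.

Lemma qpoch_cvg_01 a : 0 <= a <= 1 -> cvgn (qpoch q a).
Proof.
move=> a01; apply: nonincreasing_is_cvgn.
  apply/nonincreasing_seqP => n.
  have /andP[h1 h2] := qpoch_01 n a01; have /andP[a0 a1] := a01.
  by rewrite qpochS ler_piMr // lerBlDr lerDl mulr_ge0 ?exprn_ge0.
by exists 0 => _ [n _ <-]; have /andP[] := qpoch_01 n a01.
Qed.

Lemma qpow_small (C e : R) : 0 < e -> exists m, forall n, (m <= n)%N -> q ^+ n * C <= e.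
Proof.
move=> e0; have : (fun n => q ^+ n : R) @ \oo --> (0 : R).
  by apply: cvg_expr; rewrite ger0_norm.
have e1 : 0 < e / (`|C| + 1) by rewrite divr_gt0 // ltr_wpDl.
move/cvgrPdist_le => /(_ _ e1)[m _ hm]; exists m => n mn.
have := hm n mn; rewrite sub0r normrN ger0_norm ?exprn_ge0 // ler_pdivlMr ?ltr_wpDl //.
apply: le_trans; rewrite ler_wpM2l ?exprn_ge0 //.
by rewrite (le_trans (ler_norm _)) // lerDl.
Qed.

(** For [a > 0], all but finitely many factors form a symbol with argument in [0, 1], whose partial
    products decrease; the first [m] factors are a constant. *)
Lemma qpoch_cvg a : cvgn (qpoch q a).
Proof.
have [a0|/ltW a0] := leP a 0; first exact: qpoch_cvg_le0.
have [m hm] := qpow_small a (@ltr01 R).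
have h : 0 <= q ^+ (2 * m) * a <= 1.
  by rewrite mulr_ge0 ?exprn_ge0 // hm // mul2n -addnn leq_addr.
have /cvg_ex[l hl] := qpoch_cvg_01 h.
apply/cvg_ex; exists (qpoch q a m * l).
rewrite -(cvg_shiftn m); under eq_fun do rewrite addnC qpoch_add.
by apply: cvgM => //; exact: cvg_cst.
Qed.

Lemma qpoch_infE a : qpoch q a @ \oo --> qpoch_inf q a.
Proof. exact: qpoch_cvg. Qed.

Lemma qpoch_inf_split a m :
  qpoch_inf q a = qpoch q a m * qpoch_inf q (q ^+ (2 * m) * a).
Proof.
apply: cvg_lim => //.
rewrite -(cvg_shiftn m); under eq_fun do rewrite addnC qpoch_add.
by apply: cvgM; [exact: cvg_cst|exact: qpoch_infE].
Qed.

Lemma qpoch_inf_ge1 a : a <= 0 -> 1 <= qpoch_inf q a.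
Proof.
move=> a0; apply: limr_ge; first exact: qpoch_cvg.
by near=> n; exact: qpoch_ge1.
Unshelve. all: by end_near. Qed.

Lemma norm_qpoch_le a n : `|qpoch q a n| <= expR (`|a| * qgeom).
Proof. exact: le_trans (norm_qpoch _ _) (qpoch_le_expR _ _). Qed.

Lemma norm_qpoch_inf_le a : `|qpoch_inf q a| <= expR (`|a| * qgeom).
Proof.
rewrite -lim_norm; last exact: qpoch_cvg.
apply: limr_le; first by apply: is_cvg_norm; exact: qpoch_cvg.
by near=> n; exact: norm_qpoch_le.
Unshelve. all: by end_near. Qed.

Lemma qpoch_inf_le a n : 0 <= a <= 1 -> qpoch_inf q a <= qpoch q a n.
Proof.
move=> a01; rewrite (qpoch_inf_split a n).
have /andP[h1 _] := qpoch_01 n a01; rewrite ler_piMr //.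
have h : 0 <= q ^+ (2 * n) * a <= 1.
  have /andP[a0 a1] := a01.
  by rewrite mulr_ge0 ?exprn_ge0 // mulr_ile1 // ?exprn_ge0 // qpow_le1.
apply: limr_le; first exact: qpoch_cvg.
by near=> k; have /andP[] := qpoch_01 k h.
Unshelve. all: by end_near. Qed.

Lemma qpoch_gt0 a n : a < 1 -> 0 < qpoch q a n.
Proof.
move=> a1; elim: n => [|n IH]; first by rewrite qpoch0.
rewrite qpochS mulr_gt0 // subr_gt0.
have [a0|a0] := leP a 0.
  by rewrite (le_lt_trans _ ltr01) // mulr_ge0_le0 ?exprn_ge0.
by rewrite (le_lt_trans _ a1) // ler_piMl ?qpow_le1 // ltW.
Qed.

(* The inverse of [1 - x] is [1 + x / (1 - x)], so [1 / (a; q^2)_n] is bounded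
   by a product of the same kind. *)
Lemma qpoch_inf_gt0 a : a < 1 -> 0 < qpoch_inf q a.
Proof.
move=> a1; have [a0|a0] := leP a 0; first exact: lt_le_trans ltr01 (qpoch_inf_ge1 a0).
have b0 : 0 < 1 - a by rewrite subr_gt0.
set b := a / (1 - a); have b_ge0 : 0 <= b by rewrite divr_ge0 // ltW.
have h n : 1 <= qpoch q a n * qpoch q (- b) n.
  elim: n => [|n IH]; first by rewrite !qpoch0 mulr1.
  rewrite !qpochS mulrACA mulr_ege1 // mulrN opprK.
  set t := q ^+ (2 * n); have t0 : 0 <= t by exact: exprn_ge0.
  have t1 : t <= 1 by exact: qpow_le1.
  have -> : (1 - t * a) * (1 + t * b) = 1 + t * a * a * (1 - t) / (1 - a).
    by rewrite /b; field; rewrite gt_eqF.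
  by rewrite lerDl divr_ge0 ?(ltW b0) // !mulr_ge0 ?(ltW a0) // subr_ge0.
apply: (@lt_le_trans _ _ (expR (`|b| * qgeom))^-1); first by rewrite invr_gt0 expR_gt0.
apply: limr_ge; first exact: qpoch_cvg.
near=> n; rewrite -div1r ler_pdivrMr ?expR_gt0 // (le_trans (h n)) //.
rewrite ler_wpM2l ?(ltW (qpoch_gt0 _ _)) //.
by have := qpoch_le_expR b n; rewrite ger0_norm.
Unshelve. all: by end_near. Qed.

Lemma qpoch_inf_ge0 a : a <= 1 -> 0 <= qpoch_inf q a.
Proof.
move=> a1; have [a0|a0] := leP a 0; first exact: le_trans ler01 (qpoch_inf_ge1 a0).
have h : 0 <= a <= 1 by rewrite (ltW a0).
apply: limr_ge; first exact: qpoch_cvg.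
by near=> n; have /andP[] := qpoch_01 n h.
Unshelve. all: by end_near. Qed.

Lemma qpoch_zero a m n : (m < n)%N -> q ^+ (2 * m) * a = 1 -> qpoch q a n = 0.
Proof.
move=> mn h; rewrite -(subnKC mn) qpoch_add qpochS h subrr mulr0 mul0r //.
Qed.

Lemma qpoch_inf_zero a m : q ^+ (2 * m) * a = 1 -> qpoch_inf q a = 0.
Proof. by move=> h; rewrite (qpoch_inf_split a m.+1) (qpoch_zero _ h) // mul0r. Qed.

(** When both products are expanded, every nonconstant monomial on the left occurs on the right with
    its absolute value. *)
Lemma norm_qpoch_sub1 a n : `|qpoch q a n - 1| <= qpoch q (- `|a|) n - 1.
Proof.
elim: n => [|n IH]; first by rewrite !qpoch0 subrr normr0.
rewrite !qpochS !mulrBr !mulr1 !mulrN opprK.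
rewrite [X in `|X|](_ : _ = (qpoch q a n - 1) - qpoch q a n * (q ^+ (2 * n) * a)); last by ring.
rewrite (le_trans (ler_normB _ _)) //.
rewrite [leRHS](_ : _ = (qpoch q (- `|a|) n - 1) + qpoch q (- `|a|) n * (q ^+ (2 * n) * `|a|)); last by ring.
rewrite lerD // normrM ler_pM // ?norm_qpoch // normrM ger0_norm ?exprn_ge0 //.
Qed.

Lemma norm_qpoch_inf_sub1 a : `|qpoch_inf q a - 1| <= expR (`|a| * qgeom) - 1.
Proof.
have c : (fun n => qpoch q a n - 1) @ \oo --> qpoch_inf q a - 1.
  by apply: cvgB; [exact: qpoch_infE|exact: cvg_cst].
rewrite -(cvg_lim _ (cvg_norm c)) //; apply: limr_le.
  by apply/cvg_ex; eexists; exact: cvg_norm c.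
near=> n; rewrite (le_trans (norm_qpoch_sub1 _ _)) // lerD2r.
exact: qpoch_le_expR.
Unshelve. all: by end_near. Qed.

Lemma cvg_expR_sub1 (u : nat -> R) : u @ \oo --> (0 : R) ->
  (fun n => expR (`|u n| * qgeom) - 1) @ \oo --> (0 : R).
Proof.
move=> u0; rewrite -(subrr (1 : R)); apply: cvgB; last exact: cvg_cst.
rewrite -[X in _ --> X](@expR0 R); apply: continuous_cvg; first exact: continuous_expR.
rewrite -(mul0r qgeom) -(normr0 R); apply: cvgMl; exact: cvg_norm u0.
Qed.

Lemma cvg_of_norm_le (u v : nat -> R) (l : R) : (forall n, `|u n - l| <= v n) ->
  v @ \oo --> (0 : R) -> u @ \oo --> l.
Proof.
move=> h v0; apply/cvgrPdist_le => e e0.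
move/cvgrPdist_le: v0 => /(_ e e0)[N _ hN]; exists N => // n Nn.
rewrite distrC (le_trans (h n)) // (le_trans (ler_norm _)) //.
by have := hN n Nn; rewrite sub0r normrN.
Qed.

Lemma qpoch_inf_cvg1 (u : nat -> R) : u @ \oo --> (0 : R) ->
  (fun n => qpoch_inf q (u n)) @ \oo --> (1 : R).
Proof.
move=> u0; apply: cvg_of_norm_le (cvg_expR_sub1 u0) => n.
exact: norm_qpoch_inf_sub1.
Qed.

Lemma qq_lt1 : q ^+ 2 < 1. Proof. exact: exprn_ilt1. Qed.
Lemma qq_01 : 0 <= q ^+ 2 <= 1. Proof. by rewrite exprn_ge0 // ltW // qq_lt1. Qed.
Lemma qqn_gt0 n : 0 < qpoch q (q ^+ 2) n. Proof. exact: qpoch_gt0 qq_lt1. Qed.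
Lemma qq_inf_gt0 : 0 < qpoch_inf q (q ^+ 2). Proof. exact: qpoch_inf_gt0 qq_lt1. Qed.

(** The Gaussian power of q beats every geometric growth; all the series of this development are
    dominated through this bound. *)
Lemma gauss_le (Z : R) : 0 <= Z ->
  exists2 D, 0 <= D & forall k, q ^+ (k * k.-1) * Z ^+ k <= D * q ^+ k.
Proof.
move=> Z0; have [m /(_ m (leqnn m)) hm] := qpow_small Z (@ltr01 R).
(* Since q^m Z <= 1, the claim reduces to (m+2)^2 + k(k-1) >= k + mk, and k^2 - (m+2)k + (m+2)^2 is
   a positive definite form in k and m+2. *)
exists (q ^+ ((m + 2) * (m + 2)))^-1; first by rewrite invr_ge0 exprn_ge0.
move=> k; rewrite ler_pdivlMl ?exprn_gt0 // -(ler_pM2r (exprn_gt0 (m * k) q0)).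
have -> : q ^+ ((m + 2) * (m + 2)) * (q ^+ (k * k.-1) * Z ^+ k) * q ^+ (m * k) =
    q ^+ ((m + 2) * (m + 2) + k * k.-1) * (q ^+ m * Z) ^+ k.
  by rewrite exprMn -exprM exprD; ring.
apply: (@le_trans _ _ (q ^+ ((m + 2) * (m + 2) + k * k.-1))).
  by rewrite ler_piMr ?exprn_ge0 // exprn_ile1 // mulr_ge0 // exprn_ge0.
rewrite -exprD ler_wiXn2l // ?(ltW q1) //.
case: k => [|k]; first by rewrite muln0 mul0n addn0.
by rewrite /=; nia.
Qed.

Lemma gauss_summable (C Z : R) : 0 <= C -> 0 <= Z ->
  cvgn (series (fun k => C * (q ^+ (k * k.-1) * Z ^+ k))).
Proof.
move=> C0 Z0; have [D D0 hD] := gauss_le Z0.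
apply: (@series_le_cvg _ _ (geometric (C * D) q)).
- by move=> n; rewrite !mulr_ge0 ?exprn_ge0.
- by move=> n; rewrite /geometric /= !mulr_ge0 ?exprn_ge0.
- by move=> n; rewrite /geometric /= -mulrA ler_wpM2l.
- by apply: is_cvg_geometric_series; rewrite ger0_norm.
Qed.

End QPochhammer.

(** * Dominated convergence for series *)

Section Tannery.
Variable R : realType.
Implicit Types (u v w M : nat -> R).

Lemma dominated_series_cvg w M : cvgn (series M) -> (forall k, `|w k| <= M k) ->
  cvgn (series w).
Proof.
move=> cM h; apply: normed_cvg; apply: series_le_cvg cM => [k|k|k] /=; [exact: normr_ge0| |exact: h].
exact: le_trans (normr_ge0 _) (h k).
Qed.

Lemma series_tail w M n : cvgn (series M) -> (forall k, `|w k| <= M k) ->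
  `|limn (series w) - series w n| <= limn (series M) - series M n.
Proof.
move=> cM h; have cw := dominated_series_cvg cM h.
have c1 : (fun m => `|series w m - series w n|) @ \oo --> `|limn (series w) - series w n|.
  by apply: cvg_norm; apply: cvgB; [exact: cw|exact: cvg_cst].
have c2 : (fun m => series M m - series M n) @ \oo --> limn (series M) - series M n.
  by apply: cvgB; [exact: cM|exact: cvg_cst].
rewrite -(cvg_lim _ c1) // -(cvg_lim _ c2) //; apply: ler_lim.
- by apply/cvg_ex; eexists; exact: c1.
- by apply/cvg_ex; eexists; exact: c2.
near=> m; have nm : (n <= m)%N by near: m; exact: nbhs_infty_ge.
by rewrite !sub_series_geq // (le_trans (ler_norm_sum _ _ _)) // ler_sum.
Unshelve. all: by end_near. Qed.

Lemma norm_series_le w M : cvgn (series M) -> (forall k, `|w k| <= M k) ->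
  `|limn (series w)| <= limn (series M).
Proof.
move=> cM h; have := series_tail 0 cM h.
by rewrite !seriesEnat /= !big_geq // !subr0.
Qed.

(** Tannery's theorem: the tails of every [u N] and of [v] are bounded by the tail of [M], so an
    error of e/3 is spent on each tail and e/3 on a finite partial sum, which converges term by
    term. *)
Lemma tannery (u : nat -> nat -> R) v M : cvgn (series M) ->
  (forall N k, `|u N k| <= M k) -> (forall k, u^~ k @ \oo --> v k) ->
  (fun N => limn (series (u N))) @ \oo --> limn (series v).
Proof.
move=> cM h hv; have hvM k : `|v k| <= M k.
  have c : (fun N => `|u N k|) @ \oo --> `|v k| by apply: cvg_norm; exact: hv.
  rewrite -(cvg_lim _ c) //; apply: limr_le.
    by apply/cvg_ex; eexists; exact: c.
  by near=> N; exact: h.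
have cs K : (fun N => series (u N) K) @ \oo --> series v K.
  elim: K => [|K IH].
    rewrite (_ : (fun N => series (u N) 0%N) = (fun=> series v 0%N)); first exact: cvg_cst.
    by apply/funext => N; rewrite !seriesEnat /= !big_geq.
  rewrite seriesSr; under eq_fun do rewrite seriesSr.
  by apply: cvgD; [exact: IH|exact: hv].
apply/cvgrPdist_le => e e0.
have e3 : 0 < e / 3 by rewrite divr_gt0.
have [K _ hK] : \forall n \near \oo, `|limn (series M) - series M n| <= e / 3.
  by move/cvgrPdist_le: cM => /(_ _ e3).
have hK' : limn (series M) - series M K <= e / 3.
  by rewrite (le_trans (ler_norm _)) // hK /=.
have [N0 _ hN] : \forall n \near \oo, `|series v K - series (u n) K| <= e / 3.
  by move/cvgrPdist_le: (cs K) => /(_ _ e3).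
exists N0 => // N N0N; have a1 := hN N N0N.
have a2 := series_tail K cM hvM; have a3 := series_tail K cM (h N).
rewrite (_ : limn (series v) - limn (series (u N)) =
  (limn (series v) - series v K) + (series v K - series (u N) K) -
  (limn (series (u N)) - series (u N) K)); last by ring.
rewrite (le_trans (ler_normB _ _)) // (le_trans (lerD (ler_normD _ _) (lexx _))) //.
rewrite (_ : e = e / 3 + e / 3 + e / 3); last by field.
by rewrite !lerD // (le_trans _ hK').
Unshelve. all: by end_near. Qed.

Lemma limn_series_finite w n : (forall k, (n <= k)%N -> w k = 0) ->
  limn (series w) = \sum_(k < n) w k.
Proof.
move=> h; apply: cvg_lim => //; apply: cvg_near_cst.
near=> m; have nm : (n <= m)%N by near: m; exact: nbhs_infty_ge.
rewrite seriesEnat /= (big_cat_nat (leq0n n) nm) //= big_mkord [X in _ + X]big_nat.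
by rewrite [X in _ + X]big1 ?addr0 // => i /andP[ni _]; exact: h.
Unshelve. all: by end_near. Qed.

Lemma cvg_series_shift w n : cvgn (series w) -> (forall k, (k < n)%N -> w k = 0) ->
  series (fun k => w (n + k)%N) @ \oo --> limn (series w).
Proof.
move=> cw h.
have <- : (fun m => series w (m + n)%N) = series (fun k => w (n + k)%N).
  apply/funext => m; rewrite !seriesEnat /= (big_cat_nat (leq0n n) (leq_addl m n)) //=.
  rewrite [X in X + _]big_nat big1 ?add0r => [|i /andP[_ ni]]; last exact: h.
  by rewrite -{1}[n]add0n big_addn addnK; apply: eq_bigr => i _; rewrite addnC.
by rewrite (cvg_shiftn n).
Qed.

End Tannery.

(** * The q-binomial theorem and Euler's identity, in base q^2 *)

Section QBinomial.
Variables (R : realType) (q : R).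
Hypothesis q01 : 0 < q < 1.
Let q0 : 0 < q. Proof. by case/andP: q01. Qed.
Let q1 : q < 1. Proof. by case/andP: q01. Qed.
Let q_ge0 : 0 <= q := ltW q0.
Local Notation qq n := (qpoch q (q ^+ 2) n).

(** The Gaussian binomial coefficient in base q^2. The Pascal rule makes positivity and vanishing
    for k > N immediate; [qbin_qpoch] recovers the quotient of q-factorials. *)
Fixpoint qbin (N k : nat) : R :=
  match N, k with
  | _, 0%N => 1
  | 0%N, _ => 0
  | N'.+1, k'.+1 => qbin N' k'.+1 + q ^+ (2 * (N' - k')) * qbin N' k'
  end.

Arguments qbin : simpl never.

Lemma qbin0 N : qbin N 0 = 1. Proof. by case: N. Qed.
Lemma qbinS N k : qbin N.+1 k.+1 = qbin N k.+1 + q ^+ (2 * (N - k)) * qbin N k.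
Proof. by []. Qed.

Lemma qbin_small N k : (N < k)%N -> qbin N k = 0.
Proof.
elim: N k => [|N IH] [|k] // Nk.
by rewrite qbinS !IH ?mulr0 ?addr0 // ltnW.
Qed.

Lemma qbin_qpoch N k : (k <= N)%N -> qbin N k * (qq k * qq (N - k)) = qq N.
Proof.
elim: N k => [|N IH] [|k] kN; rewrite ?qbin0 ?qpoch0 ?mul1r ?subn0 //.
rewrite subSS qbinS mulrDl; have := kN; rewrite ltnS leq_eqVlt => /orP[/eqP kE|kN'].
  have h := IH k; rewrite kE leqnn subnn qpoch0 mulr1 in h.
  rewrite kE subnn qbin_small // mul0r add0r expr0 mul1r qpoch0 mulr1 qpochS mulrA.
  by rewrite h // qpochS.
have h1 := IH _ kN'; have h2 := IH _ (ltnW kN').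
have -> : qbin N k.+1 * (qq k.+1 * qq (N - k)) =
    qq N * (1 - q ^+ (2 * (N - k.+1)) * q ^+ 2).
  have -> : qq (N - k) = qq (N - k.+1) * (1 - q ^+ (2 * (N - k.+1)) * q ^+ 2).
    by rewrite -qpochS; congr (qpoch _ _ _); lia.
  by rewrite -h1; ring.
have -> : q ^+ (2 * (N - k)) * qbin N k * (qq k.+1 * qq (N - k)) =
    q ^+ (2 * (N - k)) * qq N * (1 - q ^+ (2 * k) * q ^+ 2).
  by rewrite -h2 [qq k.+1]qpochS; ring.
have e1 : q ^+ (2 * (N - k.+1)) * q ^+ 2 = q ^+ (2 * (N - k)).
  by rewrite -exprD; congr (q ^+ _); lia.
have e2 : q ^+ (2 * N) * q ^+ 2 = q ^+ (2 * (N - k)) * (q ^+ (2 * k) * q ^+ 2).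
  by rewrite -!exprD; congr (q ^+ _); lia.
by rewrite qpochS e1 e2; ring.
Qed.

(** The finite q-binomial theorem: multiplication by the last factor 1 - q^(2N) x reproduces the
    Pascal rule coefficient by coefficient. *)
Lemma qbinomial x N : qpoch q x N =
  \sum_(k < N.+1) qbin N k * (-1) ^+ k * q ^+ (k * k.-1) * x ^+ k.
Proof.
elim: N => [|N IH]; first by rewrite qpoch0 big_ord1 /= !expr0 !mulr1.
rewrite qpochS IH mulrBr mulr1 [in RHS]big_ord_recl /= !expr0 !mulr1.
under [in RHS]eq_bigr => i _ do rewrite /bump leq0n add1n qbinS !mulrDl.
rewrite [in RHS]big_split /= addrA; congr (_ + _).
  rewrite big_ord_recl /= qbin0 !expr0 !mulr1; congr (_ + _).
  rewrite [in RHS]big_ord_recr /= qbin_small // !mul0r addr0.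
  by apply: eq_bigr => i _; rewrite /bump /= add1n.
rewrite -mulrN big_distrl /=; apply: eq_bigr => -[i iN] _ /=.
have iN' : (i <= N)%N by [].
have -> : q ^+ (2 * N) = q ^+ (2 * (N - i)) * q ^+ (2 * i).
  by rewrite -exprD; congr (q ^+ _); lia.
have -> : q ^+ (i.+1 * i) = q ^+ (i * i.-1) * q ^+ (2 * i).
  by rewrite -exprD; congr (q ^+ _); case: i {iN iN'} => //= i; lia.
by rewrite !exprS; ring.
Qed.

Lemma qbin_ge0 N k : 0 <= qbin N k.
Proof.
elim: N k => [|N IH] [|k]; rewrite ?qbin0 //.
rewrite qbinS.
by rewrite addr_ge0 // mulr_ge0 // exprn_ge0 // ltW.
Qed.

Lemma qbin_le N k : qbin N k <= (qpoch_inf q (q ^+ 2) ^+ 2)^-1.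
Proof.
have [kN|Nk] := leqP k N; last by rewrite qbin_small // invr_ge0 sqr_ge0.
have h := qbin_qpoch kN; have i0 := qq_inf_gt0 q01.
rewrite -div1r ler_pdivlMr ?exprn_gt0 //.
apply: (@le_trans _ _ (qbin N k * (qq k * qq (N - k)))).
  rewrite ler_wpM2l ?qbin_ge0 // expr2 ler_pM ?(ltW i0) //;
  exact: qpoch_inf_le (qq_01 q01).
by rewrite h; have /andP[] := qpoch_01 q01 N (qq_01 q01).
Qed.

Lemma qbin_cvg k : qbin^~ k @ \oo --> (qq k)^-1.
Proof.
have c0 : qpoch_inf q (q ^+ 2) != 0 by rewrite gt_eqF // qq_inf_gt0.
have -> : (qq k)^-1 = qpoch_inf q (q ^+ 2) / (qq k * qpoch_inf q (q ^+ 2)).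
  by rewrite invfM mulrCA divff // mulr1.
have h : (fun N => qq (N + k) / (qq k * qq N)) @ \oo -->
    qpoch_inf q (q ^+ 2) / (qq k * qpoch_inf q (q ^+ 2)).
  apply: cvgM.
    by rewrite (cvg_shiftn k (qpoch q (q ^+ 2))); exact: qpoch_infE.
  apply: cvgV; first by rewrite mulf_neq0 // gt_eqF // qqn_gt0.
  by apply: cvgM; [exact: cvg_cst|exact: qpoch_infE].
rewrite -(cvg_shiftn k); apply: cvg_trans h.
apply: near_eq_cvg; near=> N; have := @qbin_qpoch (N + k) k (leq_addl _ _).
rewrite addnK => <-; rewrite mulfK // mulf_neq0 // gt_eqF // qqn_gt0 //.
Unshelve. all: by end_near. Qed.

(** The limit N -> oo of [qbinomial]: the coefficients converge to 1 / (q^2; q^2)_k and are bounded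
    uniformly in N and k, so Tannery's theorem applies. *)
Lemma euler_qexp x : limn (series (fun k => (-1) ^+ k * q ^+ (k * k.-1) * x ^+ k / qq k)) =
  qpoch_inf q x.
Proof.
apply/esym; apply: cvg_lim => //.
rewrite (_ : qpoch q x = (fun N => limn (series (fun k =>
    qbin N k * (-1) ^+ k * q ^+ (k * k.-1) * x ^+ k)))); last first.
  apply/funext => N; rewrite qbinomial (@limn_series_finite _ _ N.+1) // => k Nk.
  by rewrite qbin_small // !mul0r.
have D0 : 0 <= (qpoch_inf q (q ^+ 2) ^+ 2)^-1 by rewrite invr_ge0 sqr_ge0.
apply: (tannery (gauss_summable q01 D0 (normr_ge0 x))) => [N k|k].
  rewrite !normrM !normrX normrN1 expr1n mulr1 ger0_norm ?qbin_ge0 //.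
  rewrite (ger0_norm (ltW q0)) -mulrA ler_wpM2r ?qbin_le //.
  by rewrite mulr_ge0 ?exprn_ge0 // ltW.
have -> : (-1) ^+ k * q ^+ (k * k.-1) * x ^+ k / qq k =
    (qq k)^-1 * (-1) ^+ k * q ^+ (k * k.-1) * x ^+ k by ring.
by do 3! (apply: cvgMl); exact: qbin_cvg.
Qed.

End QBinomial.

(** * The functions a_p *)

Section QPowers.
Variables (R : realType) (q : R).
Hypothesis q01 : 0 < q < 1.
Let q0 : 0 < q. Proof. by case/andP: q01. Qed.
Let q1 : q < 1. Proof. by case/andP: q01. Qed.
Let qn0 : q != 0. Proof. by rewrite gt_eqF. Qed.

(** Sign and exponent as coordinates on -q^Z and q^Z. In them, products, [chi], [kappa] and
    membership in I_q become boolean and integer arithmetic. *)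
Definition qelt (s : bool) (k : int) : R := (-1) ^+ s * q ^ k.
Local Notation qel := qelt.

Lemma qel0 k : qel false k = q ^ k. Proof. by rewrite /qelt mul1r. Qed.
Lemma qel1 k : qel true k = - q ^ k. Proof. by rewrite /qelt mulN1r. Qed.

Lemma qel_sign (s : bool) : (-1) ^+ s = qel s 0.
Proof. by rewrite /qelt expr0z mulr1. Qed.

Lemma qz_gt0 k : 0 < q ^ k. Proof. exact: exprz_gt0. Qed.
Lemma qz_neq0 k : q ^ k != 0. Proof. by rewrite gt_eqF // qz_gt0. Qed.

Lemma norm_qel s k : `|qel s k| = q ^ k.
Proof. by rewrite normrM normr_sign mul1r ger0_norm // ltW // qz_gt0. Qed.

Lemma qel_neq0 s k : qel s k != 0.
Proof. by rewrite -normr_eq0 norm_qel qz_neq0. Qed.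

Lemma qelM s k s' k' : qel s k * qel s' k' = qel (s (+) s') (k + k').
Proof. by rewrite /qelt mulrACA -signr_addb -expfzDr. Qed.

Lemma qelV s k : (qel s k)^-1 = qel s (- k).
Proof. by rewrite /qelt invfM invr_sign invr_expz. Qed.

Lemma sg_qel s k : Num.sg (qel s k) = (-1) ^+ s.
Proof. by case: s; rewrite ?qel0 ?qel1 ?sgrN gtr0_sg ?qz_gt0. Qed.

Lemma qel_gt0 s k : (0 < qel s k) = ~~ s.
Proof. by case: s; rewrite ?qel0 ?qel1 ?qz_gt0 // oppr_gt0 ltNge ltW // qz_gt0. Qed.

Lemma qel_lt0 s k : (qel s k < 0) = s.
Proof. by case: s; rewrite ?qel0 ?qel1 ?oppr_lt0 ?qz_gt0 // ltNge ltW // qz_gt0. Qed.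

Lemma ln_qz k : ln (q ^ k) = k%:~R * ln q.
Proof. by rewrite -powR_intmul ?ltW // ln_powR. Qed.

Lemma chi_qel s k : chi q (qel s k) = k.
Proof.
rewrite /chi norm_qel ln_qz mulfK; last by rewrite lt_eqF // ln_lt0.
exact: intrKfloor.
Qed.

Lemma kappa_qel s k : kappa (qel s k) = qel s (k * 2).
Proof.
rewrite /kappa sg_qel /qel exprMn sqrr_sign mul1r; congr (_ * _).
by rewrite -exprz_exp.
Qed.

Lemma qzn (n : nat) : q ^+ n = q ^ (n%:Z). Proof. by []. Qed.

Lemma qz_lt k l : (q ^ k < q ^ l) = (l < k).
Proof.
have h i j : i < j -> q ^ j < q ^ i.
  move=> ij; have -> : j = i + (absz (j - i)) by lia.
  rewrite expfzDr // gtr_pMr ?qz_gt0 // -exprnP exprn_ilt1 ?(ltW q0) //; lia.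
have [kl|lk|->] := ltgtP k l; last by rewrite ltxx.
  by apply: negbTE; rewrite -leNgt ltW // h.
exact: h.
Qed.

Lemma qz_inj : injective (exprz q).
Proof. by apply: ieexprIz => //; rewrite lt_eqF. Qed.

Lemma qel_inj s k s' k' : qel s k = qel s' k' -> s = s' /\ k = k'.
Proof.
move=> e; split.
  by have := qel_lt0 s k; rewrite e qel_lt0.
by apply: qz_inj; rewrite -(norm_qel s) e norm_qel.
Qed.

Lemma Iq_setP x : Iq_set q x <-> exists s k, x = qel s k /\ (s -> 0 < k).
Proof.
split=> [[[k k0 ->]|[k ->]]|[[] [k [-> h]]]].
- by exists true, (Posz k); rewrite qel1.
- by exists false, k; rewrite qel0.
- left; exists (absz k); first by have := h isT; lia.
  by rewrite qel1; congr (- _); rewrite qzn; congr (q ^ _); have := h isT; lia.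
- by right; exists k; rewrite qel0.
Qed.

Lemma qpowersP x : qpowers q x <-> exists s k, x = qel s k.
Proof.
split=> [[k [->|->]]|[[] [k ->]]].
- by exists false, k; rewrite qel0.
- by exists true, k; rewrite qel1.
- by exists k; right; rewrite qel1.
- by exists k; left; rewrite qel0.
Qed.

Lemma nu_sqr s k : nu q (qel s k) ^+ 2 = q ^ ((k - 1) * (k - 2)).
Proof.
rewrite /nu chi_qel -(powR_mulrn 2 (powR_ge0 _ _)) -powRrM -powR_intmul ?ltW //.
by congr (q `^ _); rewrite intrM; field.
Qed.

Lemma qpow_cvg0 (k : int) : (fun n : nat => q ^ (k + n%:Z)) @ \oo --> (0 : R).
Proof.
under eq_fun do rewrite expfzDr //.
rewrite -(mulr0 (q ^ k)); apply: cvgMr.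
by apply: cvg_expr; rewrite ger0_norm // ltW.
Qed.

Lemma qpow2_cvg0 (k : int) : (fun n : nat => q ^ (k + n%:Z * 2)) @ \oo --> (0 : R).
Proof.
apply: (cvg_of_norm_le _ (qpow_cvg0 k)) => n.
rewrite subr0 ger0_norm ?(ltW (qz_gt0 _)) //.
rewrite leNgt qz_lt -leNgt; lia.
Qed.

Local Notation qinf := (qpoch_inf q).

Lemma c_q_sqr : c_q q ^+ 2 = (2 * q ^+ 2 * (qinf (q ^+ 2) * qinf (- q ^+ 2)) ^+ 2)^-1.
Proof. by rewrite /c_q exprVn !exprMn sqr_sqrtr. Qed.

Lemma c_q_gt0 : 0 < c_q q.
Proof.
rewrite /c_q invr_gt0 !mulr_gt0 ?sqrtr_gt0 //; first exact: qq_inf_gt0.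
by rewrite (lt_le_trans ltr01) // qpoch_inf_ge1 // oppr_le0 exprn_ge0 // ltW.
Qed.

Lemma qinf_opp_ge0 (s : bool) (k : int) : (s -> 0 < k) -> 0 <= qinf (- qel s (k * 2)).
Proof.
move=> h; apply: qpoch_inf_ge0 => //; case: s h => h.
  rewrite qel1 opprK -(expr0z q) ltW // qz_lt; have := h isT; lia.
by rewrite qel0 (le_trans _ ler01) // oppr_le0 ltW // qz_gt0.
Qed.

Lemma qinf_opp_gt0 (s : bool) (k : int) : (s -> 0 < k) -> 0 < qinf (- qel s (k * 2)).
Proof.
move=> h; apply: qpoch_inf_gt0 => //; case: s h => h.
  rewrite qel1 opprK -(expr0z q) qz_lt; have := h isT; lia.
by rewrite qel0 (le_lt_trans _ ltr01) // oppr_le0 ltW // qz_gt0.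
Qed.

Definition apsi (s t : bool) (k l m : int) : R :=
  Psi q (- qel t (2 - l * 2)) (qel (s (+) t) (2 + (k - l) * 2))
    (qel t (2 + (k - m) * 2)).

Lemma afunE s k t l m : afun q (qel (s (+) t) m) (qel s k) (qel t l) =
  c_q q * ssign (qel s k) (qel t l) * (-1) ^ m * (- (-1) ^+ t) ^ k * q ^ l *
  nu q (qel false (m + l - k)) *
  Num.sqrt (qinf (- qel (s (+) t) (m * 2)) * qinf (- qel t (l * 2)) /
            qinf (- qel s (k * 2))) * apsi s t k l m.
Proof.
rewrite /afun qelM !sg_qel eqxx !chi_qel !kappa_qel norm_qel.
rewrite !qelV !qelM !kappa_qel.
have e2 : q ^+ 2 = qel false 2 by rewrite qel0.
rewrite /apsi e2 mulNr !qelM /nu !chi_qel.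
by rewrite !addFb addbA addbb addFb.
Qed.

Lemma afun_out p x y : Num.sg (x * y) != Num.sg p -> afun q p x y = 0.
Proof. by rewrite /afun => /negbTE ->. Qed.

(** Squaring removes the signs, the square root and the 1/2 in the exponent of [nu], leaving
    integral powers of q; the limits below are first computed in this form. *)
Lemma afun_sqr (s : bool) (k : int) (t : bool) (l m : int) : (s -> 0 < k) -> (t -> 0 < l) -> ((s (+) t)%B -> 0 < m) ->
  afun q (qel (s (+) t) m) (qel s k) (qel t l) ^+ 2 =
  c_q q ^+ 2 * q ^ (l * 2 + (m + l - k - 1) * (m + l - k - 2)) *
  (qinf (- qel (s (+) t) (m * 2)) * qinf (- qel t (l * 2)) / qinf (- qel s (k * 2))) *
  apsi s t k l m ^+ 2.
Proof.
move=> hs ht hst; rewrite afunE !exprMn nu_sqr sqr_sqrtr; last first.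
  by rewrite divr_ge0 ?mulr_ge0 ?qinf_opp_ge0.
have -> : ssign (qel s k) (qel t l) ^+ 2 = 1.
  by rewrite /ssign; case: ifP; rewrite ?sqrrN expr1n.
have sq (e : R) (i : int) : e ^+ 2 = 1 -> (e ^ i) ^+ 2 = 1.
  by move=> e2; rewrite [LHS](exprz_exp e i 2) mulrC -exprz_exp -[e ^ 2]/(e ^+ 2) e2 exp1rz.
rewrite (sq (-1) m) ?sqrrN ?expr1n // (sq (- (-1) ^+ t) k) ?sqrrN ?sqrr_sign // !mulr1.
rewrite [q ^ (_ + _)]expfzDr // [(q ^ l) ^+ 2](exprz_exp q l 2).
by rewrite !mulrA.
Qed.

End QPowers.

(** * Asymptotics of Psi on the diagonal, and a theta identity *)

Section PsiAsymptotics.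
Variables (R : realType) (q : R).
Hypothesis q01 : 0 < q < 1.
Let q0 : 0 < q. Proof. by case/andP: q01. Qed.
Let q1 : q < 1. Proof. by case/andP: q01. Qed.
Let qn0 : q != 0. Proof. by rewrite gt_eqF. Qed.
Local Notation qinf := (qpoch_inf q).
Local Notation qq n := (qpoch q (q ^+ 2) n).
Local Notation qqinf := (qpoch_inf q (q ^+ 2)).

Definition psi_t (a b z : R) (n : nat) : R :=
  qpoch q a n * qinf (b * q ^+ (2 * n)) / qq n * (-1) ^+ n * q ^+ (n * n.-1) * z ^+ n.

Arguments psi_t : simpl never.

Lemma PsiE a b z : Psi q a b z = limn (series (psi_t a b z)).
Proof. by []. Qed.

Definition psi_bound (a b : R) : R :=
  expR (`|a| * qgeom q) * expR (`|b| * qgeom q) / qqinf.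

Lemma psi_bound_ge0 a b : 0 <= psi_bound a b.
Proof. by rewrite divr_ge0 ?mulr_ge0 ?expR_ge0 // ltW // qq_inf_gt0. Qed.

Lemma expR_norm_le (a b : R) : `|a| <= `|b| -> expR (`|a| * qgeom q) <= expR (`|b| * qgeom q).
Proof. by move=> h; rewrite ler_expR ler_wpM2r // ltW // qgeom_gt0. Qed.

Lemma qqn_inv_le n : (qq n)^-1 <= qqinf^-1.
Proof.
by rewrite lef_pV2 ?posrE ?qqn_gt0 ?qq_inf_gt0 // qpoch_inf_le // qq_01.
Qed.

(** The majorant depends on b and z only through bounds on their moduli, so it serves for a whole
    family of parameters at once. *)
Lemma psi_t_le a b b' z Z n : `|b| <= `|b'| -> `|z| <= Z ->
  `|psi_t a b z n| <= psi_bound a b' * (q ^+ (n * n.-1) * Z ^+ n).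
Proof.
move=> bb zZ; rewrite /psi_t !normrM !normrX normrN1 expr1n mulr1 -mulrA.
rewrite (ger0_norm (ltW q0)) normfV (ger0_norm (ltW (qqn_gt0 q01 n))).
rewrite ler_pM // ?mulr_ge0 ?invr_ge0 ?exprn_ge0 ?(ltW q0) ?(ltW (qqn_gt0 q01 n)) //.
  rewrite /psi_bound ler_pM ?mulr_ge0 ?invr_ge0 ?(ltW (qqn_gt0 q01 n)) ?qqn_inv_le //.
  rewrite ler_pM // ?norm_qpoch_le //.
  rewrite (le_trans (norm_qpoch_inf_le q01 _)) // expR_norm_le //.
  rewrite (le_trans _ bb) // normrM [ `|q ^+ _| ]ger0_norm ?exprn_ge0 ?(ltW q0) //.
  by rewrite ler_piMr // qpow_le1.
rewrite ler_wpM2l ?exprn_ge0 ?(ltW q0) // lerXn2r ?nnegrE //.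
exact: le_trans zZ.
Qed.

Lemma psi_t_cvg a b z : cvgn (series (psi_t a b z)).
Proof.
apply: (dominated_series_cvg (gauss_summable q01 (psi_bound_ge0 a b) (normr_ge0 z))).
by move=> k; exact: psi_t_le.
Qed.

(* When [b = q ^ (2 - 2 n)] the factor [(b q^(2j); q^2)_oo] vanishes for [j < n]. *)
Lemma Psi_shift a b z n : b * q ^+ (2 * n) = q ^+ 2 ->
  series (fun k => psi_t a b z (n + k)) @ \oo --> Psi q a b z.
Proof.
move=> bE; rewrite PsiE; apply: cvg_series_shift; first exact: psi_t_cvg.
move=> k kn; rewrite /psi_t (@qpoch_inf_zero _ q q01 _ (n - k).-1) ?mulr0 ?mul0r //.
apply: (mulfI (expf_neq0 2 qn0)); rewrite mulr1.
have e : q ^+ (2 * n) = q ^+ 2 * q ^+ (2 * (n - k).-1) * q ^+ (2 * k).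
  by rewrite -!exprD; congr (q ^+ _); lia.
by rewrite -[RHS]bE e; ring.
Qed.

Lemma qinf_q2k k : qinf (q ^+ 2 * q ^+ (2 * k)) = qqinf / qq k.
Proof.
rewrite [in RHS](qpoch_inf_split q01 (q ^+ 2) k) [q ^+ 2 * _]mulrC mulrAC divff ?mul1r //.
by rewrite gt_eqF // qqn_gt0.
Qed.

Lemma Psi_shift_scaled a b z n c w : b * q ^+ (2 * n) = q ^+ 2 ->
  (forall k, c * psi_t a b z (n + k) = w k) -> c * Psi q a b z = limn (series w).
Proof.
move=> bE h; apply/esym/cvg_lim => //.
rewrite (_ : series w = (fun m => c * series (fun k => psi_t a b z (n + k)) m)).
  by apply: cvgMr; exact: Psi_shift.
apply/funext => m; rewrite !seriesEnat /= big_distrr.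
by apply: eq_bigr => k _; rewrite -h.
Qed.

Lemma limn_seriesMl (c : R) (w : nat -> R) : cvgn (series w) ->
  limn (series (fun k => c * w k)) = c * limn (series w).
Proof.
move=> cw; apply: cvg_lim => //.
rewrite (_ : series (fun k => c * w k) = (fun n => c * series w n)).
  by apply: cvgMr; exact: cw.
by apply/funext => n; rewrite !seriesEnat /= big_distrr.
Qed.

Lemma expn_pred (k : nat) : q ^+ (k * k.-1) = q ^ (k%:Z * (k%:Z - 1)).
Proof.
rewrite qzn; congr (q ^ _); case: k => [|k]; first by rewrite mul0r.
by rewrite /= PoszM; congr (_ * _); lia.
Qed.

Lemma cvg_shift_cst (u : nat -> R) (l : R) k : u @ \oo --> l ->
  (fun n => u (n + k)%N) @ \oo --> l.
Proof. by move=> h; rewrite (cvg_shiftn k u). Qed.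

Lemma cvgV0 (u : nat -> R) (l : R) : l != 0 -> u @ \oo --> l -> (fun n => (u n)^-1) @ \oo --> l^-1.
Proof. by move=> l0 h; apply: cvgV. Qed.

(** The parameters b = z = q^(2-2n) blow up, but the first n terms vanish. After shifting the index
    by n and inserting (-1)^n q^(n(n-1)), the k-th term tends to (a)_oo (-1)^k q^(k(k-1)) q^(2k) /
    (q^2)_k, and Euler's identity at q^2 sums these limits. *)
Lemma Psi_diag_pos (a : R) :
  (fun n : nat => Psi q a (q ^ (2 - n%:Z * 2)) (q ^ (2 - n%:Z * 2)) *
     ((-1) ^+ n * q ^ (n%:Z * (n%:Z - 1)))) @ \oo --> qinf a * qqinf.
Proof.
pose u (n k : nat) : R := qpoch q a (n + k) * (qqinf / qq k) / qq (n + k) *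
   (-1) ^+ k * q ^+ (k * k.-1) * (q ^+ 2) ^+ k.
have uE n : Psi q a (q ^ (2 - n%:Z * 2)) (q ^ (2 - n%:Z * 2)) *
    ((-1) ^+ n * q ^ (n%:Z * (n%:Z - 1))) = limn (series (u n)).
  have bE : q ^ (2 - n%:Z * 2) * q ^+ (2 * n) = q ^+ 2.
    by rewrite !qzn -expfzDr //; congr (q ^ _); lia.
  rewrite mulrC; apply: (Psi_shift_scaled bE) => k; rewrite /psi_t /u.
  have -> : q ^ (2 - n%:Z * 2) * q ^+ (2 * (n + k)) = q ^+ 2 * q ^+ (2 * k).
    by rewrite !qzn -!expfzDr //; congr (q ^ _); lia.
  rewrite qinf_q2k !expn_pred exprD.
  have -> : (q ^ (2 - n%:Z * 2)) ^+ (n + k) = q ^ ((2 - n%:Z * 2) * (n + k)%:Z).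
    by rewrite -exprz_exp.
  have e : q ^ (n%:Z * (n%:Z - 1)) * (q ^ ((n + k)%:Z * ((n + k)%:Z - 1)) *
      q ^ ((2 - n%:Z * 2) * (n + k)%:Z)) = q ^ (k%:Z * (k%:Z - 1)) * (q ^+ 2) ^+ k.
    rewrite -exprM qzn -!expfzDr //; congr (q ^ _); lia.
  rewrite -[RHS]mulrA -e.
  have s2 (y : R) : (-1) ^+ n * (-1) ^+ n * y = y by rewrite -expr2 sqrr_sign mul1r.
  by rewrite -[RHS]s2; ring.
have B0 : 0 <= expR (`|a| * qgeom q) * qqinf^-1 by rewrite mulr_ge0 ?expR_ge0 ?invr_ge0 ?(ltW (qq_inf_gt0 q01)).
under eq_fun do rewrite uE.
have -> : qinf a * qqinf = limn (series (fun k : nat =>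
    qinf a * ((-1) ^+ k * q ^+ (k * k.-1) * (q ^+ 2) ^+ k / qq k))).
  rewrite limn_seriesMl; first by rewrite euler_qexp.
  have c0 : 0 <= qqinf^-1 by rewrite invr_ge0 ltW // qq_inf_gt0.
  apply: (dominated_series_cvg (gauss_summable q01 c0 (exprn_ge0 2 (ltW q0)))) => k.
  rewrite !normrM !normrX normrN1 expr1n mul1r normfV !(ger0_norm (ltW q0)).
  rewrite mulrC (ger0_norm (ltW (qqn_gt0 q01 k))) ler_wpM2r ?qqn_inv_le //.
  by rewrite mulr_ge0 // !exprn_ge0 // ltW.
have c1 k : 0 <= qqinf / qq k by rewrite divr_ge0 // ltW ?qq_inf_gt0 ?qqn_gt0.
have c2 k : qqinf / qq k <= 1.
  by rewrite ler_pdivrMr ?qqn_gt0 // mul1r qpoch_inf_le // qq_01.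
apply: (tannery (M := fun k => expR (`|a| * qgeom q) * qqinf^-1 * (q ^+ (k * k.-1) * (q ^+ 2) ^+ k))).
- by apply: gauss_summable => //; rewrite exprn_ge0 // ltW.
- move=> N k; rewrite /u; have := c1 k; have := c2 k; move: (qqinf / qq k) => r r1 r0.
  rewrite !normrM !normrX normrN1 expr1n mulr1 !(ger0_norm (ltW q0)) (ger0_norm r0).
  rewrite -mulrA ler_wpM2r ?mulr_ge0 ?exprn_ge0 ?(ltW q0) //.
  rewrite normfV (ger0_norm (ltW (qqn_gt0 q01 _))) ler_pM ?qqn_inv_le ?invr_ge0 ?(ltW (qqn_gt0 q01 _)) //.
    by rewrite mulr_ge0.
  by rewrite -[leRHS]mulr1 ler_pM // norm_qpoch_le.
move=> k; have -> : qinf a * ((-1) ^+ k * q ^+ (k * k.-1) * (q ^+ 2) ^+ k / qq k) =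
    qinf a * (qqinf / qq k) / qqinf * (-1) ^+ k * q ^+ (k * k.-1) * (q ^+ 2) ^+ k.
  by field; rewrite !gt_eqF ?qq_inf_gt0 ?qqn_gt0.
rewrite /u; do 3! apply: cvgMl; apply: cvgM; last first.
  apply: cvgV0; first by rewrite gt_eqF // qq_inf_gt0.
  by apply: cvg_shift_cst; exact: qpoch_infE.
by apply: cvgMl; apply: cvg_shift_cst; exact: qpoch_infE.
Qed.

(** Each factor 1 - q^(2i-2N) is -q^(2i-2N) times 1 - q^(2N-2i), and the latter are the top k
    factors of (q^2; q^2)_N. *)
Lemma qpoch_qN (N k : nat) : (k <= N)%N ->
  qpoch q (q ^ (- (N%:Z * 2))) k * qq (N - k) =
  (-1) ^+ k * q ^+ (k * k.-1) * (q ^ (- (N%:Z * 2))) ^+ k * qq N.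
Proof.
elim: k => [|k IH] kN; first by rewrite qpoch0 subn0 !expr0 !mulr1 !mul1r.
have h := IH (ltnW kN); set a := q ^ _ in h *.
have e1 : qq (N - k) = qq (N - k.+1) * (1 - q ^+ (2 * (N - k.+1)) * q ^+ 2).
  by rewrite -qpochS; congr (qpoch _ _ _); lia.
have e2 : q ^+ (2 * k) * a * (q ^+ (2 * (N - k.+1)) * q ^+ 2) = 1.
  rewrite /a !qzn -!expfzDr // -(expr0z q); congr (q ^ _); lia.
have e3 : q ^+ (k.+1 * k.+1.-1) = q ^+ (k * k.-1) * q ^+ (2 * k).
  by rewrite -exprD; congr (q ^+ _); case: k {IH kN h e1 e2} => //= k; lia.
rewrite qpochS e3 [(-1) ^+ k.+1]exprS [a ^+ k.+1]exprS.
transitivity (- (q ^+ (2 * k) * a) * (qpoch q a k * qq (N - k))).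
  rewrite e1 -{1}e2.
  by ring.
by rewrite h; ring.
Qed.

(** By [qpoch_qN] the summand is the k-th term of the finite q-binomial expansion of the right-hand
    side. *)
Lemma sum_qpoch_qN (N : nat) :
  \sum_(k < N.+1) qpoch q (q ^ (- (N%:Z * 2))) k / qq k = qpoch q (q ^ (- (N%:Z * 2))) N.
Proof.
rewrite [RHS]qbinomial //; apply: eq_bigr => -[k kN] _ /=; have kN' : (k <= N)%N by [].
have n0 j : qq j != 0 by rewrite gt_eqF // qqn_gt0.
apply: (mulIf (n0 (N - k)%N)); rewrite mulrAC qpoch_qN //.
apply: (mulIf (n0 k)); rewrite mulfVK //.
by rewrite -(qbin_qpoch q01 kN'); ring.
Qed.

(** With b = -q^(2-2n) -> -oo, the numerator is the product of the leading parts -q^(2i) b of the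
    factors 1 - q^(2i) b of the denominator. *)
Lemma ratio_cvg1 (k : nat) :
  (fun n : nat => (-1) ^+ k * q ^+ (k * k.-1) * (- q ^ (2 - n%:Z * 2)) ^+ k /
     qpoch q (- q ^ (2 - n%:Z * 2)) k) @ \oo --> (1 : R).
Proof.
elim: k => [|k IH].
  rewrite [X in X @ _](_ : _ = fun=> 1); first exact: cvg_cst.
  by apply/funext => n; rewrite qpoch0 !expr0 !mulr1 divr1.
(* [w n] is the inverse of -q^(2k) b, so the factor of index k multiplies the quotient by 1 / (1 + w
   n). *)
pose w (n : nat) : R := q ^ (- 2 - k%:Z * 2 + n%:Z * 2).
rewrite (_ : (fun n : nat => _) = (fun n : nat =>
    (-1) ^+ k * q ^+ (k * k.-1) * (- q ^ (2 - n%:Z * 2)) ^+ k /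
     qpoch q (- q ^ (2 - n%:Z * 2)) k * (1 + w n)^-1)); last first.
  apply/funext => n; set b := - q ^ _.
  have b0 : b <= 0 by rewrite oppr_le0 ltW // qz_gt0.
  have p0 : qpoch q b k != 0 by rewrite gt_eqF // (lt_le_trans ltr01) // qpoch_ge1.
  have w0 : 1 + w n != 0 by rewrite gt_eqF // addr_gt0 // qz_gt0.
  have e3 : q ^+ (k.+1 * k.+1.-1) = q ^+ (k * k.-1) * q ^+ (2 * k).
    by rewrite -exprD; congr (q ^+ _); case: k {IH w p0 w0} => //= k; lia.
  have e : q ^+ (2 * k) * b * w n = - 1.
    rewrite /b mulrN mulNr; congr (- _).
    rewrite /w !qzn -!expfzDr // -(expr0z q); congr (q ^ _); lia.
  have wn0 : w n != 0 by rewrite qz_neq0.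
  have eb : q ^+ (2 * k) * b = - (w n)^-1 by apply: (mulIf wn0); rewrite e mulNr mulVf.
  rewrite qpochS e3 eb [(-1) ^+ k.+1]exprS [b ^+ k.+1]exprS.
  transitivity ((-1) ^+ k * q ^+ (k * k.-1) * b ^+ k / qpoch q b k *
      (- (q ^+ (2 * k) * b) / (1 + (w n)^-1))).
    by field; rewrite p0 wn0 addrC w0.
  by rewrite eb opprK; field; rewrite p0 wn0 ?w0 // addrC w0.
rewrite -[X in _ --> X]mulr1; apply: cvgM; first exact: IH.
rewrite -[X in _ --> X]invr1; apply: cvgV0; first exact: oner_neq0.
rewrite -[X in _ --> X]addr0; apply: cvgD; first exact: cvg_cst.
exact: qpow2_cvg0.
Qed.

(** For negative t the first parameter is q^(-2N), so the series stops at k = N and the limit is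
    taken term by term; dividing by (b)_oo leaves 1 / (b)_k in the k-th term, which is the situation
    of [ratio_cvg1]. *)
Lemma Psi_diag_neg (N : nat) :
  (fun n : nat => Psi q (q ^ (- (N%:Z * 2))) (- q ^ (2 - n%:Z * 2)) (- q ^ (2 - n%:Z * 2)) /
     qinf (- q ^ (2 - n%:Z * 2))) @ \oo --> qpoch q (q ^ (- (N%:Z * 2))) N.
Proof.
set a := q ^ _; rewrite -sum_qpoch_qN -/a.
have az : q ^+ (2 * N) * a = 1.
  by rewrite /a qzn -expfzDr // -(expr0z q); congr (q ^ _); lia.
rewrite (_ : (fun n : nat => _) = (fun n : nat => \sum_(k < N.+1) (qpoch q a k / qq k *
    ((-1) ^+ k * q ^+ (k * k.-1) * (- q ^ (2 - n%:Z * 2)) ^+ k /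
     qpoch q (- q ^ (2 - n%:Z * 2)) k)))); last first.
  apply/funext => n; set b := - q ^ _.
  have b0 : b <= 0 by rewrite oppr_le0 ltW // qz_gt0.
  rewrite PsiE (@limn_series_finite _ _ N.+1) => [|k Nk]; last first.
    by rewrite /psi_t (qpoch_zero Nk az) !mul0r.
  rewrite big_distrl /=; apply: eq_bigr => -[k kN] _ /=; rewrite /psi_t.
  have p0 : qpoch q b k != 0 by rewrite gt_eqF // (lt_le_trans ltr01) // qpoch_ge1.
  have p1 : qinf (q ^+ (2 * k) * b) != 0.
    by rewrite gt_eqF // (lt_le_trans ltr01) // qpoch_inf_ge1 // mulr_ge0_le0 ?exprn_ge0 // ltW.
  have p2 : qq k != 0 by rewrite gt_eqF // qqn_gt0.
  rewrite (qpoch_inf_split q01 b k) [b * _]mulrC; field.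
  by rewrite p0 p1 p2.
elim: N.+1 => [|M IH].
  rewrite big_ord0 [X in X @ _](_ : _ = fun=> 0); first exact: cvg_cst.
  by apply/funext => n; rewrite big_ord0.
under eq_fun do rewrite big_ord_recr /=; rewrite big_ord_recr /=.
apply: cvgD; first exact: IH.
by rewrite -[X in _ --> X]mulr1; apply: cvgMr; exact: ratio_cvg1.
Qed.

(** Quasi-periodicity of the theta function: under T -> T + 1 the left side is multiplied by
    q^(-2T), as is the right side. The constant comes from T = 0, where (-1)_oo = 2 (-q^2)_oo. *)
Lemma theta_q (T : int) : qinf (- q ^ (T * 2)) * qinf (- q ^ (2 - T * 2)) =
  2 * qinf (- q ^+ 2) ^+ 2 * q ^ (- (T * (T - 1))).
Proof.
pose th (T : int) := qinf (- q ^ (T * 2)) * qinf (- q ^ (2 - T * 2)) * q ^ (T * (T - 1)).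
have step T' : th (T' + 1) = th T'.
  rewrite /th.
  have sp (j : int) : qinf (- q ^ (j * 2)) = (1 + q ^ (j * 2)) * qinf (- q ^ ((j + 1) * 2)).
    rewrite (qpoch_inf_split q01 _ 1) qpochS qpoch0 mul1r muln0 expr0 mul1r opprK.
    congr (_ * qinf _); rewrite muln1 mulrN; congr (- _).
    by rewrite qzn -expfzDr //; congr (q ^ _); lia.
  rewrite (sp T').
  have -> : 2 - (T' + 1) * 2 = - T' * 2 by lia.
  rewrite (sp (- T')); have -> : (- T' + 1) * 2 = 2 - T' * 2 by lia.
  have -> : (T' + 1) * (T' + 1 - 1) = T' * (T' - 1) + T' * 2 by lia.
  have e : q ^ (- T' * 2) * q ^ (T' * 2) = 1.
    by rewrite -expfzDr // -(expr0z q); congr (q ^ _); lia.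
  rewrite [q ^ (T' * (T' - 1) + _)]expfzDr //.
  transitivity (qinf (- q ^ ((T' + 1) * 2)) * qinf (- q ^ (2 - T' * 2)) * q ^ (T' * (T' - 1)) *
     (q ^ (T' * 2) + q ^ (- T' * 2) * q ^ (T' * 2))); first by ring.
  by rewrite e; ring.
have th0 : th T = th 0.
  elim: T => [//|n IH|n IH].
    by rewrite -IH -(step n%:Z); congr th; lia.
  by rewrite -IH -(step (- n.+1%:Z)); congr th; lia.
apply: (mulIf (qz_neq0 q01 (T * (T - 1)))); rewrite -/(th T) th0 -[RHS]mulrA -[X in _ = _ * X]expfzDr //.
rewrite addNr expr0z mulr1 /th mul0r subr0 !expr0z mulr1.
rewrite {1}(qpoch_inf_split q01 (- 1) 1) qpochS qpoch0 mul1r muln0 expr0 mul1r opprK.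
by rewrite muln1 mulrN1 qzn; ring.
Qed.

End PsiAsymptotics.

(** * The limit of a_t(x,t) as x tends to oo *)

Section MatrixCoefficients.
Variables (R : realType) (q : R).
Hypothesis q01 : 0 < q < 1.
Let q0 : 0 < q. Proof. by case/andP: q01. Qed.
Let q1 : q < 1. Proof. by case/andP: q01. Qed.
Let qn0 : q != 0. Proof. by rewrite gt_eqF. Qed.
Local Notation qinf := (qpoch_inf q).
Local Notation qq n := (qpoch q (q ^+ 2) n).
Local Notation qqinf := (qpoch_inf q (q ^+ 2)).
Local Notation qel := (qelt q).

Lemma sqr_cvg0 (u : nat -> R) : (fun n => u n ^+ 2) @ \oo --> (0 : R) ->
  u @ \oo --> (0 : R).
Proof.
move=> h; apply/cvgrPdist_lt => e e0.
move/cvgrPdist_lt: h => /(_ (e ^+ 2) (exprn_gt0 _ e0))[N _ hN].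
exists N => // n Nn; have := hN n Nn; rewrite /= !sub0r !normrN normrX.
by rewrite ltr_sqr ?nnegrE // ltW.
Qed.

Lemma sqr_cvg1 (u : nat -> R) : (fun n => u n ^+ 2) @ \oo --> (1 : R) ->
  (\forall n \near \oo, 0 <= u n) -> u @ \oo --> (1 : R).
Proof.
move=> h p; rewrite -(@sqrtr1 R).
have : (fun n => Num.sqrt (u n ^+ 2)) @ \oo --> Num.sqrt (1 : R).
  by apply: continuous_cvg => //; exact: sqrt_continuous.
apply: cvg_trans; apply: near_eq_cvg; near=> n.
by rewrite sqrtr_sqr ger0_norm //; near: n.
Unshelve. all: by end_near. Qed.

Lemma qzX (k : int) (n : nat) : (q ^ k) ^+ n = q ^ (k * n%:Z).
Proof. exact: (exprz_exp q k n). Qed.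

Lemma qinf_neg_gt0 (k : int) : 0 < qinf (- q ^ k).
Proof. by rewrite (lt_le_trans ltr01) // qpoch_inf_ge1 // oppr_le0 ltW // qz_gt0. Qed.

Lemma qinf_negV (T : int) : (qinf (- q ^ (T * 2)))^-1 =
  qinf (- q ^ (2 - T * 2)) * q ^ (T * (T - 1)) / (2 * qinf (- q ^+ 2) ^+ 2).
Proof.
have h1 : qinf (- q ^ (T * 2)) != 0 by rewrite gt_eqF // qinf_neg_gt0.
have h2 : qinf (- q ^+ 2) != 0 by rewrite gt_eqF // (qinf_neg_gt0 2).
have e : q ^ (T * (T - 1)) * q ^ (- (T * (T - 1))) = 1.
  by rewrite -expfzDr // subrr expr0z.
apply: (mulfI h1); rewrite divff // mulrA mulrA (theta_q q01 T) -[LHS]e.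
by field.
Qed.

Lemma qinf_cvg1_pos (k : int) : (fun n : nat => qinf (- q ^ (k + n%:Z * 2))) @ \oo --> (1 : R).
Proof.
apply: qpoch_inf_cvg1 => //; rewrite -[X in _ --> X]oppr0; apply: cvgN.
exact: qpow2_cvg0.
Qed.

(** A constant part of a_t(x,t)^2 once the denominator (-kappa(x))_oo has been inverted by
    [theta_q]; the powers of q depending on n then combine into the square of the normalizing factor
    of [Psi]. *)
Definition diag_pref (T : int) : R :=
  c_q q ^+ 2 * q ^ (2 * T * T - T * 2 + 2) / (2 * qinf (- q ^+ 2) ^+ 2).

Lemma afun_diag_sqr (t : bool) (T : int) (n : nat) : (t -> 0 < T) ->
  afun q (qel t T) (qel false (T - n%:Z)) (qel t T) ^+ 2 =
  diag_pref T * qinf (- qel t (T * 2)) ^+ 2 * qinf (- q ^ (2 - T * 2 + n%:Z * 2)) *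
  (apsi q false t (T - n%:Z) T T * q ^ (n%:Z * (n%:Z - 1))) ^+ 2.
Proof.
move=> ht; have := @afun_sqr _ _ q01 false (T - n%:Z) t T T; rewrite addFb => ->//.
rewrite [- qel false _](_ : _ = - q ^ ((T - n%:Z) * 2)); last by rewrite qel0.
rewrite qinf_negV /diag_pref [(apsi _ _ _ _ _ _ * _) ^+ 2]exprMn [(q ^ _) ^+ 2]qzX.
have -> : 2 - (T - n%:Z) * 2 = 2 - T * 2 + n%:Z * 2 by lia.
have e : q ^ (T * 2 + (T + T - (T - n%:Z) - 1) * (T + T - (T - n%:Z) - 2)) *
    q ^ ((T - n%:Z) * (T - n%:Z - 1)) =
    q ^ (2 * T * T - T * 2 + 2) * q ^ (n%:Z * (n%:Z - 1) * 2).
  by rewrite -!expfzDr //; congr (q ^ _); lia.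
transitivity (c_q q ^+ 2 * (q ^ (T * 2 + (T + T - (T - n%:Z) - 1) * (T + T - (T - n%:Z) - 2)) *
    q ^ ((T - n%:Z) * (T - n%:Z - 1))) / (2 * qinf (- q ^+ 2) ^+ 2) *
    qinf (- qel t (T * 2)) ^+ 2 * qinf (- q ^ (2 - T * 2 + n%:Z * 2)) *
    apsi q false t (T - n%:Z) T T ^+ 2); first by ring.
by rewrite e; ring.
Qed.

Lemma sqr_mono_sign (e x : R) : e ^+ 2 = 1 -> (e * x) ^+ 2 = x ^+ 2.
Proof. by move=> h; rewrite exprMn h mul1r. Qed.

(** Here the value of [c_q] matters: for the [v] produced by either sign of t, the squared limit is
    exactly 1. *)
Lemma diag_prefE (T : int) (v : R) :
  v * q ^ (T * (T - 1)) = 2 * qinf (- q ^+ 2) ^+ 2 * qqinf ->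
  diag_pref T * v ^+ 2 = 1.
Proof.
move=> h.
have h2 : qinf (- q ^+ 2) != 0 by rewrite gt_eqF // (qinf_neg_gt0 2).
have h3 : qqinf != 0 by rewrite gt_eqF // qq_inf_gt0.
have e : q ^ (2 * T * T - T * 2 + 2) = q ^+ 2 * (q ^ (T * (T - 1))) ^+ 2.
  by rewrite qzX qzn -expfzDr //; congr (q ^ _); lia.
rewrite /diag_pref e c_q_sqr.
transitivity (q ^+ 2 * (v * q ^ (T * (T - 1))) ^+ 2 /
   (2 * q ^+ 2 * (qqinf * qinf (- q ^+ 2)) ^+ 2) / (2 * qinf (- q ^+ 2) ^+ 2)).
  by field; rewrite h2 h3 qn0.
by rewrite h; field; rewrite h2 h3 qn0.
Qed.

(** The square tends to 1, and the values are eventually nonnegative: the sign (-1)^n coming from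
    (-1)^chi(p) (-1)^chi(x) is that of [Psi]. *)
Lemma afun_diag_pos (T : int) :
  (fun n : nat => afun q (q ^ T) (q ^ (T - n%:Z)) (q ^ T)) @ \oo --> (1 : R).
Proof.
have U := @Psi_diag_pos _ _ q01 (- q ^ (2 - T * 2)).
have pE n : apsi q false false (T - n%:Z) T T =
    Psi q (- q ^ (2 - T * 2)) (q ^ (2 - n%:Z * 2)) (q ^ (2 - n%:Z * 2)).
  have e : 2 + (T - n%:Z - T) * 2 = 2 - n%:Z * 2 by lia.
  by rewrite /apsi [false (+) false]/= !qel0 e.
have U0 : 0 < qinf (- q ^ (2 - T * 2)) * qqinf.
  by apply: mulr_gt0; [exact: qinf_neg_gt0|exact: qq_inf_gt0].
apply: sqr_cvg1.
  rewrite -(@diag_prefE T (qinf (- q ^ (T * 2)) * (qinf (- q ^ (2 - T * 2)) * qqinf))); last first.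
    rewrite mulrA (theta_q q01 T) mulrAC -[_ * q ^ (- _) * _]mulrA -expfzDr // addNr expr0z.
    by rewrite mulr1.
  rewrite (_ : (fun n : nat => _) = (fun n : nat =>
     diag_pref T * qinf (- q ^ (T * 2)) ^+ 2 * qinf (- q ^ (2 - T * 2 + n%:Z * 2)) *
     (Psi q (- q ^ (2 - T * 2)) (q ^ (2 - n%:Z * 2)) (q ^ (2 - n%:Z * 2)) *
     ((-1) ^+ n * q ^ (n%:Z * (n%:Z - 1)))) ^+ 2)); last first.
    apply/funext => n; have := @afun_diag_sqr false T n; rewrite !qel0 => -> //.
    rewrite pE; congr (_ * _); rewrite [X in _ = X ^+ 2]mulrCA.
    by rewrite [RHS]sqr_mono_sign ?sqrr_sign.
  have -> : diag_pref T * (qinf (- q ^ (T * 2)) * (qinf (- q ^ (2 - T * 2)) * qqinf)) ^+ 2 =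
      diag_pref T * qinf (- q ^ (T * 2)) ^+ 2 * 1 * (qinf (- q ^ (2 - T * 2)) * qqinf) ^+ 2.
    by ring.
  apply: cvgM; first by apply: cvgMr; exact: qinf_cvg1_pos.
  by rewrite expr2; under eq_fun do rewrite expr2; apply: cvgM; exact: U.
have : \forall n \near \oo, 0 < Psi q (- q ^ (2 - T * 2)) (q ^ (2 - n%:Z * 2))
    (q ^ (2 - n%:Z * 2)) * ((-1) ^+ n * q ^ (n%:Z * (n%:Z - 1))).
  by move: U => /cvgr_gt; apply.
apply: filterS => n hn.
have := @afunE _ _ q01 false (T - n%:Z) false T T; rewrite !qel0 => ->.
rewrite pE -!qel0 /ssign !qel_gt0 // qel_lt0 //= !qel0.
have -> : - (-1) ^+ false = -1 :> R by [].
have e : (-1) ^ T * (-1) ^ (T - n%:Z) = (-1) ^+ n :> R.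
  have u : (-1 : R) != 0 by rewrite oppr_eq0 oner_neq0.
  rewrite -expfzDr // (_ : T + (T - n%:Z) = T * 2 - n%:Z); last by lia.
  rewrite expfzDr // mulrC -[(-1) ^ (T * 2)]exprz_exp exprzAC -[(-1) ^ 2]/((-1) ^+ 2) sqrrN expr1n exp1rz mulr1.
  by rewrite -invr_expz -exprnP signrN || rewrite -invr_expz -exprnP invr_sign.
rewrite mulr1 -[_ * (-1) ^ T * _]mulrA e.
set P := Psi _ _ _ _ in hn *.
have hP : 0 <= (-1) ^+ n * P.
  move: hn; rewrite mulrA pmulr_lgt0 ?qz_gt0 // mulrC; exact: ltW.
set N := nu _ _; set S := Num.sqrt _.
rewrite (_ : _ * P = c_q q * q ^ T * N * S * ((-1) ^+ n * P)); last by ring.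
apply: mulr_ge0 => //.
by rewrite !mulr_ge0 ?sqrtr_ge0 ?powR_ge0 ?(ltW (c_q_gt0 q01)) ?(ltW (qz_gt0 q01 _)).
Qed.

(** The limit of the normalized [Psi] has the sign (-1)^N. It is compensated by (-1)^chi(p) =
    -(-1)^N together with s(x,y) = -1. *)
Lemma afun_diag_neg (N : nat) : let T := (N.+1)%:Z in
  (fun n : nat => afun q (- q ^ T) (q ^ (T - n%:Z)) (- q ^ T)) @ \oo --> (1 : R).
Proof.
move=> T; have V := @Psi_diag_neg _ _ q01 N; set v := qpoch _ _ _ in V.
have pE n : apsi q false true (T - n%:Z) T T =
    Psi q (q ^ (- (N%:Z * 2))) (- q ^ (2 - n%:Z * 2)) (- q ^ (2 - n%:Z * 2)).
  have e : 2 + (T - n%:Z - T) * 2 = 2 - n%:Z * 2 by lia.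
  have e' : 2 - T * 2 = - (N%:Z * 2) by rewrite /T; lia.
  by rewrite /apsi addFb !qel1 opprK e e'.
have h2 : qinf (- q ^+ 2) != 0 by rewrite gt_eqF // (qinf_neg_gt0 2).
have vE : v = (-1) ^+ N * (q ^ (- (T * (T - 1))) * qq N).
  have := qpoch_qN q01 (leqnn N); rewrite subnn qpoch0 mulr1 -/v => ->.
  rewrite expn_pred // -!mulrA; congr (_ * _); rewrite mulrA; congr (_ * _).
  by rewrite qzX -expfzDr //; congr (q ^ _); rewrite /T; lia.
(* The growing product (b)_oo by which [Psi] was divided has to be restored; [theta_q] at 1 - n
   shows that, multiplied by q^(n(n-1)), it has a finite limit. *)
have bE n : qinf (- q ^ (2 - n%:Z * 2)) * q ^ (n%:Z * (n%:Z - 1)) =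
    2 * qinf (- q ^+ 2) ^+ 2 / qinf (- q ^ (0 + n%:Z * 2)).
  have p0 : qinf (- q ^ (0 + n%:Z * 2)) != 0 by rewrite gt_eqF // qinf_neg_gt0.
  apply: (mulIf p0); rewrite mulfVK //.
  have th := theta_q q01 (1 - n%:Z).
  have e1 : (1 - n%:Z) * 2 = 2 - n%:Z * 2 by lia.
  have e2 : 2 - (2 - n%:Z * 2) = 0 + n%:Z * 2 by lia.
  rewrite e1 e2 in th; rewrite mulrAC th -[LHS]mulrA -[X in _ * X = _]expfzDr //.
  have e3 : - ((1 - n%:Z) * (1 - n%:Z - 1)) + n%:Z * (n%:Z - 1) = 0 by lia.
  by rewrite e3 expr0z mulr1.
apply: sqr_cvg1.
  rewrite -(@diag_prefE T (qinf (q ^ (T * 2)) * (v * (2 * qinf (- q ^+ 2) ^+ 2)) * (-1) ^+ N)); last first.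
    rewrite vE.
    have e1 : q ^ (- (T * (T - 1))) * q ^ (T * (T - 1)) = 1 by rewrite -expfzDr // addNr expr0z.
    have e2 : qqinf = qq N * qinf (q ^ (T * 2)).
      rewrite (qpoch_inf_split q01 (q ^+ 2) N); congr (_ * qinf _).
      by rewrite !qzn -expfzDr //; congr (q ^ _); rewrite /T; lia.
    have e3 : (-1) ^+ N * (-1) ^+ N = 1 :> R by rewrite -expr2 sqrr_sign.
    rewrite e2; transitivity (2 * qinf (- q ^+ 2) ^+ 2 * (qq N * qinf (q ^ (T * 2))) *
      ((-1) ^+ N * (-1) ^+ N) * (q ^ (- (T * (T - 1))) * q ^ (T * (T - 1)))); first by ring.
    by rewrite e3 e1 !mulr1.
  rewrite (_ : (fun n : nat => _) = (fun n : nat =>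
     diag_pref T * qinf (q ^ (T * 2)) ^+ 2 * qinf (- q ^ (2 - T * 2 + n%:Z * 2)) *
     (Psi q (q ^ (- (N%:Z * 2))) (- q ^ (2 - n%:Z * 2)) (- q ^ (2 - n%:Z * 2)) /
       qinf (- q ^ (2 - n%:Z * 2)) *
      (2 * qinf (- q ^+ 2) ^+ 2 / qinf (- q ^ (0 + n%:Z * 2)))) ^+ 2)); last first.
    apply/funext => n; have := @afun_diag_sqr true T n; rewrite !qel1 !qel0 opprK => -> //.
    rewrite pE -bE; congr (_ * _ ^+ 2); rewrite mulrA mulfVK //.
    by rewrite gt_eqF // qinf_neg_gt0.
  have -> : diag_pref T * (qinf (q ^ (T * 2)) * (v * (2 * qinf (- q ^+ 2) ^+ 2)) * (-1) ^+ N) ^+ 2 =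
      diag_pref T * qinf (q ^ (T * 2)) ^+ 2 * 1 * (v * (2 * qinf (- q ^+ 2) ^+ 2)) ^+ 2.
    by rewrite [(_ * (-1) ^+ N) ^+ 2]exprMn sqrr_sign; ring.
  apply: cvgM; first by apply: cvgMr; exact: qinf_cvg1_pos.
  have c : (fun n : nat => Psi q (q ^ (- (N%:Z * 2))) (- q ^ (2 - n%:Z * 2)) (- q ^ (2 - n%:Z * 2)) /
       qinf (- q ^ (2 - n%:Z * 2)) *
      (2 * qinf (- q ^+ 2) ^+ 2 / qinf (- q ^ (0 + n%:Z * 2)))) @ \oo -->
      v * (2 * qinf (- q ^+ 2) ^+ 2).
    apply: cvgM; first exact: V.
    rewrite -[X in _ --> X]divr1; apply: cvgMr; apply: cvgV0; first exact: oner_neq0.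
    exact: qinf_cvg1_pos.
  by rewrite expr2; under eq_fun do rewrite expr2; apply: cvgM; exact: c.
have v0 : 0 < (-1) ^+ N * v.
  by rewrite vE mulrA -expr2 sqrr_sign mul1r mulr_gt0 ?qz_gt0 ?qqn_gt0.
have V' : (fun n : nat => (-1) ^+ N * (Psi q (q ^ (- (N%:Z * 2))) (- q ^ (2 - n%:Z * 2))
   (- q ^ (2 - n%:Z * 2)) / qinf (- q ^ (2 - n%:Z * 2)))) @ \oo --> (-1) ^+ N * v.
  by apply: cvgMr; exact: V.
have : \forall n \near \oo, 0 < (-1) ^+ N * (Psi q (q ^ (- (N%:Z * 2))) (- q ^ (2 - n%:Z * 2))
   (- q ^ (2 - n%:Z * 2)) / qinf (- q ^ (2 - n%:Z * 2))).
  by move: V' => /cvgr_gt; apply.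
apply: filterS => n hn.
have := @afunE _ _ q01 false (T - n%:Z) true T T; rewrite addFb !qel1 !qel0 => ->.
have -> : ssign (q ^ (T - n%:Z)) (- q ^ T) = -1.
  by rewrite /ssign qz_gt0 // oppr_lt0 qz_gt0.
rewrite pE.
have -> : - (-1) ^+ true = 1 :> R by rewrite /= expr1 opprK.
rewrite exp1rz mulr1.
set P := Psi _ _ _ _ in hn *.
have hP : 0 <= (-1) ^+ N * P.
  by move: hn; rewrite mulrA pmulr_lgt0 ?invr_gt0 ?qinf_neg_gt0 //; exact: ltW.
have eT : (-1) ^ T = - (-1) ^+ N :> R by rewrite /T -exprnP exprS mulN1r.
rewrite eT; set M := nu _ _; set S := Num.sqrt _.
rewrite (_ : _ * P = c_q q * q ^ T * M * S * ((-1) ^+ N * P)); last by ring.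
apply: mulr_ge0 => //.
by rewrite !mulr_ge0 ?sqrtr_ge0 ?powR_ge0 ?(ltW (c_q_gt0 q01)) ?(ltW (qz_gt0 q01 _)).
Qed.

End MatrixCoefficients.

(** * Decay of a_p(x,y) as x tends to 0 *)

Section Decay.
Variables (R : realType) (q : R).
Hypothesis q01 : 0 < q < 1.
Let q0 : 0 < q. Proof. by case/andP: q01. Qed.
Let q1 : q < 1. Proof. by case/andP: q01. Qed.
Let qn0 : q != 0. Proof. by rewrite gt_eqF. Qed.
Local Notation qinf := (qpoch_inf q).
Local Notation qq n := (qpoch q (q ^+ 2) n).
Local Notation qqinf := (qpoch_inf q (q ^+ 2)).
Local Notation qel := (qelt q).

Lemma qz_le (k l : int) : (q ^ k <= q ^ l) = (l <= k).
Proof. by rewrite leNgt qz_lt // -leNgt. Qed.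

(** As x tends to 0 the last two parameters of [Psi] only shrink, so the majorant taken at |x| = 1
    serves for all of them. *)
Lemma apsi_bound (s t : bool) (l m : int) : exists2 D, 0 <= D &
  forall n : nat, `|apsi q s t n.+1 l m| <= D.
Proof.
pose a := - qel t (2 - l * 2); pose b := qel false (2 - l * 2); pose Z := q ^ (2 - m * 2).
have Z0 : 0 <= Z by rewrite ltW // qz_gt0.
have cM := gauss_summable q01 (psi_bound_ge0 q01 a b) Z0.
have h n k : `|psi_t q a (qel (s (+) t) (2 + (n.+1%:Z - l) * 2))
    (qel t (2 + (n.+1%:Z - m) * 2)) k| <= psi_bound q a b * (q ^+ (k * k.-1) * Z ^+ k).
  by apply: psi_t_le => //; rewrite ?norm_qel // qz_le; lia.
exists (limn (series (fun k => psi_bound q a b * (q ^+ (k * k.-1) * Z ^+ k)))).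
  exact: le_trans (normr_ge0 _) (norm_series_le cM (h 0)).
by move=> n; rewrite /apsi PsiE; apply: norm_series_le cM (h n).
Qed.

Lemma qinf_opp_cvg1 (s : bool) : (fun n : nat => qinf (- qel s (n.+1%:Z * 2))) @ \oo --> (1 : R).
Proof.
apply: qpoch_inf_cvg1 => //; rewrite -oppr0; apply: cvgN.
rewrite /qelt -[X in _ --> X](mulr0 ((-1) ^+ s)); apply: cvgMr.
have := qpow2_cvg0 q01 2; apply: cvg_trans; apply: near_eq_cvg; near=> n.
by congr (q ^ _); lia.
Unshelve. all: by end_near. Qed.

(** [Psi] stays bounded, while [nu^2] contributes a power of q whose exponent is quadratic in
    chi(x). *)
Lemma afun_cvg0 (s t : bool) (l m : int) : (t -> 0 < l) -> ((s (+) t)%B -> 0 < m) ->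
  (fun n : nat => afun q (qel (s (+) t) m) (qel s n.+1) (qel t l)) @ \oo --> (0 : R).
Proof.
move=> ht hm; apply: sqr_cvg0; have [D D0 hD] := apsi_bound s t l m.
pose K := c_q q ^+ 2 * q ^ (l * 2) * (qinf (- qel (s (+) t) (m * 2)) * qinf (- qel t (l * 2))) * D ^+ 2.
apply: (@cvg_of_norm_le _ _ (fun n : nat => K * q ^ (- (m + l) + n%:Z) / qinf (- qel s (n.+1%:Z * 2)))).
  move=> n; rewrite subr0 ger0_norm ?sqr_ge0 // afun_sqr //.
  have p0 := qinf_opp_gt0 q01 (_ : s -> 0 < n.+1%:Z); rewrite expfzDr //.
  set c := c_q q ^+ 2; set A := qinf _; set B := qinf _; set C := qinf _.
  have A0 : 0 <= A by exact: qinf_opp_ge0.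
  have B0 : 0 <= B by exact: qinf_opp_ge0.
  have C0 : 0 < C by exact: p0.
  (* A linear minorant of the quadratic exponent is enough: with d = n - (m + l) + 2 it reads d(d+1)
     >= d - 2. *)
  have h1 : q ^ ((m + l - n.+1%:Z - 1) * (m + l - n.+1%:Z - 2)) <= q ^ (- (m + l) + n%:Z).
    by rewrite qz_le; move: (m + l) => c'; have := sqr_ge0 (n%:Z - c' + 2); rewrite expr2; lia.
  have h2 : apsi q s t n.+1 l m ^+ 2 <= D ^+ 2.
    by rewrite -(real_normK (num_real (apsi q s t n.+1 l m))) lerXn2r ?nnegrE.
  have w0 : 0 <= c * q ^ (l * 2) * (A * B / C).
    apply: mulr_ge0; last by rewrite divr_ge0 ?mulr_ge0 // ltW.
    by apply: mulr_ge0; [exact: sqr_ge0|exact/ltW/qz_gt0].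
  rewrite [leRHS](_ : _ = (c * q ^ (l * 2) * (A * B / C)) * (q ^ (- (m + l) + n%:Z) * D ^+ 2)); last first.
    by rewrite /K -/c -/A -/B -/C; ring.
  rewrite [leLHS](_ : _ = (c * q ^ (l * 2) * (A * B / C)) *
    (q ^ ((m + l - n.+1%:Z - 1) * (m + l - n.+1%:Z - 2)) * apsi q s t n.+1 l m ^+ 2)); last by ring.
  by rewrite ler_wpM2l // ler_pM ?sqr_ge0 // ltW // qz_gt0.
rewrite -[X in _ --> X](_ : K * 0 / 1 = 0); last by rewrite mulr0 mul0r.
apply: cvgM; first by apply: cvgMr; exact: qpow_cvg0.
by apply: cvgV0; [exact: oner_neq0|exact: qinf_opp_cvg1].
Qed.

End Decay.

(** * Asymptotics of a_1(x,y) as y tends to 0, and separation of points *)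

Section SmallSecondVariable.
Variables (R : realType) (q : R).
Hypothesis q01 : 0 < q < 1.
Let q0 : 0 < q. Proof. by case/andP: q01. Qed.
Let q1 : q < 1. Proof. by case/andP: q01. Qed.
Let qn0 : q != 0. Proof. by rewrite gt_eqF. Qed.
Local Notation qinf := (qpoch_inf q).
Local Notation qq n := (qpoch q (q ^+ 2) n).
Local Notation qqinf := (qpoch_inf q (q ^+ 2)).
Local Notation qel := (qelt q).

(** Each factor 1 + 1/u equals 1/u times 1 + u, and the order of the factors is reversed. *)
Lemma qpoch_reverse (s : bool) (X : int) (n : nat) :
  qpoch q (- qel s (2 - (X + n%:Z) * 2)) n =
  (-1) ^+ (s * n) * q ^ (n%:Z * (1 - X * 2 - n%:Z)) * qpoch q (- qel s (X * 2)) n.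
Proof.
elim: n => [|n IH]; first by rewrite !qpoch0 muln0 expr0 mul0r expr0z !mulr1.
rewrite -[n.+1 in LHS]add1n qpoch_add qpochS qpoch0 mul1r muln0 expr0 mul1r opprK.
have -> : q ^+ (2 * 1) * - qel s (2 - (X + (1 + n)%N%:Z) * 2) = - qel s (2 - (X + n%:Z) * 2).
  by rewrite mulrN; congr (- _); rewrite muln1 qzn -[q ^ 2]qel0 qelM //; congr (qelt _ _ _); lia.
rewrite IH qpochS mulrN opprK.
have e : 1 + qel s (2 - (X + (1 + n)%N%:Z) * 2) =
    (-1) ^+ s * q ^ (- (X + n%:Z) * 2) * (1 + q ^+ (2 * n) * qel s (X * 2)).
  rewrite -[(-1) ^+ s * q ^ (- (X + n%:Z) * 2)]/(qel s (- (X + n%:Z) * 2)).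
  rewrite [RHS]mulrDr mulr1 qzn -[q ^ (2 * n)%N]qel0 qelM // qelM // addFb addbb.
  have -> : - (X + n%:Z) * 2 + ((2 * n)%N%:Z + X * 2) = 0 by lia.
  rewrite qel0 expr0z addrC; congr (qelt _ _ _ + _); lia.
rewrite e mulnS exprD.
have -> : q ^ (n.+1%:Z * (1 - X * 2 - n.+1%:Z)) =
    q ^ (- (X + n%:Z) * 2) * q ^ (n%:Z * (1 - X * 2 - n%:Z)).
  by rewrite -expfzDr //; congr (q ^ _); lia.
by ring.
Qed.

(** The parameter b is again q^(2-2n), so the series starts at index n. After normalization the k-th
    remaining term carries q^(2nk), hence only k = 0 survives in the limit. *)
Lemma apsi1_asym (s : bool) (X : int) : (s -> 0 < X) ->
  (fun n : nat => ((-1) ^+ n * q ^ (- (n%:Z * 2)) / qpoch q (- qel s (X * 2)) n) *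
     apsi q s s X (X + n%:Z) 0) @ \oo --> (1 : R).
Proof.
move=> hs; pose A0 := - qel s (2 - X * 2).
have p0 n : qpoch q (- qel s (X * 2)) n != 0.
  rewrite gt_eqF // qpoch_gt0 //; case: s hs {A0} => hs.
    by rewrite qel1 opprK -(expr0z q) qz_lt //; have := hs isT; lia.
  by rewrite qel0 (le_lt_trans _ ltr01) // oppr_le0 ltW // qz_gt0.
pose w (n k : nat) : R := qpoch q A0 k * (qqinf / qq k) / qq (n + k) *
   (-1) ^+ k * (-1) ^+ (s * k) * q ^+ (k * k.-1) * (q ^ (2 + X * 2 + n%:Z * 2)) ^+ k.
have wE n : ((-1) ^+ n * q ^ (- (n%:Z * 2)) / qpoch q (- qel s (X * 2)) n) *
     apsi q s s X (X + n%:Z) 0 = limn (series (w n)).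
  have bE : qel false (2 + (X - (X + n%:Z)) * 2) * q ^+ (2 * n) = q ^+ 2.
    by rewrite qel0 !qzn -expfzDr //; congr (q ^ _); lia.
  rewrite /apsi addbb; apply: (Psi_shift_scaled q01 bE) => k; rewrite /psi_t /w.
  have -> : qel false (2 + (X - (X + n%:Z)) * 2) * q ^+ (2 * (n + k)) = q ^+ 2 * q ^+ (2 * k).
    by rewrite qel0 !qzn -!expfzDr //; congr (q ^ _); lia.
  rewrite qinf_q2k // expn_pred // [q ^+ (k * k.-1)]expn_pred // qpoch_add qpoch_reverse.
  have -> : q ^+ (2 * n) * - qel s (2 - (X + n%:Z) * 2) = A0.
    rewrite /A0 mulrN; congr (- _); rewrite qzn -[q ^ (2 * n)%N]qel0 qelM //.
    by congr (qelt _ _ _); lia.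
  have -> : (qel s (2 + (X - 0) * 2)) ^+ (n + k) =
      (-1) ^+ (s * n) * (-1) ^+ (s * k) * q ^ ((2 + X * 2) * (n + k)%:Z).
    rewrite /qelt exprMn subr0 qzX; congr (_ * _).
    by rewrite -exprD -mulnDr exprM.
  have e : q ^ (- (n%:Z * 2)) * q ^ (n%:Z * (1 - X * 2 - n%:Z)) *
      q ^ ((n + k)%:Z * ((n + k)%:Z - 1)) * q ^ ((2 + X * 2) * (n + k)%:Z) =
      q ^ (k%:Z * (k%:Z - 1)) * (q ^ (2 + X * 2 + n%:Z * 2)) ^+ k.
    by rewrite qzX -!expfzDr //; congr (q ^ _); lia.
  rewrite -[RHS]mulrA -e exprD.
  have s2 (y : R) : ((-1) ^+ n) ^+ 2 * ((-1) ^+ (s * n)) ^+ 2 * y = y.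
    by rewrite !sqrr_sign !mul1r.
  rewrite -[RHS]s2; field.
  by rewrite p0 !gt_eqF // qqn_gt0.
under eq_fun do rewrite wE.
have vE : limn (series (fun k : nat => qpoch q A0 k * (qqinf / qq k) / qqinf *
   (-1) ^+ k * (-1) ^+ (s * k) * q ^+ (k * k.-1) * 0 ^+ k)) = 1.
  rewrite (@limn_series_finite _ _ 1%N) => [|[|k] // _]; last by rewrite expr0n mulr0.
  rewrite big_ord1 /= muln0 !expr0 !mulr1 !qpoch0 divr1 mul1r divff //.
  by rewrite gt_eqF // qq_inf_gt0.
rewrite -vE.
have c1 k : 0 <= qqinf / qq k by rewrite divr_ge0 // ltW ?qq_inf_gt0 ?qqn_gt0.
have c2 k : qqinf / qq k <= 1.
  by rewrite ler_pdivrMr ?qqn_gt0 // mul1r qpoch_inf_le // qq_01.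
pose Z := q ^ (2 + X * 2); have Z0 : 0 <= Z by rewrite ltW // qz_gt0.
have B0 : 0 <= expR (`|A0| * qgeom q) * qqinf^-1.
  by rewrite mulr_ge0 ?expR_ge0 ?invr_ge0 ?(ltW (qq_inf_gt0 q01)).
apply: (tannery (gauss_summable q01 B0 Z0)).
- move=> n k; rewrite /w; have := c1 k; have := c2 k; move: (qqinf / qq k) => r r1 r0.
  rewrite !normrM !normrX normrN1 !expr1n !mulr1 (ger0_norm (ltW q0)) (ger0_norm r0).
  rewrite (ger0_norm (ltW (qz_gt0 q01 _))) -mulrA ler_pM //.
  + by rewrite !mulr_ge0.
  + by rewrite mulr_ge0 ?exprn_ge0 ?(ltW q0) ?(ltW (qz_gt0 q01 _)).
  + rewrite normfV (ger0_norm (ltW (qqn_gt0 q01 _))) ler_pM ?qqn_inv_le ?invr_ge0 ?(ltW (qqn_gt0 q01 _)) //.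
      by rewrite mulr_ge0.
    by rewrite -[leRHS]mulr1 ler_pM // norm_qpoch_le.
  + rewrite ler_wpM2l ?exprn_ge0 ?(ltW q0) // lerXn2r ?nnegrE ?(ltW (qz_gt0 q01 _)) //.
    by rewrite /Z qz_le //; lia.
move=> k; rewrite /w; apply: cvgM.
  do 3! apply: cvgMl; apply: cvgMr; apply: cvgV0; first by rewrite gt_eqF // qq_inf_gt0.
  by apply: cvg_shift_cst; exact: qpoch_infE.
have zc : (fun n : nat => q ^ (2 + X * 2 + n%:Z * 2)) @ \oo --> (0 : R) by exact: qpow2_cvg0.
elim: k => [|k IH]; first by rewrite expr0; under eq_fun do rewrite expr0; exact: cvg_cst.
by rewrite exprS; under eq_fun do rewrite exprS; apply: cvgM.
Qed.

Definition afun1_lim (s : bool) (X : int) : R :=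
  c_q q ^+ 2 * qinf (- 1) * qinf (- qel s (X * 2)).

Lemma afun1_lim_gt0 (s : bool) (X : int) : (s -> 0 < X) -> 0 < afun1_lim s X.
Proof.
move=> hs; apply: mulr_gt0; last exact: qinf_opp_gt0.
apply: mulr_gt0; first by apply: exprn_gt0; exact: c_q_gt0.
by apply: lt_le_trans ltr01 _; apply: qpoch_inf_ge1 => //; rewrite lerN10.
Qed.

(** Gaussian decay with exponent n^2 + 3n + 2X + 2 and a positive constant. Counted from a fixed y,
    the exponent depends on X, which is what separates points. *)
Lemma afun1_asym (s : bool) (X : int) : (s -> 0 < X) ->
  (fun n : nat => afun q 1 (qel s X) (qel s (X + n%:Z)) ^+ 2 *
     q ^ (- (n%:Z * n%:Z + n%:Z * 3 + X * 2 + 2))) @ \oo --> afun1_lim s X.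
Proof.
move=> hs.
have p0 n : qpoch q (- qel s (X * 2)) n != 0.
  rewrite gt_eqF // qpoch_gt0 //; case: s hs => hs.
    by rewrite qel1 opprK -(expr0z q) qz_lt //; have := hs isT; lia.
  by rewrite qel0 (le_lt_trans _ ltr01) // oppr_le0 ltW // qz_gt0.
have i0 : qinf (- qel s (X * 2)) != 0 by rewrite gt_eqF // qinf_opp_gt0.
rewrite (_ : (fun n : nat => _) = (fun n : nat => c_q q ^+ 2 * qinf (- 1) /
   qinf (- qel s (X * 2)) * qinf (- qel s ((X + n%:Z) * 2)) *
   qpoch q (- qel s (X * 2)) n ^+ 2 *
   (((-1) ^+ n * q ^ (- (n%:Z * 2)) / qpoch q (- qel s (X * 2)) n) *
     apsi q s s X (X + n%:Z) 0) ^+ 2)); last first.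
  apply/funext => n; have h : s -> 0 < X + n%:Z by move/hs; lia.
  have := @afun_sqr _ _ q01 s X s (X + n%:Z) 0 hs h; rewrite addbb qel0 ?mul0r ?qel0 expr0z.
  move=> -> //.
  have e : q ^ ((X + n%:Z) * 2 + (0 + (X + n%:Z) - X - 1) * (0 + (X + n%:Z) - X - 2)) *
      q ^ (- (n%:Z * n%:Z + n%:Z * 3 + X * 2 + 2)) = (q ^ (- (n%:Z * 2))) ^+ 2.
    by rewrite qzX -!expfzDr //; congr (q ^ _); lia.
  have s2 (y : R) : ((-1) ^+ n) ^+ 2 * y = y by rewrite sqrr_sign mul1r.
  set N := q ^ ((X + n%:Z) * 2 + _) in e *; set N' := q ^ (- (_ + 2)) in e *.
  transitivity (c_q q ^+ 2 * (N * N') * (qinf (-1) * qinf (- qel s ((X + n%:Z) * 2)) /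
    qinf (- qel s (X * 2))) * apsi q s s X (X + n%:Z) 0 ^+ 2); first by ring.
  rewrite e -[LHS]s2; field.
  by rewrite i0 p0.
have -> : afun1_lim s X = c_q q ^+ 2 * qinf (- 1) / qinf (- qel s (X * 2)) * 1 *
    qinf (- qel s (X * 2)) ^+ 2 * 1 ^+ 2.
  by rewrite /afun1_lim; field.
have c : (fun n : nat => qinf (- qel s ((X + n%:Z) * 2))) @ \oo --> (1 : R).
  apply: qpoch_inf_cvg1 => //; rewrite -oppr0; apply: cvgN.
  rewrite /qelt -[X in _ --> X](mulr0 ((-1) ^+ s)); apply: cvgMr.
  have := qpow2_cvg0 q01 (X * 2); apply: cvg_trans; apply: near_eq_cvg; near=> n.
  by congr (q ^ _); lia.
have u := apsi1_asym hs.
have v : qpoch q (- qel s (X * 2)) @ \oo --> qinf (- qel s (X * 2)) by exact: qpoch_infE.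
apply: cvgM; last by rewrite expr2; under eq_fun do rewrite expr2; apply: cvgM; exact: u.
apply: cvgM; last by rewrite expr2; under eq_fun do rewrite expr2; apply: cvgM; exact: v.
by apply: cvgMr.
Unshelve. all: by end_near. Qed.

Lemma afun1_neq0 (s : bool) (X : int) : (s -> 0 < X) ->
  exists N : int, forall Y, N <= Y -> afun q 1 (qel s X) (qel s Y) != 0.
Proof.
move=> hs; have : \forall n \near \oo, 0 < afun q 1 (qel s X) (qel s (X + n%:Z)) ^+ 2 *
     q ^ (- (n%:Z * n%:Z + n%:Z * 3 + X * 2 + 2)).
  by move: (afun1_asym hs) => /cvgr_gt; apply; exact: afun1_lim_gt0.
move=> [n0 _ h]; exists (X + n0%:Z) => Y hY.
have e : Y = X + (absz (Y - X)) by lia.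
have /= := h (absz (Y - X)); rewrite -e => h'.
apply: contraTneq (h' _) => [->|]; last by rewrite /=; lia.
by rewrite expr0n /= mul0r ltxx.
Qed.

(** If the squares agreed for all small y, two rates would have to coincide. The exponent counted
    from X at n + d exceeds the one counted from X + d at n by 2dn + d^2 + d, so the positive limit
    attached to X + d would be 0. *)
Lemma afun1_sep_lt (s : bool) (X : int) (d : nat) (N : int) : (s -> 0 < X) -> (0 < d)%N ->
  exists2 Y, N <= Y & afun q 1 (qel s X) (qel s Y) ^+ 2 !=
    afun q 1 (qel s (X + d%:Z)) (qel s Y) ^+ 2.
Proof.
move=> hs d0; apply: contrapT => h.
have hs' : s -> 0 < X + d%:Z by move/hs; lia.
have eqY Y : N <= Y -> afun q 1 (qel s X) (qel s Y) ^+ 2 =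
    afun q 1 (qel s (X + d%:Z)) (qel s Y) ^+ 2.
  by move=> NY; apply: contrapT => /eqP ne; apply: h; exists Y.
pose G n := afun q 1 (qel s X) (qel s (X + n%:Z)) ^+ 2 *
     q ^ (- (n%:Z * n%:Z + n%:Z * 3 + X * 2 + 2)).
have cG : (fun n => G (n + d)%N * q ^ (0 + n%:Z)) @ \oo --> (0 : R).
  rewrite -(mulr0 (afun1_lim s X)); apply: cvgM; last exact: qpow_cvg0.
  by apply: cvg_shift_cst; exact: afun1_asym.
have c' := afun1_asym hs'.
have l0 := afun1_lim_gt0 hs'.
suff : (fun n => afun q 1 (qel s (X + d%:Z)) (qel s (X + d%:Z + n%:Z)) ^+ 2 *
     q ^ (- (n%:Z * n%:Z + n%:Z * 3 + (X + d%:Z) * 2 + 2))) @ \oo --> (0 : R).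
  move=> c0; have := cvg_lim (@Rhausdorff R) c'; rewrite (cvg_lim (@Rhausdorff R) c0) => e.
  by rewrite -e ltxx in l0.
apply/cvgrPdist_le => e e0; move/cvgrPdist_le: cG => /(_ e e0)[n1 _ hn].
exists (n1 + absz (N - X))%N => // n /= hn1; have := hn n (leq_trans (leq_addr _ _) hn1).
rewrite !sub0r !normrN; apply: le_trans.
have p0 (k : int) : 0 <= q ^ k by exact/ltW/qz_gt0.
rewrite [leLHS]ger0_norm; last by apply: mulr_ge0; [exact: sqr_ge0|exact: p0].
rewrite [leRHS]ger0_norm; last first.
  by apply: mulr_ge0 => //; apply: mulr_ge0; [exact: sqr_ge0|exact: p0].
rewrite -eqY; last by lia.
rewrite /G; have -> : X + (n + d)%N%:Z = X + d%:Z + n%:Z by lia.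
rewrite -mulrA ler_wpM2l ?sqr_ge0 // -expfzDr // leNgt qz_lt // -leNgt.
have : (0 < d%:Z * n%:Z * 2 + d%:Z * d%:Z - n%:Z + d%:Z) by nia.
rewrite PoszD; nia.
Qed.

Lemma afun1_sep (s : bool) (X X' : int) (N : int) : (s -> 0 < X) -> (s -> 0 < X') -> X != X' ->
  exists2 Y, N <= Y & afun q 1 (qel s X) (qel s Y) ^+ 2 != afun q 1 (qel s X') (qel s Y) ^+ 2.
Proof.
move=> h h' XX'; have [lt|gt|e] := ltgtP X X'; last by rewrite e eqxx in XX'.
- have e : X' = X + (absz (X' - X)) by lia.
  by rewrite e; apply: afun1_sep_lt => //; lia.
- have e : X = X' + (absz (X - X')) by lia.
  have [Y NY hY] := @afun1_sep_lt s X' (absz (X - X')) N h' ltac:(lia).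
  by exists Y => //; rewrite eq_sym e.
Qed.

Lemma afun_near0 p y (e : R) : Iq_set q p -> Iq_set q y -> 0 < e ->
  exists2 r, 0 < r & forall x, Iq_set q x -> `|x| < r -> `|afun q p x y| < e.
Proof.
move=> /(Iq_setP q01)[sp [m [-> hm]]] /(Iq_setP q01)[t [l [-> hl]]] e0.
have h (s : bool) : exists N : nat, forall n : nat, (N <= n)%N ->
    `|afun q (qel sp m) (qel s n.+1) (qel t l)| < e.
  have [st|st] := eqVneq (s (+) t) sp; last first.
    exists 0 => n _; rewrite afun_out ?normr0 // qelM // !sg_qel //.
    by apply/eqP => /signr_inj h; rewrite h eqxx in st.
  rewrite -st; have c := @afun_cvg0 _ _ q01 s t l m hl.
  have /c/cvgrPdist_lt/(_ e e0)[N _ hN] : (s (+) t)%B -> 0 < m by rewrite st.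
  by exists N => n Nn; have := hN n Nn; rewrite sub0r normrN.
have [N0 h0] := h false; have [N1 h1] := h true.
exists (q ^ ((N0 + N1)%N%:Z)); first exact: qz_gt0.
move=> x /(Iq_setP q01)[s [k [-> hk]]]; rewrite norm_qel // qz_lt // => hN.
have -> : k = (absz (k - 1)).+1 by lia.
by case: s hk => hk; [apply: h1|apply: h0]; lia.
Qed.

Lemma afun_diag_oo t (e : R) : Iq_set q t -> 0 < e ->
  exists r, forall x, Iq_set q x -> r < `|x| -> `|afun q t x t - 1| < e.
Proof.
move=> /(Iq_setP q01)[s [T [-> hT]]] e0.
have c : (fun n : nat => afun q (qel s T) (q ^ (T - n%:Z)) (qel s T)) @ \oo --> (1 : R).
  case: s hT => hT; last by rewrite qel0; exact: afun_diag_pos.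
  have T0 := hT isT; have -> : T = (absz T).-1.+1%:Z by lia.
  by rewrite qel1; exact: afun_diag_neg.
move/cvgrPdist_lt: c => /(_ e e0)[N _ hN].
(* The minimum with 0 forces |x| > 1, which in I_q happens only for positive x. *)
exists (q ^ (Order.min (T - N%:Z) 0)) => x /(Iq_setP q01)[s' [k [-> hk]]].
rewrite norm_qel // qz_lt // lt_min => /andP[k1 k2].
have -> : s' = false by case: s' hk => // /(_ isT); lia.
rewrite qel0 distrC; have -> : k = T - (absz (T - k))%:Z by lia.
by apply: hN => /=; lia.
Qed.

End SmallSecondVariable.

(** * Characters of the circle *)

Section Characters.
Variable R : realType.
Local Notation T := (circle R).

Lemma norm_circle (l : T) : `|val l| = 1 :> R[i].
Proof. by have /set_mem := valP l. Qed.

Lemma cabs_circle (l : T) : cabs (val l) = 1.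
Proof. by apply: (@complexI R); rewrite -cabsE norm_circle. Qed.

Lemma circle_neq0 (l : T) : val l != 0 :> R[i].
Proof. by rewrite -normr_eq0 norm_circle oner_neq0. Qed.

Lemma circle_inv (l : T) : (val l)^-1 = conjc (val l) :> R[i].
Proof. by rewrite invc_norm norm_circle expr1n invr1 mul1r. Qed.

Lemma circle_nbhsP (l : T) (A : set T) : nbhs l A <->
  exists2 d : R, 0 < d & forall m : T, cabs (val m - val l) < d -> A m.
Proof.
split=> [|[d d0 h]].
  rewrite nbhsE => -[U [[V oV <-] Vl] sub].
  have /nbhs_ballP[e /= e0 he] : nbhs (val l : R[i]^o) V by exact: open_nbhs_nbhs.
  exists (complex.Re e); first by move: e0; rewrite ltcE /= => /andP[].
  move=> m hm; apply: sub; apply: he; rewrite /ball /= /ball_ distrC cabsE.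
  have -> : e = ((complex.Re e)%:C)%C by rewrite RRe_real // gtr0_real.
  by rewrite ltcR.
pose V : set R[i]^o := ball (val l : R[i]^o) ((d%:C)%C : R[i]).
have oV : open V by apply: ball_open; rewrite ltcR.
rewrite nbhsE; exists ((fun m : T => (val m : R[i]^o)) @^-1` V).
  split; first by exists V.
  by rewrite /V /preimage /=; apply: ballxx; rewrite ltcR.
by move=> m; rewrite /V /ball /= /ball_ distrC cabsE ltcR; exact: h.
Qed.

Lemma cvg_cplxP (X : topologicalType) (f : X -> R[i]^o) (x : X) :
  {for x, continuous f} <->
  forall e : R, 0 < e -> \forall y \near x, cabs (f y - f x) < e.
Proof.
split=> [h e e0|h].
  have e0' : 0 < (e%:C)%C :> R[i] by rewrite ltcR.
  move/cvgrPdist_lt: h => /(_ _ e0'); apply: filterS => y.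
  by rewrite cabsE ltcR cabsB.
apply/cvgrPdist_lt => e e0; have eE : e = ((complex.Re e)%:C)%C.
  by rewrite RRe_real // gtr0_real.
have : 0 < complex.Re e by rewrite -ltcR -eE.
by move/h; apply: filterS => y; rewrite eE cabsE ltcR cabsB.
Qed.

Lemma Re_sub (z w : R[i]) : Re (z - w) = Re z - Re w.
Proof. by case: z w => ? ? []. Qed.
Lemma Im_sub (z w : R[i]) : Im (z - w) = Im z - Im w.
Proof. by case: z w => ? ? []. Qed.

Lemma continuous_ReIm (X : topologicalType) (f : X -> R[i]^o) : continuous f ->
  continuous (fun x => Re (f x)) /\ continuous (fun x => Im (f x)).
Proof.
move=> cf; split=> x; apply/cvgrPdist_lt => e e0.
  have := (cvg_cplxP f x).1 (cf x) e e0; apply: filterS => y.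
  by apply: le_lt_trans; rewrite distrC -Re_sub; exact: Re_le_cabs.
have := (cvg_cplxP f x).1 (cf x) e e0; apply: filterS => y.
by apply: le_lt_trans; rewrite distrC -Im_sub; exact: Im_le_cabs.
Qed.

Lemma continuous_measurable_circle (g : T -> R) : continuous g -> measurable_fun setT g.
Proof.
move=> cg; apply: (measurability _ (RGenOInfty.measurableE R)) => _ [_ [x ->] <-].
rewrite setTI; apply: sub_sigma_algebra.
by apply: open_comp => [? _|]; [exact: cg|exact: interval_open].
Qed.

Lemma continuous_cmeasurable (f : T -> R[i]^o) : continuous f -> cmeasurable f.
Proof.
by move=> /continuous_ReIm[? ?]; split; exact: continuous_measurable_circle.
Qed.

Lemma cabs_char (k : int) (l : T) : cabs ((val l) ^ k) = 1.
Proof.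
have cn (n : nat) : cabs ((val l) ^+ n) = 1.
  elim: n => [|n IH]; first by rewrite expr0 cabs1.
  by rewrite exprS cabsM IH cabs_circle mulr1.
case: k => n; first exact: cn.
have : cabs ((val l) ^+ n.+1 * ((val l) ^+ n.+1)^-1) = 1.
  by rewrite mulfV ?cabs1 // expf_neq0 // circle_neq0.
by rewrite cabsM cn mul1r.
Qed.

Lemma conj_char (k : int) (l : T) : conjc ((val l) ^ k) = (val l) ^ (- k).
Proof.
have : (val l) ^ k * conjc ((val l) ^ k) = (val l) ^ k * (val l) ^ (- k).
  rewrite -abs2E -sqr_cabs cabs_char expr1n -expfzDr ?circle_neq0 //.
  by rewrite subrr expr0z.
by apply: mulfI; rewrite expfz_neq0 // circle_neq0.
Qed.

Lemma continuous_char (k : int) : continuous (fun l : T => (val l) ^ k : R[i]^o).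
Proof.
have cn (n : nat) (l m : T) : cabs ((val m) ^+ n - (val l) ^+ n) <= n%:R * cabs (val m - val l).
  elim: n => [|n IH]; first by rewrite !expr0 subrr cabs0 mul0r.
  have -> : (val m : R[i]) ^+ n.+1 - (val l : R[i]) ^+ n.+1 =
      val m * (val m ^+ n - val l ^+ n) + (val m - val l) * val l ^+ n.
    by rewrite !(exprS _ n); ring.
  apply: le_trans (cabsD _ _) _; rewrite !cabsM cabs_circle mul1r.
  rewrite (cabs_char n l) mulr1 -natr1 mulrDl mul1r.
  by rewrite lerD2r.
have cz (l m : T) : cabs ((val m) ^ k - (val l) ^ k) <= `|k|%:R * cabs (val m - val l).
  case: k => n; first exact: cn.
  rewrite -cabsJ conjcB !conj_char.
  by rewrite NegzE opprK; exact: cn.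
move=> l; apply/cvg_cplxP => e e0; apply/circle_nbhsP.
exists (e / (`|k|%:R + 1)); first by rewrite divr_gt0 // ltr_wpDl.
move=> m; rewrite ltr_pdivlMr ?ltr_wpDl // => h.
apply: le_lt_trans (cz l m) _; apply: le_lt_trans h.
by rewrite mulrC ler_wpM2l ?cabs_ge0 // lerDl.
Qed.

Lemma bounded_sqint (f : T -> R[i]) (M : R) : cmeasurable f ->
  (forall l, cabs (f l) <= M) -> f \in sqint (haar R).
Proof.
move=> mf hM; apply/sqintP; split=> //.
apply: (@le_lt_trans _ _ (\int[haar R]_x cst (M ^+ 2)%:E x)%E).
  apply: ge0_le_integral => //; first by move=> x _; rewrite lee_fin abs2_ge0.
    exact: measurable_abs2.
  move=> x _; rewrite lee_fin -sqr_cabs lerXn2r ?nnegrE ?cabs_ge0 //.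
  exact: le_trans (cabs_ge0 _) (hM x).
rewrite integral_cst // [X in (_ * X)%E](_ : _ = 1%E) ?mule1 ?ltry //.
exact: (probability_setT (haar R)).
Qed.

Lemma norm2_bounded (f : T -> R[i]) (M : R) : 0 <= M -> cmeasurable f ->
  (forall l, cabs (f l) <= M) -> norm2 (L2class (haar R) f) <= M.
Proof.
move=> M0 mf hM; rewrite -ler_sqr ?nnegrE ?norm2_ge0 // -lee_fin norm2_class; last first.
  exact: bounded_sqint hM.
apply: (@le_trans _ _ (\int[haar R]_x cst (M ^+ 2)%:E x)%E).
  apply: ge0_le_integral => //; first by move=> x _; rewrite lee_fin abs2_ge0.
    exact: measurable_abs2.
  by move=> x _; rewrite lee_fin -sqr_cabs lerXn2r ?nnegrE ?cabs_ge0.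
rewrite integral_cst // [X in (_ * X)%E](_ : _ = 1%E) ?mule1 //.
exact: (probability_setT (haar R)).
Qed.

Lemma char_sqint (k : int) : (fun l : T => (val l) ^ k : R[i]) \in sqint (haar R).
Proof.
apply: (@bounded_sqint _ 1); first by apply: continuous_cmeasurable; exact: continuous_char.
by move=> l; rewrite cabs_char.
Qed.

Lemma bounded_integrable (g : T -> R) (M : R) : measurable_fun setT g ->
  (forall l, `|g l| <= M) -> (haar R).-integrable setT (EFin \o g).
Proof.
move=> mg hM; apply: (@le_integrable _ _ _ (haar R) setT measurableT _ (cst M%:E)).
- exact/measurable_EFinP.
- move=> l _ /=; rewrite lee_fin; apply: le_trans (hM l) _; exact: ler_norm.
- by apply: finite_measure_integrable_cst.
Qed.

(** Haar measure is the image of the uniform law on [0, 1] under t |-> exp(2 i pi t), so a primitive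
    of the lifted function computes the integral. *)
Lemma haar_FTC (g : T -> R) (G : R -> R) (M : R) : continuous g ->
  (forall l, `|g l| <= M) ->
  (forall t : R, is_derive t 1 G (g (@circle_exp R t))) ->
  (\int[haar R]_l g l = G 1 - G 0)%R.
Proof.
move=> cg hM dG.
have mg := continuous_measurable_circle cg.
(* The change of variables is applied to a nonnegative integrand: [M] is added first and removed at
   the end, the total mass being 1. *)
pose g' := fun l => g l + M.
have mg' : measurable_fun setT g' by apply: measurable_funD => //.
have g'0 l : 0 <= g' l.
  by have := hM l; rewrite ler_norml /g' => /andP[]; lra.
have i1 : (\int[haar R]_l (g' l)%:E = (\int[haar R]_l g l)%:E + M%:E)%E.
  rewrite /g'; under eq_integral do rewrite EFinD.
  rewrite integralD //; last first.
  - by apply: finite_measure_integrable_cst.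
  - exact: bounded_integrable mg hM.
  rewrite integral_cst // [X in (_ + _ * X)%E](_ : _ = 1%E) ?mule1; last exact: (probability_setT (haar R)).
  congr (_ + _)%E; rewrite /Rintegral fineK //.
  exact: integral_fune_fin_num (bounded_integrable mg hM).
have ce : continuous (fun t : R => @circle_exp R t : T).
  move=> t; rewrite /continuous_at.
  move=> A /circle_nbhsP[d d0 h].
  have := (cvg_cplxP _ _).1 (@continuous_circle_exp_val R t) d d0.
  by apply: filterS => s hs; apply: h.
have i2 : (\int[haar R]_l (g' l)%:E = \int[lebesgue_measure]_(t in `[0%R, 1%R]) (g' (@circle_exp R t))%:E)%E.
  rewrite /haar ge0_integral_distribution; last 2 first.
  - exact/measurable_EFinP.
  - by move=> y; rewrite lee_fin.
  rewrite integral_uniform; last 2 first.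
  - apply/measurable_EFinP; apply: measurableT_comp => //; exact: measurable_circle_exp.
  - by move=> x /=; rewrite lee_fin.
  by rewrite subr0 invr1 mul1e.
have dG' (t : R) : is_derive t (1 : R) (fun t => G t + M * t) (g' (@circle_exp R t)).
  have := dG t => dGt; apply: is_derive_eq.
  by rewrite /g' /GRing.scale /= mulr1.
have := @continuous_FTC2 R (fun t => g' (@circle_exp R t)) (fun t => G t + M * t) 0 1 ltr01.
rewrite -i2 i1 => H.
have : ((\int[haar R]_l g l)%:E + M%:E = (G 1 + M * 1)%:E - (G 0 + M * 0)%:E)%E.
  apply: H.
  - apply: continuous_subspaceT => t; rewrite /g'.
    apply: cvgD; last exact: cvg_cst.
    apply: continuous_comp; [exact: ce|exact: cg].
  - have cc t : {for t, continuous (fun t => G t + M * t)}.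
      apply: differentiable_continuous; apply/derivable1_diffP.
      by have := dG' t => -[].
    split.
    + by move=> t _; have := dG' t => -[].
    + by apply: cvg_at_right_filter; exact: cc.
    + by apply: cvg_at_left_filter; exact: cc.
  - move=> t _; rewrite derive1E; exact: derive_val.
rewrite -!EFinD => -[]; rewrite mulr1 mulr0 addr0; lra.
Qed.

End Characters.

(** * Uniform approximation by Laurent polynomials *)

Section Laurent.
Variable R : realType.
Local Notation T := (circle R).

Lemma circle_expX (t : R) (k : int) : (val (@circle_exp R t) : R[i]) ^ k =
  Complex (cos (2 * pi * k%:~R * t)) (sin (2 * pi * k%:~R * t)).
Proof.
have hn (n : nat) : (val (@circle_exp R t) : R[i]) ^+ n =
    Complex (cos (2 * pi * n%:R * t)) (sin (2 * pi * n%:R * t)).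
  elim: n => [|n IH]; first by rewrite expr0 mulr0 mul0r cos0 sin0.
  have -> : 2 * pi * n.+1%:R * t = 2 * pi * n%:R * t + 2 * pi * t.
    by rewrite -[n.+1%:R]natr1; ring.
  rewrite exprS IH cosD sinD.
  by apply: eq_cplx => /=; ring.
case: k => n; first exact: hn.
rewrite NegzE -conj_char -exprnP hn mulrNz mulrN mulNr cosN sinN.
exact: eq_cplx.
Qed.

(** The parameter is acos(Re l) / (2 pi), with the sign of Im l. Covering the circle by a segment
    yields its compactness. *)
Lemma circle_exp_surj (l : T) : exists2 t : R, t \in `[(-1 : R), 1] & @circle_exp R t = l.
Proof.
have := cabs_circle l; rewrite /cabs => h.
have {h} : abs2 (val l) = 1.
  by rewrite -sqr_cabs cabs_circle expr1n.
have [a ha] : exists a, a = Re (val l) by eexists.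
have [b hb] : exists b, b = Im (val l) by eexists.
rewrite /abs2 -ha -hb => hab.
have a1 : -1 <= a <= 1 by apply/andP; split; nra.
have p0 := pi_gt0 R.
have ac0 := acos_ge0 a1; have acp := acos_lepi a1.
have sa : sin (acos a) = `|b|.
  by rewrite sin_acos // -sqrtr_sqr; congr Num.sqrt; lra.
pose s : R := acos a / (2 * pi).
have hs : 2 * pi * s = acos a by rewrite /s mulrC divfK // gt_eqF // mulr_gt0.
have s0 : 0 <= s <= 1.
  have pp : 0 < 2 * pi :> R by apply: mulr_gt0.
  by rewrite divr_ge0 //= ?(ltW pp) // ler_pdivrMr // mul1r; lra.
have [b0|b0] := leP 0 b.
  exists s; first by rewrite in_itv /=; lra.
  apply: val_inj; apply: eq_cplx; rewrite /= hs; first by rewrite acosK.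
  by rewrite sa ger0_norm.
exists (- s); first by rewrite in_itv /=; lra.
apply: val_inj; apply: eq_cplx; rewrite /= mulrN hs; first by rewrite cosN acosK.
by rewrite sinN sa ltr0_norm // opprK.
Qed.

Lemma continuous_circle_exp : continuous (fun t : R => @circle_exp R t : T).
Proof.
move=> t A /circle_nbhsP[d d0 h].
have := (cvg_cplxP _ _).1 (@continuous_circle_exp_val R t) d d0.
by apply: filterS => s hs; apply: h.
Qed.

Lemma circle_compact : compact [set: T].
Proof.
have -> : [set: T] = (fun t : R => @circle_exp R t : T) @` `[(-1 : R), 1].
  apply/seteqP; split=> // l _; have [t ht <-] := circle_exp_surj l.
  by exists t.
apply: continuous_compact; last exact: segment_compact.
by apply: continuous_subspaceT; exact: continuous_circle_exp.
Qed.

Lemma circle_bounded (f : T -> R[i]^o) : continuous f ->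
  exists2 M : R, 0 <= M & forall l, cabs (f l) <= M.
Proof.
move=> cf.
have := (compact_near_coveringP [set: T]).1 circle_compact _ (pinfty_nbhs R)
  (fun M l => cabs (f l) <= M) _.
case.
  move=> l _; have := (cvg_cplxP f l).1 (cf l) 1 ltr01 => hl.
  exists ([set m | cabs (f m - f l) < 1], [set M | cabs (f l) + 1 < M]).
    by split=> //; apply: nbhs_pinfty_gt; rewrite num_real.
  move=> [m M] [/= h1 h2]; apply: le_trans _ (ltW h2).
  rewrite -[f m](subrK (f l)) addrC; apply: le_trans (cabsD _ _) _.
  by rewrite lerD2l ltW.
move=> M [_ hM]; exists (Num.max (M + 1) 0); first by rewrite le_max lexx orbT.
by move=> l; rewrite le_max; apply/orP; left; apply: hM; rewrite // ltrDl.
Qed.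

Lemma circle_unif (f : T -> R[i]^o) (e : R) : continuous f -> 0 < e ->
  exists2 d : R, 0 < d &
    forall l m : T, cabs (val m - val l) < d -> cabs (f m - f l) < e.
Proof.
move=> cf e0; have e20 : 0 < e / 2 by lra.
have := (compact_near_coveringP [set: T]).1 circle_compact _ (at_right (0 : R))
  (fun d l => forall m : T, cabs (val m - val l) < d -> cabs (f m - f l) < e) _.
have cB (a b c : R[i]) : cabs (a - c) <= cabs (a - b) + cabs (b - c).
  by apply: le_trans (cabsD _ _); rewrite addrA subrK.
move=> /(_ _) h.
have {h} : \forall d \near at_right (0 : R), [set: T] `<=`
    (fun l => forall m : T, cabs (val m - val l) < d -> cabs (f m - f l) < e).
  apply: h => l _.
  have /circle_nbhsP[d d0 hd] := (cvg_cplxP f l).1 (cf l) _ e20.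
  exists ([set m : T | cabs (val m - val l) < d / 2], [set x : R | x < d / 2]).
    split; first by apply/circle_nbhsP; exists (d / 2); rewrite ?divr_gt0.
    by apply: nbhs_right_lt; rewrite divr_gt0.
  move=> [m x] [/= h1 h2] m' h3.
  apply: le_lt_trans (cB _ (f l) _) _.
  rewrite [ltRHS](splitr e) ltrD //; last by rewrite cabsB; apply: hd; lra.
  apply: hd; apply: le_lt_trans (cB _ (val m) _) _; lra.
move=> h; have : \forall d \near at_right (0 : R), 0 < d /\ ([set: T] `<=`
    (fun l => forall m : T, cabs (val m - val l) < d -> cabs (f m - f l) < e)).
  near=> d; split; first by near: d; exact: nbhs_right_gt.
  by near: d.
case/filter_ex => d [d0 hd]; exists d => // l m; exact: hd.
Unshelve. all: by end_near. Qed.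


Lemma circle_exp_pow (t : R) (k : int) :
  (val (@circle_exp R t) : R[i]) ^ k = val (@circle_exp R (k%:~R * t)).
Proof. by rewrite circle_expX; apply: eq_cplx; rewrite /= !mulrA. Qed.

Lemma circle_exp1 : val (@circle_exp R 1) = 1 :> R[i].
Proof. by apply: eq_cplx; rewrite /= mulr1 mulr_natl ?cos2pi ?sin2pi. Qed.

Lemma circle_exp_neq1 (t : R) : 0 < `|t| < 1 -> val (@circle_exp R t) != 1 :> R[i].
Proof.
move=> /andP[t0 t1]; apply/eqP => /(congr1 (fun z : R[i] => Re z)) /=.
have -> : cos (2 * pi * t) = cos (2 * pi * `|t|).
  by case: (ger0P t) => _ //; rewrite mulrN cosN.
have -> : 2 * pi * `|t| = pi * `|t| + pi * `|t| by ring.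
rewrite cosD.
have p0 := pi_gt0 R.
have : 0 < sin (pi * `|t|).
  by apply: sin_gt0_pi; rewrite mulr_gt0 //= gtr_pMr.
have := cos2Dsin2 (pi * `|t|); nra.
Qed.

(* The kernel ((1 + Re w) / 2)^n = 4^-n w^-n (1 + w)^(2n) on |w| = 1, as a Laurent
   polynomial. *)
Definition kern (n : nat) (w : R[i]) : R[i] :=
  4^-1 ^+ n * \sum_(i < (2 * n).+1) 'C(2 * n, i)%:R * w ^ (i%:Z - n%:Z).

Definition kern_re (n : nat) (w : R[i]) : R := ((1 + Re w) / 2) ^+ n.

Lemma kernE n w : abs2 w = 1 -> kern n w = ((kern_re n w)%:C)%C.
Proof.
move=> w1; have w0 : w != 0.
  by apply: contra_eq_neq w1 => ->; rewrite /abs2 /= expr0n addr0 eq_sym oner_neq0.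
have wV : w^-1 = conjc w.
  by apply: (mulfI w0); rewrite mulfV // -abs2E w1.
rewrite /kern /kern_re.
have -> : \sum_(i < (2 * n).+1) 'C(2 * n, i)%:R * w ^ (i%:Z - n%:Z) =
    w^-1 ^+ n * (1 + w) ^+ (2 * n).
  rewrite exprDn mulr_sumr; apply: eq_bigr => i _.
  rewrite expr1n mul1r expfzDr // -exprnP -mulr_natl exprVn.
  by rewrite -exprnN; ring.
rewrite exprM -!exprMn rmorphXn /=; congr (_ ^+ n).
have -> : w^-1 * (1 + w) ^+ 2 = w^-1 + 2 + w by field.
rewrite wV; have : (2 : R[i]) != 0 by rewrite pnatr_eq0.
move=> t0; apply: (mulfI (_ : (4 : R[i]) != 0)); first by rewrite pnatr_eq0.
rewrite mulrA mulfV ?pnatr_eq0 // mul1r rmorphM rmorphD /= fmorphV /=.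
have -> : 4 * ((1 + (Re w)%:C) * (2%:C)^-1)%C = 2 * (1 + ((Re w)%:C)%C) :> R[i].
  have -> : (2%:C)%C = 2 :> R[i] by exact: rmorph_nat.
  by field.
have -> : 2 * (1 + ((Re w)%:C)%C) = 2 + (w + conjc w) :> R[i].
  by rewrite [w + _]addcJ; ring.
by ring.
Qed.


Lemma kern_re_ge0 n w : cabs w = 1 -> 0 <= kern_re n w.
Proof.
move=> w1; apply: exprn_ge0; have := Re_le_cabs w.
by rewrite w1 ler_norml => /andP[]; lra.
Qed.

(** Equally spaced points, more numerous than the exponents of [kern n] in absolute value, so that a
    sum over the nodes integrates the kernel exactly. *)
Definition node (n : nat) (j : 'I_(2 * n).+1) : T := @circle_exp R (j%:R / (2 * n).+1%:R).

(** A full geometric sum of powers of exp(2 i pi k / (2n+1)), a root of unity that differs from 1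
    for k <> 0 because |k| < 2n+1. *)
Lemma sum_node (n : nat) (k : int) : (`|k| <= n)%N ->
  \sum_j (val (@node n j) : R[i]) ^ k = (if k == 0 then (2 * n).+1%:R else 0).
Proof.
move=> kn; set N := (2 * n).+1; have N0 : 0 < N%:R :> R by rewrite ltr0n.
pose z : R[i] := val (@circle_exp R (k%:~R / N%:R)).
have zj (j : 'I_N) : (val (@node n j) : R[i]) ^ k = z ^+ j.
  rewrite (exprnP z j) !circle_exp_pow.
  suff -> : k%:~R * (j%:R / N%:R) = (j : nat)%:~R * (k%:~R / N%:R) :> R by [].
  by rewrite mulrCA.
under eq_bigr do rewrite zj.
have [k0|k0] := eqVneq k 0.
  rewrite (_ : z = 1); last by rewrite /z k0 mul0r; apply: eq_cplx; rewrite /= mulr0 ?cos0 ?sin0.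
  by under eq_bigr do rewrite expr1n; rewrite sumr_const card_ord.
have zN : z ^+ N = 1.
  rewrite [z ^+ N](exprnP z N) circle_exp_pow mulrC divfK ?lt0r_neq0 //.
  by rewrite -[k%:~R]mulr1 -circle_exp_pow circle_exp1 exp1rz.
have z1 : z != 1.
  apply: circle_exp_neq1; rewrite normrM normfV (gtr0_norm N0) -intr_norm.
  rewrite divr_gt0 //= ?ltr0z ?normr_gt0 // ltr_pdivrMr // mul1r.
  by rewrite -[N%:R]/(N%:~R) ltr_int; lia.
apply/eqP; have := subrX1 z N; rewrite zN subrr => /esym/eqP.
by rewrite mulf_eq0 subr_eq0 (negPf z1).
Qed.

Lemma cabs_unit_div (l m : T) : abs2 ((val l : R[i]) / val m) = 1.
Proof.
by rewrite -sqr_cabs circle_inv cabsM cabsJ !cabs_circle mulr1 expr1n.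
Qed.

(** Only the constant term of the kernel survives, so the sum does not depend on [l]: after division
    the kernel values are weights of total mass 1. *)
Lemma kern_sum (n : nat) (l : T) : \sum_j kern n ((val l : R[i]) / val (@node n j)) =
  4^-1 ^+ n * 'C(2 * n, n)%:R * (2 * n).+1%:R.
Proof.
rewrite /kern -mulr_sumr exchange_big /= -mulrA; congr (_ * _).
pose i0 : 'I_(2 * n).+1 := inord n.
have i0E : (i0 : nat) = n by rewrite inordK //; lia.
have ex (i j : 'I_(2 * n).+1) : 'C(2 * n, i)%:R * ((val l : R[i]) / val (@node n j)) ^ (i%:Z - n%:Z) =
    ('C(2 * n, i)%:R * (val l : R[i]) ^ (i%:Z - n%:Z)) * (val (@node n j) : R[i]) ^ (n%:Z - i%:Z).
  by rewrite expfzMl -mulrA; congr (_ * (_ * _)); rewrite exprz_inv opprB.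
under eq_bigr => i _ do (under eq_bigr => j _ do rewrite ex; rewrite -mulr_sumr sum_node; last by (have := ltn_ord i; lia)).
rewrite (bigD1 i0) //= i0E subrr expr0z mulr1 eqxx big1 ?addr0 //.
move=> i ii; rewrite ifF ?mulr0 //; apply/negbTE; apply: contra ii => /eqP ii.
by apply/eqP/val_inj; rewrite /= i0E; lia.
Qed.

(** Write r = s^2: Bernoulli's inequality bounds n s^n, and the other factor s^n tends to 0. *)
Lemma geometric_beats_linear (C r e : R) : 0 < r < 1 -> 0 < e -> 0 <= C ->
  exists n : nat, C * (2 * n).+1%:R * r ^+ n <= e.
Proof.
move=> /andP[r0 r1] e0 C0.
pose s := Num.sqrt r; have s0 : 0 < s by rewrite sqrtr_gt0.
have sr : r = s ^+ 2 by rewrite sqr_sqrtr // ltW.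
have s1 : s < 1 by rewrite -sqrtr1 ltr_sqrt.
pose h := s^-1 - 1; have h0 : 0 < h by rewrite subr_gt0 invf_gt1.
have hn n : n%:R * h <= s^-1 ^+ n.
  have hE : s^-1 = 1 + h by rewrite /h addrC subrK.
  rewrite hE; elim: n => [|n IH]; first by rewrite mul0r expr0.
  rewrite exprS -natr1; have : 0 <= n%:R :> R by [].
  have : 1 <= (1 + h) ^+ n by apply: exprn_ege1; lra.
  nra.
have hs n : n%:R * s ^+ n <= h^-1.
  rewrite -[h^-1]mul1r ler_pdivlMr // mulrAC -ler_pdivlMr ?exprn_gt0 // mul1r -exprVn.
  exact: hn.
have D0 : 0 <= C * (2 * h^-1 + 1) by rewrite mulr_ge0 // addr_ge0 // mulr_ge0 // invr_ge0 ltW.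
have := @cvg_expr R s; rewrite gtr0_norm // => /(_ s1)/cvgrPdist_lt.
move=> /(_ (e / (C * (2 * h^-1 + 1) + 1))) [].
  by rewrite divr_gt0 // ltr_wpDl.
move=> n _ /(_ n (leqnn n)); rewrite sub0r normrN gtr0_norm ?exprn_gt0 // => hlt.
exists n; rewrite sr -exprM mulnC exprM expr2 mulrA.
have sn : 0 < s ^+ n by rewrite exprn_gt0.
have sn1 : s ^+ n <= 1 by apply: exprn_ile1; exact: ltW.
apply: (@le_trans _ _ (C * (2 * h^-1 + 1) * s ^+ n)).
  apply: ler_wpM2r; first exact: ltW.
  rewrite -mulrA; apply: ler_wpM2l => //.
  have := hs n; rewrite -natr1 natrM; move: sn1; lra.
move: hlt; rewrite ltr_pdivlMr ?ltr_wpDl // => hlt.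
by apply: ltW; apply: le_lt_trans hlt; rewrite mulrC ler_wpM2l ?(ltW sn) // lerDl.
Qed.


(** An approximate identity over finitely many nodes instead of a convolution. Nodes close to [l]
    are handled by uniform continuity; each of the at most 2n+1 others has a kernel value below
    r^n. *)
Lemma laurent_approx (f : T -> R[i]^o) (e : R) : continuous f -> 0 < e ->
  exists s : seq (R[i] * int), forall l : T,
    cabs (f l - \sum_(c <- s) c.1 * (val l : R[i]) ^ c.2) <= e.
Proof.
move=> cf e0; have [M M0 hM] := circle_bounded cf.
have e20 : 0 < e / 2 by lra.
have [d0 d00 hd0] := circle_unif cf e20.
pose d := Num.min d0 1; have dgt0 : 0 < d by rewrite lt_min d00 ltr01.
have d1 : d <= 1 by rewrite ge_min lexx orbT.
have hd (l m : T) : cabs (val m - val l) < d -> cabs (f m - f l) < e / 2.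
  by move=> h; apply: hd0; apply: lt_le_trans h _; rewrite ge_min lexx.
(* A point w of the circle with |w - 1| >= d has Re w <= 1 - d^2/2, so (1 + Re w) / 2 <= r. The cap
   d <= 1 keeps r in (0, 1). *)
pose r := 1 - d ^+ 2 / 4; have r01 : 0 < r < 1 by rewrite /r; apply/andP; split; nra.
have [n hn] := geometric_beats_linear r01 e20 (mulr_ge0 (ler0n R 2) M0).
set N := (2 * n).+1 in hn.
pose w (l : T) j : R[i] := (val l : R[i]) / val (@node n j).
have wE l j : kern n (w l j) = ((kern_re n (w l j))%:C)%C by rewrite kernE // cabs_unit_div.
have w1 l j : cabs (w l j) = 1.
  by apply/eqP; rewrite -[_ == 1](@eqrXn2 _ 2) ?cabs_ge0 // sqr_cabs cabs_unit_div expr1n.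
have k0 l j : 0 <= kern_re n (w l j) by apply: kern_re_ge0.
pose S0 : R := \sum_(j < N) kern_re n (w (@circle_exp R 0) j).
(* The node of index 0 is the point 1, where the kernel equals 1. This lower bound is uniform in n,
   so dividing by [S0] does not spoil the estimate of the far nodes. *)
have S01 : 1 <= S0.
  rewrite /S0 (bigD1 ord0) //= -[leLHS]addr0; apply: lerD; last by apply: sumr_ge0.
  rewrite /kern_re /w /node mul0r mulfV ?circle_neq0 //= .
  by rewrite -[1 + 1]/(2%:R) mulfV ?expr1n // pnatr_eq0.
have SE l : ((S0%:C)%C : R[i]) = \sum_(j < N) kern n (w l j).
  rewrite kern_sum -(kern_sum n (@circle_exp R 0)) rmorph_sum.
  by apply: eq_bigr => j _; exact: esym (wE _ j).
have SR l : S0 = \sum_(j < N) kern_re n (w l j).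
  apply: (@complexI R); rewrite (SE l) rmorph_sum.
  by apply: eq_bigr => j _; exact: wE.
have Sn0 : ((S0%:C)%C : R[i]) != 0.
  by rewrite eq_complex /= eqxx andbT gt_eqF //; exact: lt_le_trans ltr01 S01.
pose c (j i : 'I_N) : R[i] * int := (((S0%:C)%C)^-1 * f (@node n j) * (4^-1 ^+ n * 'C(2 * n, i)%:R *
   (val (@node n j) : R[i]) ^ (n%:Z - i%:Z)), i%:Z - n%:Z).
exists [seq c j i | j <- enum 'I_N, i <- enum 'I_N] => l.
have -> : \sum_(a <- [seq c j i | j <- enum 'I_N, i <- enum 'I_N]) a.1 * (val l : R[i]) ^ a.2 =
    ((S0%:C)%C)^-1 * \sum_(j < N) f (@node n j) * kern n (w l j).
  rewrite big_allpairs_dep big_enum /= mulr_sumr; apply: eq_bigr => j _.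
  rewrite big_enum /= mulrA /kern !mulr_sumr; apply: eq_bigr => i _.
  rewrite /w expfzMl exprz_inv opprB; ring.
have -> : f l - ((S0%:C)%C)^-1 * \sum_(j < N) f (@node n j) * kern n (w l j) =
    ((S0%:C)%C)^-1 * \sum_(j < N) (f l - f (@node n j)) * kern n (w l j).
  under [in RHS]eq_bigr do rewrite mulrBl.
  by rewrite sumrB -mulr_sumr -(SE l) mulrBr [f l * _]mulrC mulKf.
have cS : cabs ((S0%:C)%C)^-1 = S0^-1.
  by rewrite -fmorphV cabs_real ger0_norm // invr_ge0; lra.
rewrite cabsM cS mulrC ler_pdivrMr; last by lra.
apply: le_trans (cabs_sum _ _ _) _.
apply: (@le_trans _ _ (\sum_(j < N) (e / 2 * kern_re n (w l j) + 2 * M * r ^+ n))).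
  apply: ler_sum => j _; rewrite cabsM wE cabs_real ger0_norm //.
  have r0 : 0 <= r ^+ n by apply: exprn_ge0; lra.
  have [hlt|hge] := ltP (cabs (val (@node n j) - val l)) d.
    apply: ler_wpDr; first by rewrite mulr_ge0 // mulr_ge0.
    by apply: ler_wpM2r => //; rewrite cabsB; apply: ltW; exact: hd.
  apply: ler_wpDl; first by rewrite mulr_ge0 // ltW.
  apply: ler_pM => //; first exact: cabs_ge0.
    apply: le_trans (cabsD _ _) _; rewrite cabsN mulr_natl mulr2n.
    by apply: lerD.
  have := Re_le_cabs (w l j); rewrite w1 ler_norml => /andP[wl wr].
  have v0 : 0 <= (1 + Re (w l j)) / 2 by move: wl; clear; move: (Re _) => x; lra.
  have r0' : 0 <= r by move: r01 => /andP[/ltW].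
  apply: lerXn2r; rewrite ?nnegrE //.
  have : d ^+ 2 <= abs2 ((val (@node n j) : R[i]) - val l).
    by rewrite -sqr_cabs lerXn2r // nnegrE ?cabs_ge0 // ltW.
  have -> : abs2 ((val (@node n j) : R[i]) - val l) = 2 - 2 * Re (w l j).
    have h (z : T) : abs2 (val z) = 1 by rewrite -sqr_cabs cabs_circle expr1n.
    rewrite /w circle_inv; move: (h l) (h (@node n j)).
    case: (val l : R[i]) (val (@node n j) : R[i]) => [a b] [a' b'].
    by rewrite /abs2 /=; clear; lra.
  by rewrite /r; move: (Re _) => x; clear; lra.
rewrite big_split /= -mulr_sumr -SR sumr_const card_ord -mulr_natr.
have := hn; nra.
Qed.

End Laurent.

(** * Totality of the characters in L^2 of the circle *)

Section ClosedSpan.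
Context (R : realType) d (X : measurableType d) (mu : {measure set X -> \bar R}).
Context (J : Type) (E : J -> L2 mu).

Definition closed_span : set (L2 mu) := [set u | forall e : R, 0 < e ->
  exists s : seq (R[i] * J), norm2 (u - \sum_(c <- s) c.1 *: E c.2) < e].

Lemma closed_span_lin (a : R[i]) u v : closed_span u -> closed_span v ->
  closed_span (a *: u + v).
Proof.
move=> hu hv e e0; have e2 : 0 < e / 2 by lra.
have a0 : 0 < cabs a + 1 by rewrite ltr_wpDl // cabs_ge0.
have [s hs] := hu (e / 2 / (cabs a + 1)) (divr_gt0 e2 a0).
have [t ht] := hv _ e2.
exists ([seq (a * c.1, c.2) | c <- s] ++ t); rewrite big_cat big_map /=.
under eq_bigr do rewrite -scalerA.
rewrite -scaler_sumr opprD addrACA -scalerBr.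
apply: le_lt_trans (norm2D _ _) _; rewrite norm2Z [ltRHS](splitr e).
apply: ler_ltD => //; move: hs; rewrite ltr_pdivlMr // => hs.
apply: le_trans (ltW hs); rewrite mulrC ler_wpM2l ?norm2_ge0 //.
by rewrite lerDl.
Qed.

Lemma closed_span_closed u : (forall e : R, 0 < e -> exists2 v, closed_span v & norm2 (u - v) < e) ->
  closed_span u.
Proof.
move=> h e e0; have e2 : 0 < e / 2 by lra.
have [v hv uv] := h _ e2; have [s hs] := hv _ e2.
exists s; apply: le_lt_trans (norm2_triangle _ v _) _.
by rewrite [ltRHS](splitr e) ltrD.
Qed.

Lemma closed_span0 : closed_span 0.
Proof. by move=> e e0; exists [::]; rewrite big_nil subr0 norm20. Qed.

Lemma closed_span_gen j : closed_span (E j).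
Proof.
by move=> e e0; exists [:: (1, j)]; rewrite big_seq1 /= scale1r subrr norm20.
Qed.

End ClosedSpan.

Section Dominated.
Context (R : realType) d (X : measurableType d) (mu : {measure set X -> \bar R}).

Lemma dominated_sqint (f : X -> R[i]) (g : X -> R) : cmeasurable f ->
  measurable_fun setT g -> (\int[mu]_x (g x ^+ 2)%:E < +oo)%E ->
  (forall x, cabs (f x) <= g x) -> f \in sqint mu.
Proof.
move=> mf mg ig fg; apply/sqintP; split=> //; apply: le_lt_trans ig.
apply: ge0_le_integral => //; first by move=> x _; rewrite lee_fin abs2_ge0.
- exact: measurable_abs2.
- by apply/measurable_EFinP; exact: measurable_funX.
- move=> x _; rewrite lee_fin -sqr_cabs lerXn2r ?nnegrE ?cabs_ge0 //.
  exact: le_trans (cabs_ge0 _) (fg x).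
Qed.

(** Dominated convergence for |f - f_n|^2, with the majorant 4 g^2. *)
Lemma L2_dominated (f_ : nat -> X -> R[i]) (f : X -> R[i]) (g : X -> R) (e : R) :
  (forall n, cmeasurable (f_ n)) -> cmeasurable f ->
  measurable_fun setT g -> (\int[mu]_x (g x ^+ 2)%:E < +oo)%E ->
  (forall n x, cabs (f_ n x) <= g x) -> (forall x, cabs (f x) <= g x) ->
  (forall x, cabs (f x - f_ n x) @[n --> \oo] --> 0) -> 0 < e ->
  exists n, norm2 (L2class mu f - L2class mu (f_ n)) < e.
Proof.
move=> mf_ mf mg ig f_g fg cf e0.
have sf := dominated_sqint mf mg ig fg.
have sf_ n := dominated_sqint (mf_ n) mg ig (f_g n).
have sd n : (fun x => -1 * f_ n x + f x) \in sqint mu by exact: sqintD.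
pose h n x : \bar R := (abs2 (-1 * f_ n x + f x))%:E.
have hE n x : h n x = (cabs (f x - f_ n x) ^+ 2)%:E.
  by rewrite /h sqr_cabs mulN1r addrC.
have g0 x : 0 <= g x by exact: le_trans (cabs_ge0 _) (fg x).
have [] := @dominated_convergence _ _ _ mu setT measurableT h (cst 0%E)
   (fun x => (4 * g x ^+ 2)%:E).
- by move=> n; apply: measurable_abs2; case/sqintP: (sd n).
- exact: measurable_cst.
- apply: aeW => x _; rewrite (_ : h^~ x = fun n => (cabs (f x - f_ n x) ^+ 2)%:E); last first.
    by apply/funext => n; rewrite hE.
  apply/fine_cvgP; split; first exact: nearW.
  have := cvgM (cf x) (cf x); rewrite mulr0; exact.
- apply/integrableP; split.
    by apply/measurable_EFinP; apply: measurable_funM => //; exact: measurable_funX.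
  under eq_integral => x _.
    rewrite gee0_abs; last by rewrite lee_fin mulr_ge0 // sqr_ge0.
    rewrite EFinM; over.
  rewrite ge0_integralZl //; first by apply: lte_mul_pinfty.
  - by apply/measurable_EFinP; exact: measurable_funX.
  - by move=> x _; rewrite lee_fin sqr_ge0.
- apply: aeW => x n _; rewrite hE lee_fin ger0_norm ?sqr_ge0 //.
  have : cabs (f x - f_ n x) <= 2 * g x.
    apply: le_trans (cabsD _ _) _; rewrite cabsN; have := f_g n x; have := fg x; lra.
  have := cabs_ge0 (f x - f_ n x); have := g0 x; nra.
move=> _ _; rewrite integral_cst // mul0e => /fine_cvgP[_ /cvgrPdist_lt].
move=> /(_ (e ^+ 2)) [|n _ /(_ n (leqnn n))]; first by rewrite exprn_gt0.
rewrite sub0r normrN /= => hn; exists n.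
have -> : L2class mu f - L2class mu (f_ n) = L2class mu (fun x => -1 * f_ n x + f x).
  by rewrite L2classD // scaleN1r addrC.
rewrite -ltr_sqr ?nnegrE ?norm2_ge0 ?(ltW e0) //.
have := norm2_class (sd n); rewrite -/(h n) => hn2.
move: hn; rewrite -[(\int[mu]_x h n x)%E]hn2 /= ger0_norm //.
exact: sqr_ge0.
Qed.

End Dominated.

Section ZetaBasis.
Variable R : realType.
Local Notation T := (circle R).
Local Notation hr := (haar R).

Lemma inner_zeta (m n : int) : inner (zeta R m) (zeta R n) = (m == n)%:R.
Proof.
rewrite /zeta inner_class ?char_sqint //.
under eq_fun do rewrite conj_char -expfzDr ?circle_neq0 //.
set k := m - n; have -> : (m == n) = (k == 0) by rewrite subr_eq0.
have [cR cI] := continuous_ReIm (@continuous_char R k).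
have bR (l : T) : `|Re ((val l : R[i]) ^ k)| <= 1 by rewrite (le_trans (Re_le_cabs _)) ?cabs_char.
have bI (l : T) : `|Im ((val l : R[i]) ^ k)| <= 1 by rewrite (le_trans (Im_le_cabs _)) ?cabs_char.
have [k0|k0] := eqVneq k 0.
  rewrite k0 in cR cI bR bI *; apply: eq_cplx; rewrite /=.
    by rewrite (haar_FTC (G := id) cR bR) ?subr0 // => t; rewrite expr0z; exact: is_derive_id.
  rewrite (haar_FTC (G := cst 0) cI bI) ?subr0 // => t; rewrite expr0z; exact: is_derive_cst.
pose w : R := 2 * pi * k%:~R.
have w0 : w != 0 by rewrite /w !mulf_eq0 intr_eq0 (negPf k0) (gt_eqF (pi_gt0 R)) pnatr_eq0.
have c1 : cos w = 1 /\ sin w = 0.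
  have h : (val (@circle_exp R 1) : R[i]) ^ k = 1 by rewrite circle_exp1 exp1rz.
  by move: h; rewrite circle_expX mulr1 -/w => -[-> ->].
have dR (t : R) : is_derive t (1 : R) (fun t => w^-1 * sin (w * t))
    (Re ((val (@circle_exp R t) : R[i]) ^ k)).
  rewrite circle_expX /=; apply: is_derive_eq.
  by rewrite /GRing.scale /= -/w; field.
have dI (t : R) : is_derive t (1 : R) (fun t => - w^-1 * cos (w * t))
    (Im ((val (@circle_exp R t) : R[i]) ^ k)).
  rewrite circle_expX /=; apply: is_derive_eq.
  by rewrite /GRing.scale /= -/w; field.
apply: eq_cplx; rewrite /=.
  by rewrite (haar_FTC cR bR dR) mulr1 mulr0 sin0 c1.2 subrr.
by rewrite (haar_FTC cI bI dI) mulr1 mulr0 cos0 c1.1 subrr.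
Qed.

Local Notation cs := (closed_span (zeta R)).

Lemma sum_zeta (s : seq (R[i] * int)) : \sum_(c <- s) c.1 *: zeta R c.2 =
   L2class hr (fun l => \sum_(c <- s) c.1 * (val l : R[i]) ^ c.2) /\
  (fun l : T => \sum_(c <- s) c.1 * (val l : R[i]) ^ c.2) \in sqint hr.
Proof.
elim: s => [|c s [IH1 IH2]].
  under [X in L2class _ X]eq_fun do rewrite big_nil.
  under [X in X \in _]eq_fun do rewrite big_nil.
  by rewrite big_nil L2class0; split=> //; exact: sqint0.
under [X in L2class _ X]eq_fun do rewrite big_cons.
under [X in X \in _]eq_fun do rewrite big_cons.
rewrite big_cons IH1 /zeta -L2classD ?char_sqint //.
by split=> //; apply: sqintD => //; exact: char_sqint.
Qed.

Lemma closed_span_continuous (f : T -> R[i]^o) : continuous f -> cs (L2class hr f).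
Proof.
move=> cf e e0; have e2 : 0 < e / 2 by lra.
have [s hs] := laurent_approx cf e2; have [M M0 hM] := circle_bounded cf.
have mf := continuous_cmeasurable cf.
have sf := bounded_sqint mf hM.
exists s; have [-> ss] := sum_zeta s.
rewrite -scaleN1r addrC -L2classD //.
apply: (@le_lt_trans _ _ (e / 2)); last lra.
apply: norm2_bounded; [lra|by case/sqintP: (sqintD (-1) ss sf)|].
by move=> l; rewrite mulN1r addrC; exact: hs.
Qed.

Lemma cplx_cmeasurable (g : T -> R) : measurable_fun setT g -> cmeasurable (fun l => ((g l)%:C)%C).
Proof. by move=> mg; split=> //=; exact: measurable_cst. Qed.

Lemma int_cst_haar (M : R) : (\int[hr]_x ((cst M x) ^+ 2)%:E < +oo)%E.
Proof.
rewrite (_ : (fun x => _) = cst (M ^+ 2)%:E) //.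
rewrite integral_cst // [X in (_ * X)%E](_ : _ = 1%E) ?mule1 ?ltry //.
exact: (probability_setT (haar R)).
Qed.

Lemma closed_span_bounded_limit (g_ : nat -> T -> R) (g : T -> R) :
  (forall n, measurable_fun setT (g_ n)) -> measurable_fun setT g ->
  (forall n l, `|g_ n l| <= 1) -> (forall l, `|g l| <= 1) ->
  (forall l, g_ n l @[n --> \oo] --> g l) ->
  (forall n, cs (L2class hr (fun l => ((g_ n l)%:C)%C))) ->
  cs (L2class hr (fun l => ((g l)%:C)%C)).
Proof.
move=> mg_ mg b_ b cg h; apply: closed_span_closed => e e0.
have [||||||||n hn] := @L2_dominated _ _ _ hr (fun n l => ((g_ n l)%:C)%C)
  (fun l => ((g l)%:C)%C) (cst 1) e.
- by move=> n; exact: cplx_cmeasurable.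
- exact: cplx_cmeasurable.
- exact: measurable_cst.
- exact: int_cst_haar.
- by move=> n l; rewrite cabs_real.
- by move=> l; rewrite cabs_real.
- move=> l; have /cvgrPdist_lt hl := cg l; apply/cvgrPdist_lt => r r0.
  apply: filterS (hl r r0) => n.
  by rewrite -rmorphB cabs_real sub0r normrN normr_id.
- by [].
exists (L2class hr (fun l => ((g_ n l)%:C)%C)); [exact: h|exact: hn].
Qed.

Lemma cvg_realP (X : topologicalType) (f : X -> R) (x : X) :
  {for x, continuous f} <->
  forall e : R, 0 < e -> \forall y \near x, `|f y - f x| < e.
Proof.
split=> [/cvgrPdist_lt h e e0|h].
  by apply: filterS (h e e0) => y; rewrite distrC.
apply/cvgrPdist_lt => e e0.
by apply: filterS (h e e0) => y; rewrite distrC.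
Qed.

Lemma continuous_min1M (X : topologicalType) (f : X -> R) (c : R) : continuous f ->
  continuous (fun x => Num.min 1 (c * f x)).
Proof.
move=> cf x; apply: (@continuous_min _ _ (fun=> 1) (fun x => c * f x)); first exact: cvg_cst.
by apply: cvgM; [exact: cvg_cst|exact: cf].
Qed.

Lemma measurable_circle_open (U : set T) : open U -> measurable U.
Proof. exact: sub_sigma_algebra. Qed.

(** The continuous functions min(1, n dist(l, U^c)) tend pointwise to the indicator of [U]. The case
    U = T is apart because the infimum [D] requires a nonempty complement. *)
Lemma closed_span_open (U : set T) : open U -> cs (L2class hr (fun l => ((\1_U l)%:C)%C)).
Proof.
move=> oU; have [UT|nU] := pselect (U = setT).
  rewrite (_ : (fun l => _) = fun l => (val l : R[i]) ^ 0); last first.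
    by apply/funext => l; rewrite UT indicT expr0z.
  exact: closed_span_gen.
have {nU} [m0 Um0] : exists m, ~ U m.
  by apply/existsNP => h; apply: nU; apply/seteqP; split=> // l _; apply: h.
pose S (l : T) := [set x : R | exists2 m : T, ~ U m & x = cabs (val l - val m)].
pose D (l : T) := inf (S l).
have Slb l : lbound (S l) 0 by move=> _ [m _ ->]; exact: cabs_ge0.
have hS l : has_inf (S l) by split; [exists (cabs (val l - val m0)), m0|exists 0].
have D0 l : 0 <= D l by apply: lb_le_inf; [case: (hS l)|].
have Dle l m : ~ U m -> D l <= cabs (val l - val m).
  by move=> Um; apply: ge_inf; [exists 0|exists m].
have DU l : U l -> 0 < D l.
  move=> Ul; have : nbhs l U by exact: open_nbhs_nbhs.
  move=> /circle_nbhsP[d d0 hd]; apply: (lt_le_trans d0); apply: lb_le_inf.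
    by case: (hS l).
  move=> _ [m Um ->]; rewrite leNgt; apply/negP; rewrite cabsB => /hd; exact: Um.
have DN l : ~ U l -> D l = 0.
  move=> Ul; apply/eqP; rewrite eq_le D0 andbT.
  by apply: le_trans (Dle l l Ul) _; rewrite subrr cabs0.
have DL l m : D l <= D m + cabs (val l - val m).
  rewrite -lerBlDr; apply: lb_le_inf; first by case: (hS m).
  move=> _ [m' Um' ->]; rewrite lerBlDr; apply: le_trans (Dle l m' Um') _.
  rewrite [leRHS]addrC; apply: le_trans _ (cabsD _ _).
  by rewrite addrA subrK.
have DLip l m : `|D l - D m| <= cabs (val l - val m).
  by rewrite ler_norml; apply/andP; split; [have := DL m l; rewrite cabsB|have := DL l m]; lra.
have cD : continuous D.
  move=> l; apply/cvg_realP => e e0; apply/circle_nbhsP; exists e => // m hm.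
  exact: le_lt_trans (DLip m l) _.
pose g (n : nat) l := Num.min 1 (n%:R * D l).
have cg n : continuous (g n) by exact: continuous_min1M.
have g01 n l : 0 <= g n l <= 1.
  by rewrite /g le_min ler01 ge_min lexx /= andbT mulr_ge0.
apply: (@closed_span_bounded_limit g).
- by move=> n; apply: continuous_measurable_circle.
- by apply: measurable_indic; exact: measurable_circle_open.
- by move=> n l; have /andP[? ?] := g01 n l; rewrite ger0_norm.
- by move=> l; rewrite ger0_norm ?indicE //; case: (_ \in _).
- move=> l; have [Ul|Ul] := pselect (U l).
    rewrite indicE mem_set //; apply/cvgrPdist_lt => e e0.
    near=> n; rewrite /g min_l ?subrr ?normr0 //.
    rewrite -ler_pdivrMr ?DU //; apply: ltW.
    by near: n; exact: nbhs_infty_gtr.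
  rewrite indicE memNset // (_ : g^~ l = cst 0); first exact: cvg_cst.
  by apply/funext => n; rewrite /g DN // mulr0 min_r.
- move=> n; apply: closed_span_continuous => l; apply/cvg_cplxP => e e0.
  have := (cvg_realP (g n) l).1 (cg n l) e e0; apply: filterS => m.
  by rewrite -rmorphB cabs_real.
Unshelve. all: by end_near. Qed.

(** The open sets are stable under intersection and generate the Borel sets, and the sets whose
    indicator lies in the closed span form a Dynkin class. *)
Lemma closed_span_indic (A : set T) : measurable A -> cs (L2class hr (fun l => ((\1_A l)%:C)%C)).
Proof.
have sq (B : set T) : measurable B -> (fun l => ((\1_B l)%:C)%C : R[i]) \in sqint hr.
  move=> mB; apply: (@bounded_sqint _ _ 1).
    by apply: cplx_cmeasurable; exact: measurable_indic.
  by move=> l; rewrite cabs_real ger0_norm ?indicE //; case: (_ \in _).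
have s1 : (fun l => (val l : R[i]) ^ 0) \in sqint hr := char_sqint R 0.
pose P (B : set T) := cs (L2class hr (fun l => ((\1_B l)%:C)%C)).
have H := @dynkin_induction _ T (@open T) P (erefl _) (fun U V oU oV => openI oU oV)
  (closed_span_open openT) closed_span_open.
move=> mA; refine (H _ _ A mA) => {mA A H}.
- move=> B mB PB; rewrite /P (_ : (fun l => _) = fun l => -1 * ((\1_B l)%:C)%C + (val l : R[i]) ^ 0).
    rewrite (L2classD (-1) (sq B mB) s1).
    exact: (closed_span_lin (-1) PB (closed_span_gen (zeta R) 0)).
  apply/funext => l; rewrite expr0z !indicE in_setC mulN1r.
  by case: (_ \in _); rewrite /= ?addNr ?oppr0 ?add0r.
- move=> F mF tF PF.
  apply: (@closed_span_bounded_limit (fun n => \1_(\big[setU/set0]_(i < n) F i))).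
  + by move=> n; apply: measurable_indic; apply: bigsetU_measurable.
  + by apply: measurable_indic; apply: bigcup_measurable.
  + by move=> n l; rewrite ger0_norm ?indicE //; case: (_ \in _).
  + by move=> l; rewrite ger0_norm ?indicE //; case: (_ \in _).
  + move=> l; have [[n _ Fn]|Fl] := pselect ((\bigcup_k F k) l).
      rewrite indicE mem_set; last by exists n.
      apply/cvgrPdist_lt => e e0; near=> m.
      rewrite indicE mem_set ?subrr ?normr0 //; rewrite -bigcup_mkord; exists n => //=.
      by near: m; exists n.+1.
    rewrite indicE memNset // (_ : (fun n => _) = cst 0); first exact: cvg_cst.
    apply/funext => n; rewrite indicE memNset // -bigcup_mkord => -[k _ Fk].
    by apply: Fl; exists k.
  + elim=> [|n IH].
      rewrite (_ : (fun l => _) = fun=> 0); first by rewrite L2class0; exact: closed_span0.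
      by apply/funext => l; rewrite big_ord0 indic0.
    rewrite (_ : (fun l => _) = fun l => 1 * ((\1_(F n) l)%:C)%C +
        ((\1_(\big[setU/set0]_(i < n) F i) l)%:C)%C).
      have mU : measurable (\big[setU/set0]_(i < n) F i) by apply: bigsetU_measurable.
      rewrite (L2classD 1 (sq _ (mF n)) (sq _ mU)).
      exact: (closed_span_lin 1 (PF n) IH).
    apply/funext => l; rewrite big_ord_recr /= mul1r -rmorphD addrC; congr ((_ _)%C).
    rewrite !indicE in_setU; have [h1|h1] := boolP (l \in F n); last by rewrite orbF addr0.
    rewrite orbT; case: (boolP (l \in _)) => [|_]; last by rewrite add0r.
    rewrite inE -bigcup_mkord => -[k /= kn Fk].
    move: h1; rewrite inE => h1.
    have kE : k = n by apply: tF => //; exists l.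
    by move: kn; rewrite kE ltnn.
Unshelve. all: by end_near. Qed.

Lemma closed_span_simple (s : seq (R * set T)) : (forall c, c \in s -> measurable c.2) ->
  (fun l => ((\sum_(c <- s) c.1 * \1_(c.2) l)%:C)%C : R[i]) \in sqint hr /\
  cs (L2class hr (fun l => ((\sum_(c <- s) c.1 * \1_(c.2) l)%:C)%C)).
Proof.
elim: s => [|[a A] s IH] hm.
  rewrite (_ : (fun l => _) = fun=> 0); last by apply/funext => l; rewrite big_nil.
  by rewrite L2class0; split; [exact: sqint0|exact: closed_span0].
have [|h1 h2] := IH; first by move=> c cs; apply: hm; rewrite in_cons cs orbT.
have mA : measurable A by apply: (hm (a, A)); exact: mem_head.
have sA : (fun l => ((\1_A l)%:C)%C : R[i]) \in sqint hr.
  apply: (@bounded_sqint _ _ 1).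
    by apply: cplx_cmeasurable; exact: measurable_indic.
  by move=> l; rewrite cabs_real ger0_norm ?indicE //; case: (_ \in _).
have -> : (fun l => ((\sum_(c <- (a, A) :: s) c.1 * \1_(c.2) l)%:C)%C : R[i]) =
  fun l => (a%:C)%C * ((\1_A l)%:C)%C + ((\sum_(c <- s) c.1 * \1_(c.2) l)%:C)%C.
  by apply/funext => l; rewrite big_cons rmorphD rmorphM.
split; first exact: sqintD.
rewrite (L2classD _ sA h1).
exact: (closed_span_lin _ (closed_span_indic mA) h2).
Qed.

Import HBNNSimple.

Lemma closed_span_nneg (g : T -> R) : measurable_fun setT g -> (forall l, 0 <= g l) ->
  (\int[hr]_x (g x ^+ 2)%:E < +oo)%E -> cs (L2class hr (fun l => ((g l)%:C)%C)).
Proof.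
move=> mg g0 ig; apply: closed_span_closed => e e0.
have mE : measurable_fun setT (EFin \o g) by exact/measurable_EFinP.
have g0' (l : T) : setT l -> (0 <= (EFin \o g) l)%E by rewrite lee_fin.
pose h n := nnsfun_approx measurableT mE n.
have hle n l : h n l <= g l.
  rewrite -lee_fin /h nnsfun_approxE.
  exact: (@le_approx _ _ _ setT (EFin \o g) n l g0').
have h0 n l : 0 <= h n l by exact: fun_ge0.
have hc l : h n l @[n --> \oo] --> g l.
  have /fine_cvgP[_] := @cvg_nnsfun_approx _ _ _ setT measurableT (EFin \o g) mE g0' l Logic.I.
  exact.
have [||||||||n hn] := @L2_dominated _ _ _ hr (fun n l => ((h n l)%:C)%C)
  (fun l => ((g l)%:C)%C) g e.
- by move=> n; apply: cplx_cmeasurable; exact: measurable_funP.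
- exact: cplx_cmeasurable.
- exact: mg.
- exact: ig.
- by move=> n l; rewrite cabs_real ger0_norm.
- by move=> l; rewrite cabs_real ger0_norm.
- move=> l; have /cvgrPdist_lt hl := hc l; apply/cvgrPdist_lt => r r0.
  apply: filterS (hl r r0) => n.
  by rewrite -rmorphB cabs_real sub0r normrN normr_id.
- by [].
exists (L2class hr (fun l => ((h n l)%:C)%C)); last exact: hn.
pose s := [seq (y, h n @^-1` [set y]) | y <- finmap.enum_fset (fset_set (range (h n)))].
have -> : (fun l => ((h n l)%:C)%C) = (fun l => ((\sum_(c <- s) c.1 * \1_(c.2) l)%:C)%C : R[i]).
  apply/funext => l; congr ((_ _)%C); rewrite fimfunE big_map /=.
  by rewrite fsbig_finite.
apply: (closed_span_simple _).2 => c /mapP[y _ ->] /=.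
by apply: measurable_funPTI.
Qed.

(** What is left after [closed_span_nneg] is the splitting into real and imaginary, then positive
    and negative parts, each dominated by |f|. *)
Lemma total_zeta : total_family (zeta R).
Proof.
suff h u : cs u by move=> u; exact: h.
rewrite -(L2_reprK u); set f := L2_repr u.
have /sqintP[[mR mI] sf] := L2_repr_sqint u.
have key (g : T -> R) : measurable_fun setT g -> (forall l, `|g l| <= cabs (f l)) ->
   cs (L2class hr (fun l => ((g l)%:C)%C)) /\ (fun l => ((g l)%:C)%C) \in sqint hr.
  move=> mg hg.
  have pos (k : T -> R) : measurable_fun setT k -> (forall l, 0 <= k l) ->
      (forall l, k l <= cabs (f l)) ->
      cs (L2class hr (fun l => ((k l)%:C)%C)) /\ (fun l => ((k l)%:C)%C) \in sqint hr.
    move=> mk k0 kf.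
    have ik : (\int[hr]_x (k x ^+ 2)%:E < +oo)%E.
      apply: le_lt_trans sf; apply: ge0_le_integral => //.
      - by move=> x _; rewrite lee_fin sqr_ge0.
      - by apply/measurable_EFinP; exact: measurable_funX.
      - exact: measurable_abs2.
      - move=> x _; rewrite lee_fin -sqr_cabs lerXn2r ?nnegrE ?cabs_ge0 //; exact: kf.
    split; first exact: closed_span_nneg.
    apply: (dominated_sqint (cplx_cmeasurable mk) mk ik).
    by move=> l; rewrite cabs_real ger0_norm.
  have [p1 p2] : cs (L2class hr (fun l => ((Num.max (g l) 0)%:C)%C)) /\
     (fun l => ((Num.max (g l) 0)%:C)%C) \in sqint hr.
    apply: pos; [by apply: measurable_maxr|by move=> l; rewrite le_max lexx orbT|].
    move=> l; rewrite ge_max cabs_ge0 andbT; apply: le_trans (hg l); exact: ler_norm.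
  have [n1 n2] : cs (L2class hr (fun l => ((Num.max (- g l) 0)%:C)%C)) /\
     (fun l => ((Num.max (- g l) 0)%:C)%C) \in sqint hr.
    apply: pos; [by apply: measurable_maxr => //; exact: measurableT_comp|by move=> l; rewrite le_max lexx orbT|].
    move=> l; rewrite ge_max cabs_ge0 andbT; apply: le_trans (hg l).
    by rewrite -normrN ler_norm.
  have -> : (fun l => ((g l)%:C)%C : R[i]) =
      fun l => -1 * ((Num.max (- g l) 0)%:C)%C + ((Num.max (g l) 0)%:C)%C.
    apply/funext => l; rewrite mulN1r addrC -rmorphB; congr ((_ _)%C).
    have [gl|gl] := leP 0 (g l).
      by rewrite max_r ?subr0 // oppr_le0.
    by rewrite max_l ?sub0r ?opprK // oppr_ge0 ltW.
  rewrite (L2classD _ n2 p2); split; last exact: (sqintD (-1) n2 p2).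
  exact: (closed_span_lin (-1) n1 p1).
have [r1 r2] := key (fun l => Re (f l)) mR (fun l => Re_le_cabs _).
have [i1 i2] := key (fun l => Im (f l)) mI (fun l => Im_le_cabs _).
have -> : f = fun l => Complex 0 1 * ((Im (f l))%:C)%C + ((Re (f l))%:C)%C.
  by apply/funext => l; apply: eq_cplx; rewrite /= ?mul0r ?mulr0 ?mul1r ?subr0 ?add0r ?addr0.
rewrite (L2classD _ i2 r2).
exact: (closed_span_lin (Complex 0 1) i1 r1).
Qed.

End ZetaBasis.

(** * Shifts and multiplications *)

Section Multiplication.
Context (R : realType) d (X : measurableType d) (mu : {measure set X -> \bar R}).
Variables (g : X -> R[i]) (M : R).
Hypotheses (mg : cmeasurable g) (gM : forall x, cabs (g x) <= M).

Lemma mul_sqint (f : X -> R[i]) : f \in sqint mu -> (fun x => g x * f x) \in sqint mu.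
Proof.
move=> /sqintP[mf sf]; apply/sqintP; split; first exact: cmeasurableM.
apply: (@le_lt_trans _ _ (\int[mu]_x ((M ^+ 2)%:E * (abs2 (f x))%:E))%E).
  apply: ge0_le_integral => //.
  - by move=> x _; rewrite lee_fin abs2_ge0.
  - by apply: measurable_abs2; exact: cmeasurableM.
  - exact: (measurable_funeM _ (measurable_abs2 mf)).
  - move=> x _; rewrite -EFinM lee_fin abs2M ler_wpM2r ?abs2_ge0 //.
    rewrite -sqr_cabs lerXn2r ?nnegrE ?cabs_ge0 //.
    exact: le_trans (cabs_ge0 _) (gM x).
rewrite ge0_integralZl_EFin ?sqr_ge0 //.
- by apply: lte_mul_pinfty => //; rewrite lee_fin sqr_ge0.
- by move=> x _; rewrite lee_fin abs2_ge0.
- exact: measurable_abs2.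
Qed.

Lemma mul_op_class (f : X -> R[i]) : f \in sqint mu ->
  mul_op mu g (L2class mu f) = L2class mu (fun x => g x * f x).
Proof.
move=> sf; rewrite /mul_op; apply: eq_L2class; try by apply: mul_sqint; rewrite ?L2_repr_sqint.
by apply: filterS (L2class_repr sf) => x ->.
Qed.

Lemma mul_op_linear : linear (mul_op mu g).
Proof.
move=> a u v; rewrite -(L2_reprK u) -(L2_reprK v).
rewrite -L2classD ?L2_repr_sqint // !mul_op_class ?L2_repr_sqint //; last first.
  by apply: sqintD; exact: L2_repr_sqint.
rewrite -L2classD; [|by apply: mul_sqint; exact: L2_repr_sqint..].
by congr L2class; apply/funext => x; ring.
Qed.

Lemma norm2_mul_op u : norm2 (mul_op mu g u) <= M * norm2 u.
Proof.
have [[x0]|nX] := pselect (inhabited X); last first.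
  have u0 (v : L2 mu) : v = 0.
    rewrite -(L2_reprK v) -L2class0; congr L2class; apply/funext => x.
    by case: nX; exists.
  by rewrite (u0 u) (u0 (mul_op mu g 0)) norm20 mulr0.
have M0 : 0 <= M := le_trans (cabs_ge0 _) (gM x0).
rewrite -ler_sqr ?nnegrE ?mulr_ge0 ?norm2_ge0 // exprMn -lee_fin [leRHS]EFinM.
have e1 := norm2_class (mul_sqint (L2_repr_sqint u)).
have e2 := norm2_class (L2_repr_sqint u); rewrite L2_reprK in e2.
rewrite [leLHS]e1 e2.
have mu_ := L2_repr_measurable u.
rewrite -ge0_integralZl_EFin ?sqr_ge0 //.
- apply: ge0_le_integral => //.
  + by move=> x _; rewrite lee_fin abs2_ge0.
  + by apply: measurable_abs2; exact: cmeasurableM.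
  + exact: (measurable_funeM _ (measurable_abs2 mu_)).
  + move=> x _; rewrite -EFinM lee_fin abs2M ler_wpM2r ?abs2_ge0 //.
    by rewrite -sqr_cabs lerXn2r ?nnegrE ?cabs_ge0.
- by move=> x _; rewrite lee_fin abs2_ge0.
- exact: measurable_abs2.
Qed.

End Multiplication.

Lemma mul_opDl (R : realType) d (X : measurableType d) (mu : {measure set X -> \bar R})
   (g h : X -> R[i]) (M M' : R) (a : R[i]) (u : L2 mu) :
  cmeasurable g -> (forall x, cabs (g x) <= M) ->
  cmeasurable h -> (forall x, cabs (h x) <= M') ->
  mul_op mu (fun x => a * g x + h x) u = a *: mul_op mu g u + mul_op mu h u.
Proof.
move=> mg gM mh hM; rewrite /mul_op.
rewrite -(L2classD a (mul_sqint mg gM (L2_repr_sqint u)) (mul_sqint mh hM (L2_repr_sqint u))).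
by congr L2class; apply/funext => x; ring.
Qed.

Section Shift.
Variables (R : realType) (q : R).
Local Notation I := (Iq q).
Local Notation T := (circle R).
Local Notation H := (L2 (mu_H q)).
Local Notation slice := (@slice_at R q _ _ (haar R)).

Fact shift_mul_key : unit. Proof. by []. Qed.
Definition shift_mul : R -> (T * I -> R[i]) -> H -> H :=
  locked_with shift_mul_key (fun p f => rho p \o mul_op (mu_H q) f).

Lemma shift_mulE p f : shift_mul p f = rho p \o mul_op (mu_H q) f.
Proof. by rewrite /shift_mul unlock. Qed.

(** Measurability of the sections is all that has to be asked: it gives joint measurability because
    I_q is countable and discrete. *)
Definition symbol (f : T * I -> R[i]) : Prop :=
  (forall x, cmeasurable (fun l => f (l, x))) /\ exists M : R, forall z, cabs (f z) <= M.

Lemma symbolD a f g : symbol f -> symbol g -> symbol (fun z => a * f z + g z).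
Proof.
move=> [mf [M fM]] [mg [N gN]]; split=> [x|].
  by apply: cmeasurableD => //; apply: cmeasurableM => //; exact: cmeasurable_cst.
exists (cabs a * M + N) => z; apply: le_trans (cabsD _ _) _.
by rewrite cabsM; apply: lerD => //; rewrite ler_wpM2l ?cabs_ge0.
Qed.

Lemma slice_mul_op f (u : H) y : symbol f ->
  slice (mul_op (mu_H q) f u) y = mul_op (haar R) (fun l => f (l, y)) (slice u y).
Proof.
move=> [mf [M fM]]; have cf := cmeasurable_prod_Iq mf.
have := mul_sqint (mu := mu_H q) cf fM (L2_repr_sqint u) => sf.
rewrite /mul_op (slice_at_class y sf) slice_atE.
exact: esym (mul_op_class (mf y) (fun l => fM (l, y)) (slice_at_sqint u y)).
Qed.

(** Multiplication by [p] is injective, so the left side sums [phi] over a subset of I_q. *)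
Lemma esum_shift (p : R) (phi : I -> \bar R) : p != 0 -> (forall y, 0 <= phi y)%E ->
  (\esum_(x in [set: I]) (if (insub (p * val x)%R : option I) is Some y then phi y else 0) <=
   \esum_(y in setT) phi y)%E.
Proof.
move=> p0 phi0.
pose D : set I := [set t | exists y : I, val y = p * val t].
pose h (t : I) : I := odflt point (insub (p * val t) : option I).
have hD t : D t -> val (h t) = p * val t by move=> [y yt]; rewrite /h -yt valK.
apply: (@le_trans _ _ (\esum_(t in D) phi (h t))%E).
  rewrite [leRHS]esum_mkcond; apply: le_esum => t _.
  case: insubP => [y _ yt|_]; last by case: ifP.
  by rewrite mem_set; [rewrite /h -yt valK|exists y].
rewrite -(@reindex_esum _ _ _ D (h @` D) h).
  rewrite [leLHS]esum_mkcond; apply: le_esum => y _.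
  by case: ifP => // _; exact: phi0.
split=> //; move=> s t /set_mem Ds /set_mem Dt /(congr1 val); rewrite !hD //.
by move/(mulfI p0)/val_inj.
Qed.

Lemma rho_sqint (p : R) (v : H) : p != 0 -> (fun lx : T * I =>
   if (insub (p * val lx.2) : option I) is Some y then L2_repr v (lx.1, y) else 0)
   \in sqint (mu_H q).
Proof.
move=> p0; apply: sqint_prod_Iq => [t|] /=.
  case: insubP => [y _ _|_]; last exact: sqint0.
  exact: (slice_at_sqint v y).
pose phi (y : I) : \bar R := (\int[haar R]_l (abs2 (L2_repr v (l, y)))%:E)%E.
have phi0 y : (0 <= phi y)%E by apply: integral_ge0 => l _; rewrite lee_fin abs2_ge0.
apply: (@le_lt_trans _ _ (\esum_(y in setT) phi y)%E); last first.
  have := norm2_slices v; under eq_esum => t _.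
    rewrite slice_atE (norm2_class (slice_at_sqint v t)); over.
  by rewrite -/phi => <-; rewrite ltry.
apply: le_trans (esum_shift p0 phi0); apply: le_esum => t _.
case: insubP => [y _ yt|_] //.
rewrite (eq_integral (cst 0%E)) ?integral0 // => l _.
by rewrite /abs2 /= expr0n addr0.
Qed.

Lemma slice_rho (p : R) (v : H) x : p != 0 ->
  slice (rho p v) x = if (insub (p * val x) : option I) is Some y then slice v y else 0.
Proof.
move=> p0; rewrite /rho (slice_at_class x (rho_sqint v p0)) /=.
by case: insubP => [y _ _|_]; rewrite ?slice_atE // L2class0.
Qed.

Lemma slice_shift_mul p f (u : H) x : p != 0 -> symbol f ->
  slice (shift_mul p f u) x = if (insub (p * val x) : option I) is Some y
    then mul_op (haar R) (fun l => f (l, y)) (slice u y) else 0.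
Proof.
by move=> p0 sf; rewrite shift_mulE slice_rho //; case: insubP => // y _ _; exact: slice_mul_op.
Qed.

Lemma shift_mulDl p a f g u : p != 0 -> symbol f -> symbol g ->
  shift_mul p (fun z => a * f z + g z) u = a *: shift_mul p f u + shift_mul p g u.
Proof.
move=> p0 sf sg; apply: slice_at_inj => x; rewrite slice_atD.
rewrite (slice_shift_mul u x p0 (symbolD a sf sg)).
rewrite (slice_shift_mul u x p0 sf) (slice_shift_mul u x p0 sg).
case: insubP => [y _ _|_]; last by rewrite scaler0 addr0.
have [mf [M fM]] := sf; have [mg [N gN]] := sg.
exact: (mul_opDl a _ (mf y) (fun l => fM (l, y)) (mg y) (fun l => gN (l, y))).
Qed.

Lemma shift_mul_linear p f : p != 0 -> symbol f -> linear (shift_mul p f).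
Proof.
move=> p0 sf a u v; apply: slice_at_inj => x.
rewrite slice_atD (slice_shift_mul (a *: u + v) x p0 sf).
rewrite (slice_shift_mul u x p0 sf) (slice_shift_mul v x p0 sf).
case: insubP => [y _ _|_]; last by rewrite scaler0 addr0.
have [mf [M fM]] := sf.
by rewrite slice_atD (mul_op_linear (mf y) (fun l => fM (l, y))).
Qed.

(** The slice at y survives the shift only if y / p is in I_q, so the bound on [f] is asked at these
    points alone. For negative p this discards all large y. *)
Lemma norm2_shift_mul p f (e : R) u : p != 0 -> symbol f -> 0 <= e ->
  (forall l (y : I), Iq_set q (val y / p) -> cabs (f (l, y)) <= e) ->
  norm2 (shift_mul p f u) <= e * norm2 u.
Proof.
move=> p0 sf e0 fe.
rewrite -ler_sqr ?nnegrE ?mulr_ge0 ?norm2_ge0 // exprMn -lee_fin [leRHS]EFinM.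
rewrite (norm2_slices (shift_mul p f u)) (norm2_slices u).
rewrite -esum_Zl ?sqr_ge0 // => [|t]; last exact: sqr_ge0.
pose phi (y : I) : \bar R := (e ^+ 2 * norm2 (slice u y) ^+ 2)%:E.
have phi0 y : (0 <= phi y)%E by rewrite lee_fin mulr_ge0 ?sqr_ge0.
apply: le_trans (esum_shift p0 phi0); apply: le_esum => t _.
rewrite slice_shift_mul //; case: insubP => [y _ yt|_]; last by rewrite norm20 expr0n.
rewrite lee_fin -exprMn ler_sqr ?nnegrE ?mulr_ge0 ?norm2_ge0 //.
have [mf [M fM]] := sf; apply: (norm2_mul_op (mf y)) => l; apply: fe.
by rewrite yt mulrAC mulfV // mul1r; apply/set_mem/valP.
Qed.

Lemma shift_mul_bounded p f : p != 0 -> symbol f -> bounded_op (shift_mul p f).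
Proof.
move=> p0 sf; split; first exact: shift_mul_linear.
have [mf [M fM]] := sf; exists M => u; apply: norm2_shift_mul => //.
exact: le_trans (cabs_ge0 _) (fM point).
Qed.

Definition basis_H (k : int) (p : R) : H := tensor (zeta R k) (delta q p).

Lemma L2_repr_deltaR (p : R) (t : I) : L2_repr (delta q p) t = (val t == p)%:R.
Proof. by rewrite (ae_mu_I (L2class_repr (delta_sqint q p)) t). Qed.

Definition mono (b : I -> R) (k : int) (z : T * I) : R[i] :=
  ((b z.2)%:C)%C * (val z.1 : R[i]) ^ k.

Lemma mono_symbol b k : (exists M : R, forall x, `|b x| <= M) -> symbol (mono b k).
Proof.
move=> [M bM]; split=> [x|]; last first.
  by exists M => z; rewrite cabsM cabs_real cabs_char mulr1.
have cz : cmeasurable (fun l : T => (val l : R[i]) ^ k).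
  by apply: continuous_cmeasurable; exact: continuous_char.
exact: (@cmeasurableM R _ T _ _ (@cmeasurable_cst R _ T ((b x)%:C)%C) cz).
Qed.

(** If x / p lies outside I_q, the shift kills the slice and [delta] is 0 by convention, so the
    formula holds there too. *)
Lemma shift_mul_basis p b k j (x : I) : p != 0 -> (exists M : R, forall x, `|b x| <= M) ->
  shift_mul p (mono b k) (basis_H j (val x)) = ((b x)%:C)%C *: basis_H (j + k) (val x / p).
Proof.
move=> p0 hb; have sf := mono_symbol k hb.
apply: slice_at_inj => t; rewrite slice_shift_mul //.
have -> : slice (((b x)%:C)%C *: basis_H (j + k) (val x / p)) t =
    (((b x)%:C)%C * (val t == val x / p)%:R) *: zeta R (j + k).
  rewrite -[X in slice X t]addr0 slice_atD /basis_H slice_at_tensor L2_repr_deltaR scalerA.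
  rewrite (_ : slice 0 t = 0) ?addr0 //.
  by have := slice_atD (-1) (0 : H) 0 t; rewrite !scaleN1r !addNr.
case: insubP => [y _ yt|yN]; last first.
  have [tx|_] := eqVneq; last by rewrite mulr0 scale0r.
  by move: yN; rewrite tx mulrC divfK // (valP x).
rewrite /basis_H slice_at_tensor L2_repr_deltaR.
have -> : (val y == val x) = (val t == val x / p).
  by rewrite yt mulrC; apply/eqP/eqP => [<-|->]; rewrite ?mulfK // divfK.
case: eqVneq => [tx|_]; last first.
  have := mul_op_linear (mu := haar R) (sf.1 y) (M := projT1 (cid sf.2)).
  move=> /(_ (fun l => projT2 (cid sf.2) (l, y))) ml.
  by rewrite !scale0r mulr0 scale0r (lin0 ml).
rewrite scale1r mulr1.
have -> : y = x by apply: val_inj; rewrite yt tx mulrC divfK.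
have [M fM] := sf.2.
rewrite {1}/zeta (mul_op_class (sf.1 x) (fun l => fM (l, x)) (char_sqint R j)) /zeta.
rewrite -[RHS]addr0 -[0 in RHS]L2class0 -(L2classD _ (char_sqint R _) (sqint0 _)).
congr L2class; apply/funext => l; rewrite addr0 /mono /= -mulrA; congr (_ * _).
by rewrite addrC expfzDr // circle_neq0.
Qed.

Lemma total_basis_H : total_family (fun jt : int * I => basis_H jt.1 (val jt.2)).
Proof. exact: (@total_tensor_delta R q _ _ (haar R) _ _ (@total_zeta R)). Qed.

End Shift.

(** * Matrix coefficients of the multiplicative unitary *)

Section Forms.
Context (R : realType) d (X : measurableType d) (mu : {measure set X -> \bar R}).
Context (J : Type) (E : J -> L2 mu) (totE : total_family E).

Definition bounded_form (B : L2 mu -> L2 mu -> R[i]) : Prop :=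
  [/\ forall a u v w, B (a *: u + v) w = a * B u w + B v w,
      forall a u v w, B w (a *: u + v) = conjc a * B w u + B w v
    & exists2 C : R, 0 <= C & forall u v, cabs (B u v) <= C * (norm2 u * norm2 v)].

Lemma linear_form_ext (L : L2 mu -> R[i]) (C : R) :
  (forall a u v, L (a *: u + v) = a * L u + L v) ->
  0 <= C -> (forall u, cabs (L u) <= C * norm2 u) -> (forall j, L (E j) = 0) ->
  forall u, L u = 0.
Proof.
move=> lL C0 LC LE u; apply/eqP; rewrite -cabs_eq0; apply/eqP/le_anti.
rewrite cabs_ge0 andbT; apply/ler_addgt0Pr => e e0; rewrite add0r.
have C1 : 0 < C + 1 by rewrite ltr_wpDl.
have [s hs] := totE u (divr_gt0 e0 C1).
have L0 : L 0 = 0 by have := LC 0; rewrite norm20 mulr0 => h; apply/eqP; rewrite -cabs_eq0 eq_le h cabs_ge0.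
have Ls : L (\sum_(c <- s) c.1 *: E c.2) = 0.
  elim: (s) => [|c s' IH]; first by rewrite big_nil.
  by rewrite big_cons lL LE IH mulr0 addr0.
have -> : L u = L (u - \sum_(c <- s) c.1 *: E c.2).
  by rewrite addrC -scaleN1r lL Ls mulr0 add0r.
apply: le_trans (LC _) _; move: hs; rewrite ltr_pdivlMr // mulrC => hs.
by apply: le_trans (ltW hs); rewrite ler_wpM2r ?norm2_ge0 // lerDl.
Qed.

(** Extension by continuity in the first variable against members of the family, then in the second
    one, where conjugation restores linearity. *)
Lemma form_ext B B' : bounded_form B -> bounded_form B' ->
  (forall i j, B (E i) (E j) = B' (E i) (E j)) -> forall u v, B u v = B' u v.
Proof.
move=> [l1 r1 [C C0 bC]] [l2 r2 [C' C'0 bC']] e u v.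
have cB a b : cabs (a - b) <= cabs a + cabs b :> R.
  by rewrite -[cabs b]cabsN; exact: cabsD.
have h j w : B w (E j) = B' w (E j).
  apply/eqP; rewrite -subr_eq0; apply/eqP.
  apply: (@linear_form_ext (fun w => B w (E j) - B' w (E j)) ((C + C') * norm2 (E j))).
  - by move=> a w1 w2; rewrite l1 l2; ring.
  - by rewrite mulr_ge0 ?norm2_ge0 // addr_ge0.
  - move=> w1; apply: le_trans (cB _ _) _.
    by have := bC w1 (E j); have := bC' w1 (E j); lra.
  - by move=> i; rewrite e subrr.
have : conjc (B u v - B' u v) = 0.
  apply: (@linear_form_ext (fun v => conjc (B u v - B' u v)) ((C + C') * norm2 u)).
  - by move=> a w1 w2; rewrite r1 r2 !(conjcB, conjcD, conjcM) !conjcK; ring.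
  - by rewrite mulr_ge0 ?norm2_ge0 // addr_ge0.
  - move=> w1; rewrite cabsJ; apply: le_trans (cB _ _) _.
    by have := bC u w1; have := bC' u w1; lra.
  - by move=> i; rewrite h subrr conjc0.
by move=> /(congr1 conjc); rewrite conjcK conjc0 => /eqP; rewrite subr_eq0 => /eqP.
Qed.

Lemma inner_form T : bounded_op T -> bounded_form (fun u v => inner (T u) v).
Proof.
move=> bT; have [C C0 hC] := bounded_pos bT; split.
- by move=> a u v w; rewrite (proj1 bT) innerDl.
- by move=> a u v w; rewrite innerAr innerZr.
- exists C; [exact: ltW|move=> u v].
  apply: le_trans (cauchy_schwarz _ _) _; rewrite mulrA.
  by apply: ler_wpM2r; rewrite ?norm2_ge0.
Qed.

End Forms.

Section HasSum.
Context (R : realType) d (X : measurableType d) (mu : {measure set X -> \bar R}).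

(** All partial sums over finite sets containing [i0] have the same inner product with [u]. The test
    on [P i0] covers an index that is outside the range of summation. *)
Lemma has_sum_inner (I : choiceType) (P : set I) (F : I -> L2 mu) (v u : L2 mu) (i0 : I) :
  has_sum P F v -> (forall i, i <> i0 -> inner (F i) u = 0) ->
  inner v u = if `[< P i0 >] then inner (F i0) u else 0.
Proof.
move=> hs h0; set c := (if _ then _ else _).
apply/eqP; rewrite -subr_eq0 -cabs_eq0; apply/eqP/le_anti; rewrite cabs_ge0 andbT.
apply/ler_addgt0Pr => e e0; rewrite add0r.
have n1 : 0 < norm2 u + 1 by rewrite ltr_wpDl ?norm2_ge0.
have [J JP hJ] := hs _ (divr_gt0 e0 n1).
have sum_in (s : seq I) : uniq s -> i0 \in s -> \sum_(i <- s) inner (F i) u = inner (F i0) u.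
  move=> us i0s; rewrite (bigD1_seq i0) //= big1 ?addr0 // => i /eqP; exact: h0.
have sum_out (s : seq I) : i0 \notin s -> \sum_(i <- s) inner (F i) u = 0.
  move=> i0s; rewrite big_seq big1 // => i iin; apply: h0 => e1.
  by move: i0s; rewrite -e1 iin.
have [J' [J1 J2 JE]] : exists J' : {fset I}, [/\ [set` J] `<=` [set` J'], [set` J'] `<=` P
    & inner (\sum_(i <- enum_fset J') F i) u = c].
  rewrite /c; case: asboolP => Pi0.
    exists (i0 |` J)%fset; split.
    - by move=> i /=; rewrite in_fset1U orbC => ->.
    - by move=> i /=; rewrite in_fset1U => /orP[/eqP->//|]; exact: JP.
    - by rewrite inner_suml sum_in // ?fset_uniq // in_fset1U eqxx.
  exists J; split=> //; rewrite inner_suml sum_out //.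
  by apply/negP => i0J; apply: Pi0; exact: JP.
rewrite -JE -innerBl; apply: le_trans (cauchy_schwarz _ _) _.
have := hJ _ J1 J2; rewrite norm2B ltr_pdivlMr // => h.
by apply: le_trans (ltW h); rewrite ler_wpM2l ?norm2_ge0 // lerDl.
Qed.

End HasSum.

Section Coefficients.
Variables (R : realType) (q : R) (q01 : 0 < q < 1).
Local Notation I := (Iq q).
Local Notation K := (L2 (mu_K q)).
Local Notation KK := (L2 (prod_measure (mu_K q) (mu_K q))).

Lemma inner_deltaR (p : R) (t : I) : inner (delta q p) (delta q (val t)) = (p == val t)%:R.
Proof.
have [[s <-]|h] := pselect (exists s : I, val s = p).
  by rewrite inner_delta (inj_eq val_inj).
rewrite delta_out ?inner0l; last first.
  by move=> /mem_set hp; apply: h; exists (exist (fun x : R => x \in Iq_set q) p hp : I).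
by case: eqP => // e; case: h; exists t.
Qed.

Lemma inner_fbasis m n (p t : R) (p' t' : I) :
  inner (fbasis q m p t) (fbasis q n (val p') (val t')) =
  [&& m == n, p == val p' & t == val t']%:R.
Proof.
rewrite /fbasis inner_tensor inner_tensor inner_zeta !inner_deltaR.
by do 3 case: eqP => _ /=; rewrite ?mulr1 ?mulr0 ?mul0r.
Qed.

Lemma norm2_fbasis m (p t : I) : norm2 (fbasis q m (val p) (val t)) = 1.
Proof. by rewrite /norm2 inner_fbasis !eqxx sqrtr1. Qed.

Lemma total_fbasis : total_family (fun j : int * I * I =>
  fbasis q j.1.1 (val j.1.2) (val j.2)).
Proof. exact: (@total_tensor_delta R q _ _ (mu_H q) _ _ (@total_basis_H R q)). Qed.

Variable W : KK -> KK.
Hypothesis hW : multiplicative_unitary W.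
Local Notation V := (adjoint_op W).

Definition W_coef (p1 p2 t2 y z w : R) : R := `|t2 / y| * afun q t2 p1 y * afun q p2 z w.

(** In the double sum defining the image of a basis vector, only the term of index (y, z) can fail
    to be orthogonal to the second vector. *)
Lemma inner_W m1 m2 n1 n2 (p1 t1 p2 t2 y z w t1' : I) :
  inner (V (tensor (fbasis q m1 (val p1) (val t1)) (fbasis q m2 (val p2) (val t2))))
    (tensor (fbasis q n1 (val z) (val t1')) (fbasis q n2 (val w) (val y))) =
  ((W_coef (val p1) (val p2) (val t2) (val y) (val z) (val w))%:C)%C *
  [&& m1 + m2 - n2 == n1, t1 == t1', n2 == chi q (val p1 * val p2 / (val t2 * val z))
    & W_point q m2 (val p1) (val p2) (val t2) (val y) (val z) == val w]%:R.
Proof.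
have [_ hs] := hW.
have h := hs m1 m2 p1 t1 p2 t2.
have term (yz : I * I) :
  inner (W_term q m1 m2 (val p1) (val t1) (val p2) (val t2) (val yz.1) (val yz.2))
    (tensor (fbasis q n1 (val z) (val t1')) (fbasis q n2 (val w) (val y))) =
  (let c := chi q (val p1 * val p2 / (val t2 * val yz.2)) in
   let w' := W_point q m2 (val p1) (val p2) (val t2) (val yz.1) (val yz.2) in
   ((W_coef (val p1) (val p2) (val t2) (val yz.1) (val yz.2) w')%:C)%C *
   ([&& m1 + m2 - c == n1, val yz.2 == val z & val t1 == val t1']%:R *
    [&& c == n2, w' == val w & val yz.1 == val y]%:R)).
  rewrite /W_term /= innerZl; congr (_ * _).
  by rewrite (inner_tensor (mu := mu_K q) (nu := mu_K q)); congr (_ * _); exact: inner_fbasis.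
rewrite (has_sum_inner (i0 := (y, z)) h) => [|[y' z'] yz]; last first.
  rewrite term /=; have [zz|_] := eqVneq (val z') (val z); last by rewrite andbF mul0r mulr0.
  have [yy|_] := eqVneq (val y') (val y); last by rewrite !andbF !mulr0.
  by case: yz; rewrite (val_inj zz) (val_inj yy).
have -> : (t1 == t1') = (val t1 == val t1') by rewrite (inj_eq val_inj).
rewrite term /= !eqxx /= !andbT.
set c := chi q _; set w' := W_point _ _ _ _ _ _ _.
case: asboolP => P0.
  have [cn|_] := eqVneq c n2; last by rewrite eq_sym /= !(mulr0, andbF).
  rewrite cn /=; have [->|_] := eqVneq w' (val w); last by rewrite !(mulr0, andbF).
  by rewrite mulr1 andbT.
have [e|_] := eqVneq w' (val w); last by rewrite !(mulr0, andbF).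
by case: P0; rewrite -/w' e; apply/set_mem/valP.
Qed.

End Coefficients.

(** * Bessel's inequality and bounds on the coefficients *)

Section Bessel.
Context (R : realType) d (X : measurableType d) (mu : {measure set X -> \bar R}).

(** Cauchy-Schwarz for [v] against its projection [w] on the span of [g] and [h]: both <v,w> and
    |w|^2 equal the left-hand side. *)
Lemma bessel2 (v g h : L2 mu) : norm2 g = 1 -> norm2 h = 1 -> inner g h = 0 ->
  cabs (inner v g) ^+ 2 + cabs (inner v h) ^+ 2 <= norm2 v ^+ 2.
Proof.
move=> g1 h1 gh; pose a := inner v g; pose b := inner v h.
pose w := a *: g + b *: h.
have gg : inner g g = 1 by rewrite norm2_sqr g1 expr1n.
have hh : inner h h = 1 by rewrite norm2_sqr h1 expr1n.
have hg : inner h g = 0 by rewrite innerC gh conjc0.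
set S := _ + _.
have S0 : 0 <= S by rewrite addr_ge0 ?sqr_ge0.
have SE : ((S%:C)%C : R[i]) = a * conjc a + b * conjc b.
  by rewrite /S !sqr_cabs rmorphD /= !abs2E.
have vw : inner v w = (S%:C)%C.
  by rewrite /w innerAr !innerZr SE /a /b; ring.
have ww : norm2 w ^+ 2 = S.
  apply: (@complexI R); rewrite -norm2_sqr {2}/w innerAr !innerZr /w !innerDl !innerZl.
  by rewrite gg hh gh hg SE; ring.
have := cauchy_schwarz v w; rewrite vw cabs_real ger0_norm // => h2.
have : S ^+ 2 <= norm2 v ^+ 2 * S.
  by rewrite -{2}ww -exprMn lerXn2r // nnegrE mulr_ge0 // norm2_ge0.
have [->|Sn] := eqVneq S 0; first by rewrite sqr_ge0.
by rewrite expr2 ler_pM2r // lt_neqAle eq_sym Sn.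
Qed.

End Bessel.

Section CoefficientBounds.
Variables (R : realType) (q : R) (q01 : 0 < q < 1).
Local Notation I := (Iq q).
Local Notation K := (L2 (mu_K q)).
Local Notation KK := (L2 (prod_measure (mu_K q) (mu_K q))).
Local Notation qel := (qelt q).

Lemma Iq_qel (x : I) : exists s k, val x = qel s k /\ (s -> 0 < k).
Proof. by apply/(Iq_setP q01)/set_mem/valP. Qed.

Definition Iq_of s k (h : Iq_set q (qel s k)) : I :=
  exist (fun x : R => x \in Iq_set q) _ (mem_set h).

Lemma Iq_pos k : Iq_set q (qel false k).
Proof. by apply/(Iq_setP q01); exists false, k. Qed.

Lemma sign_inj (a b : bool) : (-1) ^+ a = (-1) ^+ b :> R -> a = b.
Proof. by case: a b => [] [] //=; rewrite expr1 expr0 => h; exfalso; lra. Qed.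

Lemma exprn_lt_eventually (e : R) : 0 < e -> exists n : nat, forall m, (n <= m)%N -> q ^+ m < e.
Proof.
move=> e0; have /andP[q0 q1] := q01.
have /cvgrPdist_lt/(_ _ e0)[n _ hn] : q ^+ m @[m --> \oo] --> (0 : R).
  by apply: cvg_expr; rewrite gtr0_norm.
exists n => m nm; have := hn m nm; rewrite sub0r normrN ger0_norm //.
by rewrite exprn_ge0 // ltW.
Qed.

Variable W : KK -> KK.
Hypothesis hW : multiplicative_unitary W.
Local Notation V := (adjoint_op W).

Lemma norm2_V u : norm2 (V u) = norm2 u.
Proof. by have [_ iV _] := adjoint_unitaryP (proj1 hW); rewrite /norm2 iV. Qed.

(* With p_2 = w = 1 the component z of the image of a basis vector tends to oo with
   m, so the factor a_1(z, 1) tends to 1. *)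
Lemma bessel_test (x t y : I) (m : nat) : exists (F : K) (n2 : int), norm2 F = 1 /\
  (`|val t / val y| * afun q (val t) (val x) (val y) *
     afun q 1 (`|val x / val y| * q ^- m) 1) ^+ 2 <=
  cabs (inner (V (tensor (fbasis q 0 (val x) 1) (fbasis q m 1 (val t))))
   (tensor F (fbasis q n2 1 (val y)))) ^+ 2.
Proof.
have [s [k [xE _]]] := Iq_qel x; have [st [T [tE _]]] := Iq_qel t.
have [sy [Y [yE _]]] := Iq_qel y.
have zE : `|val x / val y| * q ^- m = qel false (k - Y - m%:Z).
  by rewrite xE yE qelV // qelM // norm_qel // exprnN -expfzDr ?qel0 // gt_eqF; case/andP: q01.
have oneE : 1 = qel false 0 by rewrite qel0 expr0z.
have [sg|sg] := eqVneq (Num.sg (val x * val y)) (Num.sg (val t)); last first.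
  exists (fbasis q 0 (val x) (val x)), 0; split; first exact: norm2_fbasis.
  by rewrite (afun_out q sg) mulr0 mul0r expr0n; exact: sqr_ge0.
have s3 : s (+) sy = st.
  move: sg; rewrite xE yE tE qelM // !sg_qel //.
  exact: sign_inj.
pose z : I := Iq_of (Iq_pos (k - Y - m%:Z)).
pose one : I := Iq_of (Iq_pos 0).
pose n2 := chi q (val x * val one / (val t * val z)).
exists (fbasis q (0 + m%:Z - n2) (val z) (val one)), n2; split; first exact: norm2_fbasis.
rewrite zE oneE -[qel false 0]/(val one) -[qel false (_ - _)]/(val z).
rewrite (inner_W hW) !eqxx /=.
have -> : W_point q m (val x) (val one) (val t) (val y) (val z) == val one.
  rewrite /W_point /= -oneE mul1r xE yE tE sg_qel // qelV // !qelM //.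
  rewrite [_ ^+ st](_ : _ = qel st 0) ?qelM //; last exact: qel_sign.
  rewrite -qel0 qelM // oneE; apply/eqP; congr (qel _ _); last by lia.
  by rewrite -s3; case: (s) (sy) => [] [].
by rewrite mulr1 cabs_real real_normK ?num_real.
Qed.

(** The vectors tested for y and for t are orthogonal through their last legs. The accompanying
    coefficients a_1(z,1) tend to 1 with m, so they drop out of Bessel's inequality. *)
Lemma afun_bessel (x t y : I) : y != t ->
  (`|val t / val y| * afun q (val t) (val x) (val y)) ^+ 2 +
  afun q (val t) (val x) (val t) ^+ 2 <= 1.
Proof.
move=> yt; have /andP[q0 q1] := q01.
set u := _ * _; set u' := afun _ _ _ _; rewrite leNgt; apply/negP => S1.
set S := _ + _ in S1.
have nz (a : I) : val a != 0 by have [s [k [-> _]]] := Iq_qel a; exact: qel_neq0.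
(* Chosen so that S (1 - e)^2 > S - 2 e S = (S + 1) / 2 > 1, against Bessel's inequality. *)
pose e := (S - 1) / (4 * S); have S0 : 0 < S by lra.
have e0 : 0 < e by rewrite divr_gt0 ?mulr_gt0 // subr_gt0.
have eS : e * (4 * S) = S - 1 by rewrite /e divfK // gt_eqF // mulr_gt0.
have e1 : e < 1 by nra.
have [r hr] := afun_diag_oo q01 (Iq_pos 0) e0.
have zbig (a : I) : exists n : nat, forall m, (n <= m)%N -> r < `|val x / val a| * q ^- m.
  have xa : 0 < `|val x / val a| by rewrite normr_gt0 mulf_neq0 ?invr_eq0.
  have r1 : 0 < `|r| + 1 by rewrite ltr_wpDl.
  have [n hn] := exprn_lt_eventually (divr_gt0 xa r1).
  exists n => m nm; have := hn m nm; rewrite ltr_pdivlMr // => h.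
  rewrite ltr_pdivlMr ?exprn_gt0 //; apply: le_lt_trans h.
  rewrite mulrC; apply: ler_wpM2l; first by rewrite exprn_ge0 // ltW.
  by apply: le_trans (ler_norm r) _; rewrite lerDl.
have [na hna] := zbig y; have [nb hnb] := zbig t.
pose m := maxn na nb.
have diag (a : I) : r < `|val x / val a| * q ^- m ->
    (1 - e) ^+ 2 <= afun q 1 (`|val x / val a| * q ^- m) 1 ^+ 2.
  have one : qel false 0 = 1 by rewrite qel0 expr0z.
  have zI : Iq_set q (`|val x / val a| * q ^- m).
    have [s [k [xE _]]] := Iq_qel x; have [sy [Y [yE _]]] := Iq_qel a.
    rewrite xE yE qelV // qelM // norm_qel // exprnN -expfzDr ?gt_eqF //.
    by rewrite -qel0; exact: Iq_pos.
  move=> h; have := hr _ zI; rewrite one gtr0_norm; last first.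
    rewrite mulr_gt0 ?normr_gt0 ?mulf_neq0 ?invr_eq0 ?nz // invr_gt0 exprn_gt0 //.
  move=> /(_ h); rewrite ltr_norml => /andP[h1 h2].
  by rewrite lerXn2r // ?nnegrE; lra.
have dy := diag y (hna m (leq_maxl _ _)); have dt := diag t (hnb m (leq_maxr _ _)).
have [F [n2 [F1 hy]]] := bessel_test x t y m.
have [F' [n2' [F'1 ht]]] := bessel_test x t t m.
rewrite divff ?nz // normr1 mul1r in ht.
rewrite -/u exprMn in hy; rewrite -/u' exprMn in ht.
have one : qel false 0 = 1 by rewrite qel0 expr0z.
have n1 n (a : I) : norm2 (fbasis q n 1 (val a)) = 1.
  by rewrite -one -[qel false 0]/(val (Iq_of (Iq_pos 0))) norm2_fbasis.
have n1' n (a : I) : norm2 (fbasis q n (val a) 1) = 1.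
  by rewrite -one -[qel false 0]/(val (Iq_of (Iq_pos 0))) norm2_fbasis.
have ng (G : K) n (a : I) : norm2 G = 1 -> norm2 (tensor G (fbasis q n 1 (val a)) : KK) = 1.
  by move=> G1; rewrite norm2_tensor G1 n1 mulr1.
have og : inner (tensor F (fbasis q n2 1 (val y)) : KK) (tensor F' (fbasis q n2' 1 (val t))) = 0.
  rewrite inner_tensor -one -[qel false 0]/(val (Iq_of (Iq_pos 0))) inner_fbasis.
  have -> : (val y == val t) = false by rewrite (inj_eq val_inj) (negPf yt).
  by rewrite !andbF mulr0.
have nV : norm2 (V (tensor (fbasis q 0 (val x) 1) (fbasis q m 1 (val t)))) = 1.
  rewrite norm2_V; apply: etrans (norm2_tensor _ _) _.
  by apply: etrans (f_equal2 *%R (n1' 0 x) (n1 m%:Z t)) _; exact: mulr1.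
have := bessel2 (V (tensor (fbasis q 0 (val x) 1) (fbasis q m 1 (val t))))
  (ng F n2 y F1) (ng F' n2' t F'1) og.
rewrite nV expr1n => hB.
have hS : S * (1 - e) ^+ 2 <= 1.
  rewrite /S mulrDl; apply: le_trans (le_trans (lerD hy ht) hB).
  exact: lerD (ler_wpM2l (sqr_ge0 u) dy) (ler_wpM2l (sqr_ge0 u') dt).
move: hS eS e0 e1 S1; clear; move: S e => S e; nra.
Qed.

(** One of the two squares in [afun_bessel] is dropped; for y = t any other point of I_q serves as
    the second label. *)
Lemma afun_bound (x t y : I) : `|afun q (val t) (val x) (val y)| <= `|val y / val t|.
Proof.
have nz (a : I) : val a != 0 by have [s [k [-> _]]] := Iq_qel a; exact: qel_neq0.
have [->|yt] := eqVneq y t.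
  rewrite divff // normr1.
  have [y0 y0t] : exists y0 : I, y0 != t.
    have [e|ne] := eqVneq (Iq_of (Iq_pos 0)) t; last by exists (Iq_of (Iq_pos 0)).
    exists (Iq_of (Iq_pos 1)); rewrite -e -(inj_eq val_inj) /=; apply/eqP => /(qel_inj q01)[_].
    by [].
  have := afun_bessel x y0t; set A := afun _ _ _ _; set B := (_ * _) => h.
  rewrite -(@ler_sqr _ _ 1) ?nnegrE // expr1n real_normK ?num_real //.
  have := sqr_ge0 B; lra.
have := afun_bessel x yt; set A := afun _ _ _ _; set B := afun _ _ _ _ => h.
have : (`|val t / val y| * A) ^+ 2 <= 1 by have := sqr_ge0 B; lra.
rewrite -[X in _ <= X](expr1n _ 2) -(real_normK (num_real (_ * _))).
rewrite ler_sqr ?nnegrE // normrM normr_id => h1.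
have ty : 0 < `|val t / val y| by rewrite normr_gt0 mulf_neq0 ?invr_eq0.
by rewrite -[val y / _]invf_div normfV -[leRHS]mul1r ler_pdivlMr // mulrC.
Qed.

(** The diagonal square tends to 1 and leaves no room in [afun_bessel] for the other one. *)
Lemma afun_off (t y : I) (e : R) : y != t -> 0 < e ->
  exists r : R, forall x : I, r < `|val x| -> `|afun q (val t) (val x) (val y)| < e.
Proof.
move=> yt e0.
have nz (a : I) : val a != 0 by have [s [k [-> _]]] := Iq_qel a; exact: qel_neq0.
have ty : 0 < `|val t / val y| by rewrite normr_gt0 mulf_neq0 ?invr_eq0.
set k := `|val t / val y| in ty.
have ek : 0 < e * k by rewrite mulr_gt0.
(* If a_t(x,t) > 1 - dd, the other square is at most 1 - (1 - dd)^2 <= 2 dd <= (e k)^2 / 2; the cap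
   1/2 keeps 1 - dd positive. *)
pose dd := Num.min ((e * k) ^+ 2 / 4) (1 / 2).
have d0 : 0 < dd by rewrite lt_min !divr_gt0 ?exprn_gt0.
have [r hr] := afun_diag_oo q01 (set_mem (valP t)) d0.
exists r => x xr; have := hr _ (set_mem (valP x)) xr.
rewrite ltr_norml => /andP[h1 _].
have := afun_bessel x yt; rewrite -/k; move: h1.
set A := afun _ _ _ _; set B := afun _ _ _ _ => h1 h2.
have d1 : dd <= (e * k) ^+ 2 / 4 by rewrite ge_min lexx.
have d2 : dd <= 1 / 2 by rewrite ge_min lexx orbT.
have : (k * B) ^+ 2 < (e * k) ^+ 2.
  have p : 0 < (e * k) ^+ 2 by rewrite exprn_gt0.
  by move: h1 h2 d1 d2 p d0; clear; nra.
rewrite -(real_normK (num_real (k * B))) ltr_sqr ?nnegrE ?(ltW ek) //.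
by rewrite normrM (gtr0_norm ty) mulrC ltr_pM2r.
Qed.

End CoefficientBounds.

(** * Slices by basis vectors *)

Section BasicSlices.
Variables (R : realType) (q : R) (q01 : 0 < q < 1).
Local Notation I := (Iq q).
Local Notation T := (circle R).
Local Notation H := (L2 (mu_H q)).
Local Notation K := (L2 (mu_K q)).
Local Notation KK := (L2 (prod_measure (mu_K q) (mu_K q))).
Local Notation qel := (qelt q).
Variable W : KK -> KK.
Hypothesis hW : multiplicative_unitary W.
Local Notation V := (adjoint_op W).
Local Notation fb m p t := (fbasis q m (val p) (val t)).

Lemma qel_eq s k s' k' : (qel s k == qel s' k') = (s == s') && (k == k').
Proof.
by apply/eqP/andP => [/(qel_inj q01)[-> ->]|[/eqP-> /eqP->]].
Qed.

Lemma Iq_neq0 (x : I) : val x != 0.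
Proof. by have [s [k [-> _]]] := Iq_qel q01 x; exact: qel_neq0. Qed.

Lemma Iq_lift x : Iq_set q x -> exists z : I, val z = x.
Proof. by move=> /mem_set h; exists (exist (fun x : R => x \in Iq_set q) x h : I). Qed.

Lemma V_linear : linear V.
Proof. by have [] := adjoint_unitaryP (proj1 hW). Qed.

Lemma V_form_bound (f g u u' : K) : cabs (inner (V (tensor u f)) (tensor u' g)) <=
  norm2 f * norm2 g * (norm2 u * norm2 u').
Proof.
apply: le_trans (cauchy_schwarz _ _) _; rewrite (norm2_V hW).
have -> : norm2 f * norm2 g * (norm2 u * norm2 u') =
  norm2 u * norm2 f * (norm2 u' * norm2 g) by ring.
by apply: ler_pM; rewrite ?norm2_ge0 ?norm2_tensor.
Qed.

Lemma V_form (f g : K) : bounded_form (fun u u' => inner (V (tensor u f)) (tensor u' g)).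
Proof.
split.
- by move=> a u v w; rewrite tensorDl V_linear innerDl.
- by move=> a u v w; rewrite tensorDl innerAr innerZr.
- exists (norm2 f * norm2 g); first by rewrite mulr_ge0 ?norm2_ge0.
  exact: V_form_bound.
Qed.

Section Operator.
Variables (t y p w : I) (m : int).

(* W_point m p x t y z = w exactly when z = bshift * x, and then
   chi (x p / (t z)) = m - bdegree *)
Definition bshift : R := Num.sg (val p * val t) * (val w / val y) * q ^ (- m).

Definition bdegree : int := chi q (val t * val w / (val p * val y)).

(** The test confines the formula to shifted points of I_q, where the estimates on a_p hold. *)
Definition bcoef (x : I) : R := if `[< Iq_set q (bshift * val x) >] then
  W_coef q (val x) (val p) (val t) (val y) (bshift * val x) (val w) else 0.

Definition basic_op : H -> H := shift_mul bshift^-1 (mono bcoef bdegree).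

Lemma bshift_qel st T' sy Y sp P sw W' : val t = qel st T' -> val y = qel sy Y ->
  val p = qel sp P -> val w = qel sw W' ->
  bshift = qel (sp (+) st (+) sw (+) sy) (W' - Y - m) /\ bdegree = T' + W' - (P + Y).
Proof.
move=> tE yE pE wE; split.
  rewrite /bshift tE yE pE wE !qelV // !qelM // sg_qel //.
  rewrite [_ ^+ _](_ : _ = qel (sp (+) st) 0); last exact: qel_sign.
  rewrite -(qel0 q (- m)) !qelM //; congr (qel _ _); last by lia.
  by rewrite addbF addbA.
by rewrite /bdegree tE yE pE wE !qelM // qelV // qelM // chi_qel.
Qed.

Lemma bshift_neq0 : bshift != 0.
Proof.
have [st [T' [tE _]]] := Iq_qel q01 t; have [sy [Y [yE _]]] := Iq_qel q01 y.
have [sp [P [pE _]]] := Iq_qel q01 p; have [sw [W' [wE _]]] := Iq_qel q01 w.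
by rewrite (bshift_qel tE yE pE wE).1 qel_neq0.
Qed.

Lemma norm_W_coef p1 p2 t2 y' z w' : `|W_coef q p1 p2 t2 y' z w'| =
  `|t2 / y'| * `|afun q t2 p1 y'| * `|afun q p2 z w'|.
Proof. by rewrite /W_coef; move: (t2 / y') => A; rewrite !normrM normr_id. Qed.

(** This bound keeps the coefficient in [x] and [bcoef_bound2] the one in the shifted point, so that
    y <> t and w <> p each force decay at oo. *)
Lemma bcoef_bound1 (x : I) :
  `|bcoef x| <= `|val t / val y| * `|val w / val p| * `|afun q (val t) (val x) (val y)|.
Proof.
rewrite /bcoef; case: asboolP => [/Iq_lift[z <-]|_]; last first.
  by rewrite normr0 !mulr_ge0.
rewrite norm_W_coef mulrAC.
by apply: ler_wpM2r => //; apply: ler_wpM2l => //; exact: (afun_bound q01 hW z p w).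
Qed.

Lemma bcoef_bound2 (x z : I) : val z = bshift * val x ->
  `|bcoef x| <= `|afun q (val p) (val z) (val w)|.
Proof.
move=> zE; rewrite /bcoef -zE; case: asboolP => [_|h]; last by rewrite normr0.
rewrite norm_W_coef -[leRHS]mul1r; apply: ler_wpM2r => //.
have := afun_bound q01 hW x t y; have yt : 0 < `|val t / val y|.
  by rewrite normr_gt0 mulf_neq0 ?invr_eq0 ?Iq_neq0.
move/(ler_wpM2l (ltW yt)) => /le_trans; apply.
by rewrite -normrM mulrA divfK ?Iq_neq0 // divff ?Iq_neq0 // normr1.
Qed.

Lemma bcoef_bounded : exists M : R, forall x, `|bcoef x| <= M.
Proof.
exists (`|val t / val y| * `|val w / val p| * `|val y / val t|) => x.
apply: le_trans (bcoef_bound1 x) _; apply: ler_wpM2l; first exact: mulr_ge0.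
exact: (afun_bound q01 hW x t y).
Qed.

Lemma basic_op_bounded : bounded_op basic_op.
Proof.
by apply: shift_mul_bounded; [rewrite invr_eq0 bshift_neq0|apply: mono_symbol; exact: bcoef_bounded].
Qed.

(** Both sides are bounded forms, so [inner_W] on basis vectors decides. A value of [n] other than m
    - bdegree only gives the zero form, hence the [basic_op] exhaust the slices by basis vectors up
    to a scalar 0 or 1. *)
Lemma basic_form (n : int) (u u' : K) :
  inner (V (tensor u (fb m p t))) (tensor u' (fb n w y)) =
  (n == m - bdegree)%:R * inner (pi_rep basic_op u) u'.
Proof.
have bA : bounded_op (pi_rep basic_op) by apply: amplify_bounded; exact: basic_op_bounded.
have [i1 i2 [C C0 i3]] := inner_form bA.
have bR : bounded_form (fun u u' => (n == m - bdegree)%:R * inner (pi_rep basic_op u) u').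
  split.
  - by move=> a v v' z; rewrite i1; ring.
  - by move=> a v v' z; rewrite i2; ring.
  - exists C => // v v'; rewrite cabsM; apply: le_trans (i3 v v').
    rewrite -[leRHS]mul1r; apply: ler_wpM2r; first exact: cabs_ge0.
    by case: eqP; rewrite ?cabs1 ?cabs0.
apply: (form_ext (@total_fbasis R q) (V_form _ _) bR) => -[[m1 p1] t1] [[n1 z] t1'] /=.
have [st [T' [tE _]]] := Iq_qel q01 t; have [sy [Y [yE _]]] := Iq_qel q01 y.
have [sp [P [pE _]]] := Iq_qel q01 p; have [sw [W' [wE _]]] := Iq_qel q01 w.
have [s1 [P1 [p1E _]]] := Iq_qel q01 p1; have [sz [Z [zE _]]] := Iq_qel q01 z.
have [cE kE] := bshift_qel tE yE pE wE.
rewrite (inner_W hW).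
have -> : inner (pi_rep basic_op (fb m1 p1 t1)) (fb n1 z t1') =
  ((bcoef p1)%:C)%C * ((m1 + bdegree == n1) && (bshift * val p1 == val z))%:R * (t1 == t1')%:R.
  rewrite /pi_rep /fbasis -/(basis_H q m1 (val p1)) (amplify_tensor _ _ basic_op_bounded).
  rewrite inner_tensor inner_delta /basic_op.
  rewrite (shift_mul_basis _ _ _ _ bcoef_bounded) ?invr_eq0 ?bshift_neq0 // innerZl.
  rewrite /basis_H invrK [val p1 * _]mulrC inner_tensor inner_zeta inner_deltaR.
  by congr (_ * _ * _); do 2 case: eqP => _; rewrite /= ?mulr1 ?mulr0.
have chiE : chi q (val p1 * val p / (val t * val z)) = P1 + P - (T' + Z).
  by rewrite p1E pE tE zE !qelM // qelV // qelM // chi_qel.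
have WpE : W_point q m (val p1) (val p) (val t) (val y) (val z) =
    qel (sp (+) st (+) sy (+) sz (+) s1) (Y + Z - P1 + m).
  rewrite /W_point pE tE yE zE p1E !qelV // !qelM // sg_qel //.
  rewrite [_ ^+ _](_ : _ = qel (sp (+) st) 0); last exact: qel_sign.
  rewrite -(qel0 q m) !qelM //; congr (qel _ _); last by lia.
  by rewrite addbF !addbA.
have cpE : bshift * val p1 = qel (sp (+) st (+) sw (+) sy (+) s1) (W' - Y - m + P1).
  by rewrite cE p1E qelM.
have eqv : (W_point q m (val p1) (val p) (val t) (val y) (val z) == val w) =
    (bshift * val p1 == val z).
  rewrite WpE wE cpE zE !qel_eq; congr (_ && _); last by apply/eqP/eqP; lia.
  by case: (sp) (st) (sw) (sy) (s1) (sz) => [] [] [] [] [] [].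
rewrite eqv chiE; have [cz|_] := eqVneq (bshift * val p1) (val z); last by rewrite !andbF !(mul0r, mulr0).
have eZ : Z = W' - Y - m + P1.
  by move: cz; rewrite cpE zE => /(qel_inj q01)[_ ->].
have -> : bcoef p1 = W_coef q (val p1) (val p) (val t) (val y) (val z) (val w).
  by rewrite /bcoef cz asboolT //; apply/set_mem/valP.
have -> : (n == P1 + P - (T' + Z)) = (n == m - bdegree) by rewrite kE eZ; apply/eqP/eqP; lia.
have [->|_] := eqVneq n (m - bdegree); last by rewrite !(andbF, mulr0, mul0r).
have -> : m1 + m - (m - bdegree) = m1 + bdegree by lia.
by do 2 case: eqP => _; rewrite /= ?(mulr1, mulr0, mul1r).
Qed.

End Operator.
End BasicSlices.

(** * Symbols of basic slices, and approximation of forms *)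

Section Generators.
Variables (R : realType) (q : R) (q01 : 0 < q < 1).
Local Notation I := (Iq q).
Local Notation T := (circle R).
Local Notation H := (L2 (mu_H q)).
Local Notation K := (L2 (mu_K q)).
Local Notation KK := (L2 (prod_measure (mu_K q) (mu_K q))).
Local Notation qel := (qelt q).

Lemma continuous_prod_Iq (f : T * I -> R[i]^o) :
  (forall x : I, continuous (fun l => f (l, x))) -> continuous f.
Proof.
move=> h [l x]; apply/cvg_cplxP => e e0.
have hl := (cvg_cplxP (fun l => f (l, x)) l).1 (h x l) e e0.
exists ([set m | cabs (f (m, x) - f (l, x)) < e], [set x]).
  split=> //=; apply: open_nbhs_nbhs; split=> //; exact: discrete_open.
by move=> [m z] [/= h1 h2]; rewrite h2.
Qed.

Lemma continuous_section_Iq (f : T * I -> R[i]^o) (x : I) : continuous f ->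
  continuous (fun l => f (l, x)).
Proof.
move=> cf l; apply/cvg_cplxP => e e0.
have [[A B] /= [hA hB] sub] := (cvg_cplxP f (l, x)).1 (cf (l, x)) e e0.
apply: filterS hA => m Am; apply: (sub (m, x)); split=> //=.
exact: nbhs_singleton hB.
Qed.

(** A nontrivial character is compatible with a constant limit at oo only if that limit is 0, whence
    the alternative on [k] and [c]. *)
Lemma C_mono (b : I -> R) (k : int) (c : R) :
  (forall e : R, 0 < e -> exists2 r : R, 0 < r & forall x : I, `|val x| < r -> `|b x| < e) ->
  (forall e : R, 0 < e -> exists r : R, forall x : I, r < `|val x| -> `|b x - c| < e) ->
  k = 0 \/ c = 0 -> C_algebra (mono b k).
Proof.
move=> h0 hoo kc; split.
- apply: continuous_prod_Iq => x l; apply/cvg_cplxP => e e0.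
  have e1 : 0 < e / (`|b x| + 1) by rewrite divr_gt0 // ltr_wpDl.
  have := (cvg_cplxP _ l).1 (@continuous_char R k l) _ e1; apply: filterS => m.
  rewrite ltr_pdivlMr ?ltr_wpDl // => h; rewrite /mono /= -mulrBr cabsM cabs_real.
  apply: le_lt_trans h; rewrite mulrC; apply: ler_wpM2l; first exact: cabs_ge0.
  by rewrite lerDl.
- move=> e /h0[r r0 hr]; exists r => // l x /hr.
  by rewrite /mono cabsM cabs_real cabs_char mulr1.
- exists ((c%:C)%C) => e /hoo[r hr]; exists r => l x /hr.
  case: kc => [->|c0]; first by rewrite /mono expr0z mulr1 -rmorphB cabs_real.
  by rewrite c0 !subr0 /mono cabsM cabs_real cabs_char mulr1.
Qed.

Definition gens : set (H -> H) := [set X | exists (f : T * I -> R[i]) (p : R),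
  [/\ C_algebra f, qpowers q p & X = rho p \o mul_op (mu_H q) f]].

Variable W : KK -> KK.
Hypothesis hW : multiplicative_unitary W.
Local Notation V := (adjoint_op W).

Lemma Iq_gt1 (x : I) : 1 < `|val x| -> exists2 k : int, val x = qel false k & k < 0.
Proof.
have [s [k [xE hs]]] := Iq_qel q01 x; rewrite xE norm_qel // -(expr0z q) qz_lt // => k0.
exists k => //; case: s hs {xE} => // hs.
by have := hs isT; lia.
Qed.

Section Basic.
Variables (t y p w : I) (m : int).
Local Notation bs := (bshift t y p w m).
Local Notation bc := (bcoef t y p w m).

Lemma basic_near0 (e : R) : 0 < e -> exists2 r : R, 0 < r &
  forall x : I, `|val x| < r -> `|bc x| < e.
Proof.
move=> e0; set C := `|val t / val y| * `|val w / val p|.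
have C0 : 0 < C by rewrite mulr_gt0 // normr_gt0 mulf_neq0 ?invr_eq0 ?Iq_neq0.
have [r r0 hr] := afun_near0 q01 (set_mem (valP t)) (set_mem (valP y)) (divr_gt0 e0 C0).
exists r => // x /(hr _ (set_mem (valP x))).
rewrite ltr_pdivlMr // mulrC; apply: le_lt_trans; exact: (bcoef_bound1 q01 hW).
Qed.

(** If y <> t, the coefficient in x decays. If w <> p, the one in the shifted point does, since that
    point goes to oo together with x. *)
Lemma basic_oo0 : (y != t) || (w != p) -> forall e : R, 0 < e ->
  exists r : R, forall x : I, r < `|val x| -> `|bc x - 0| < e.
Proof.
move=> /orP[yt|wp] e e0.
  set C := `|val t / val y| * `|val w / val p|.
  have C0 : 0 < C by rewrite mulr_gt0 // normr_gt0 mulf_neq0 ?invr_eq0 ?Iq_neq0.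
  have [r hr] := afun_off q01 hW yt (divr_gt0 e0 C0).
  exists r => x /hr; rewrite ltr_pdivlMr // mulrC subr0; apply: le_lt_trans.
  exact: (bcoef_bound1 q01 hW).
have [r hr] := afun_off q01 hW wp e0.
have b0 : 0 < `|bs| by rewrite normr_gt0 bshift_neq0.
exists (`|r| / `|bs|) => x; rewrite ltr_pdivrMr // => rx; rewrite subr0.
have [/Iq_lift[z zE]|h] := pselect (Iq_set q (bs * val x)).
  apply: le_lt_trans (bcoef_bound2 q01 hW zE) _; apply: hr.
  by rewrite zE normrM mulrC; apply: le_lt_trans rx; exact: ler_norm.
by rewrite /bcoef asboolF // normr0.
Qed.

Lemma basic_oo1 : y = t -> w = p -> (forall e : R, 0 < e ->
  exists r : R, forall x : I, r < `|val x| -> `|bc x - 1| < e) /\ bdegree t y p w = 0.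
Proof.
move=> yt wp.
have [st [T' [tE _]]] := Iq_qel q01 t; have [sp [P [pE _]]] := Iq_qel q01 p.
have yE : val y = qel st T' by rewrite yt.
have wE : val w = qel sp P by rewrite wp.
have [bE kE] := bshift_qel q01 m tE yE pE wE; split; last by rewrite kE; lia.
move=> e e0; have e2 : 0 < e / 2 by lra.
have [r1 hr1] := afun_diag_oo q01 (set_mem (valP t)) e2.
have [r2 hr2] := afun_diag_oo q01 (set_mem (valP p)) e2.
have b0 : 0 < `|bs| by rewrite normr_gt0 bshift_neq0.
(* The summand 1 ensures |x| > 1, hence x > 0. As y = t and w = p, the signs in [bshift] cancel, and
   the shifted point is positive, so it lies in I_q. *)
exists (`|r1| + 1 + `|r2| / `|bs|) => x rx.
have d0 : 0 <= `|r2| / `|bs| by rewrite divr_ge0.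
have x1 : 1 < `|val x| by have := normr_ge0 r1; lra.
have xr1 : r1 < `|val x| by have := ler_norm r1; lra.
have xr2 : r2 < `|bs * val x|.
  rewrite normrM mulrC -ltr_pdivrMr //; apply: le_lt_trans (_ : `|r2| / `|bs| < _).
    by rewrite ler_pM2r ?invr_gt0 // ler_norm.
  by have := normr_ge0 r1; lra.
have [k xE k0] := Iq_gt1 x1.
have bxI : Iq_set q (bs * val x).
  rewrite bE xE qelM //; have -> : sp (+) st (+) sp (+) st (+) false = false.
    by case: (sp) (st) => [] [].
  exact: Iq_pos.
have [z zE] := Iq_lift bxI.
rewrite /bcoef asboolT // -zE /W_coef yt wp divff ?Iq_neq0 // normr1 mul1r.
have h1 := hr1 _ (set_mem (valP x)) xr1; have h2 := hr2 _ bxI xr2; rewrite -zE in h2.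
have h3 : `|afun q (val p) (val z) (val p)| <= 1.
  by apply: le_trans (afun_bound q01 hW z p p) _; rewrite divff ?Iq_neq0 // normr1.
set a := afun _ _ _ _ in h1 *; set b := afun _ _ _ _ in h2 h3 *.
have -> : a * b - 1 = (a - 1) * b + (b - 1) by ring.
apply: le_lt_trans (ler_normD _ _) _; rewrite normrM.
have := ler_wpM2l (normr_ge0 (a - 1)) h3; rewrite mulr1; lra.
Qed.

Lemma basic_C : C_algebra (mono bc (bdegree t y p w)).
Proof.
have [h|h] := boolP ((y != t) || (w != p)).
  by apply: (C_mono basic_near0 (basic_oo0 h)); right.
move: h; rewrite negb_or !negbK => /andP[/eqP yt /eqP wp].
have [h k0] := basic_oo1 yt wp.
by apply: (C_mono basic_near0 h); left.
Qed.

Lemma basic_gens : gens (basic_op t y p w m).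
Proof.
exists (mono bc (bdegree t y p w)), (bs^-1); split; first exact: basic_C.
  apply: (qpowersP q _).2.
  have [st [T' [tE _]]] := Iq_qel q01 t; have [sy [Y [yE _]]] := Iq_qel q01 y.
  have [sp [P [pE _]]] := Iq_qel q01 p; have [sw [W' [wE _]]] := Iq_qel q01 w.
  rewrite (bshift_qel q01 m tE yE pE wE).1 qelV //.
  by do 2 eexists.
by rewrite /basic_op shift_mulE.
Qed.

End Basic.

Lemma op_span0 (G : set (H -> H)) : op_span G (fun=> 0).
Proof.
exists 0%N, (fun=> 0), (fun=> fun=> 0); split; first by case.
by apply/funext => u; rewrite big_ord0.
Qed.

Lemma op_span_gen (G : set (H -> H)) X : G X -> op_span G X.
Proof.
move=> GX; exists 1%N, (fun=> 1), (fun=> X); split=> //.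
by apply/funext => u; rewrite big_ord1 scale1r.
Qed.

Lemma op_span_lin (G : set (H -> H)) (a : R[i]) X Y : op_span G X -> op_span G Y ->
  op_span G (fun u => a *: X u + Y u).
Proof.
move=> [n [c [F [hF ->]]]] [n' [c' [F' [hF' ->]]]].
exists (n + n')%N, (fun k => match fintype.split k with inl i => a * c i | inr j => c' j end),
  (fun k => match fintype.split k with inl i => F i | inr j => F' j end).
split; first by move=> k; case: (fintype.split k).
apply/funext => u; rewrite big_split_ord /= scaler_sumr; congr (_ + _).
  apply: eq_bigr => i _; have := unsplitK (inl i : 'I_n + 'I_n'); rewrite /unsplit /= => ->.
  by rewrite scalerA.
by apply: eq_bigr => i _; have := unsplitK (inr i : 'I_n + 'I_n'); rewrite /unsplit /= => ->.
Qed.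

(** Forms rather than operators are approximated: slices are known through their matrix
    coefficients, and limits can be taken without first producing an operator. *)
Definition approx_form (B : H -> H -> R[i]) : Prop := forall e : R, 0 < e ->
  exists2 X, op_span gens X & forall v v', cabs (B v v' - inner (X v) v') <= e * (norm2 v * norm2 v').

Lemma approx_form0 : approx_form (fun _ _ => 0).
Proof.
move=> e e0; exists (fun=> 0); first exact: op_span0.
by move=> v v'; rewrite inner0l subr0 cabs0 mulr_ge0 ?(ltW e0) // mulr_ge0 ?norm2_ge0.
Qed.

Lemma approx_form_lin (a : R[i]) B B' : approx_form B -> approx_form B' ->
  approx_form (fun v v' => a * B v v' + B' v v').
Proof.
move=> hB hB' e e0; have a0 : 0 < cabs a + 1 by rewrite ltr_wpDl // cabs_ge0.
have e2 : 0 < e / 2 by lra.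
have [X sX hX] := hB _ (divr_gt0 e2 a0); have [Y sY hY] := hB' _ e2.
exists (fun u => a *: X u + Y u); first exact: op_span_lin.
move=> v v'; rewrite innerDl.
have -> : a * B v v' + B' v v' - (a * inner (X v) v' + inner (Y v) v') =
  a * (B v v' - inner (X v) v') + (B' v v' - inner (Y v) v') by ring.
apply: le_trans (cabsD _ _) _; rewrite cabsM.
have N0 : 0 <= norm2 v * norm2 v' by rewrite mulr_ge0 ?norm2_ge0.
move: (hX v v') (hY v v') N0; move: (norm2 v * norm2 v') => N hXv hYv N0.
rewrite [e]splitr mulrDl; apply: lerD => //.
apply: le_trans (ler_wpM2l (cabs_ge0 a) hXv) _.
rewrite mulrA; apply: ler_wpM2r => //.
rewrite mulrA ler_pdivrMr // mulrC; apply: ler_wpM2l; first exact: ltW.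
by rewrite lerDl.
Qed.

Lemma approx_form_closed B : (forall e : R, 0 < e -> exists2 B', approx_form B' &
    forall v v', cabs (B v v' - B' v v') <= e * (norm2 v * norm2 v')) -> approx_form B.
Proof.
move=> h e e0; have e2 : 0 < e / 2 by lra.
have [B' hB' hBB] := h _ e2; have [X sX hX] := hB' _ e2.
exists X => // v v'; rewrite -[B v v'](subrK (B' v v')) -addrA.
apply: le_trans (cabsD _ _) _; rewrite [e]splitr mulrDl.
exact: lerD.
Qed.

End Generators.

Lemma series_single (F : numFieldType) (E : normedModType F) (f : nat -> E) :
  (forall n, f n.+1 = 0) -> series f @ \oo --> f 0%N.
Proof.
move=> f0; apply: cvg_near_cst; exists 1%N => // n /= n1.
by rewrite /series /= -(prednK n1) big_nat_recl // big1 ?addr0.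
Qed.

Lemma series_block_lt (R : realType) (a : nat -> R) (e : R) : cvgn (series a) -> 0 < e ->
  exists N : nat, forall n m, (N <= n)%N -> (n <= m)%N -> \sum_(n <= k < m) a k < e.
Proof.
move=> /cvgrPdist_lt ca e0; have e2 : 0 < e / 2 by lra.
have [N _ hN] := ca _ e2; exists N => n m Nn nm.
have h1 := hN n Nn; have h2 := hN m (leq_trans Nn nm).
have : series a m = series a n + \sum_(n <= k < m) a k.
  by rewrite /series /= (big_cat_nat (leq0n n) nm).
move: h1 h2; rewrite /= !ltr_norml => /andP[? ?] /andP[? ?]; lra.
Qed.

(** Provides the operators on the second leg that [is_slice] demands, as the contraction by u' of V
    (u (x) v). *)
Lemma slice_operator (R : realType) d1 d2 (X : measurableType d1) (Y : measurableType d2)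
    (mu : {sigma_finite_measure set X -> \bar R}) (nu : {sigma_finite_measure set Y -> \bar R})
    (V : L2 (prod_measure mu nu) -> L2 (prod_measure mu nu)) (u u' : L2 mu) :
  linear V -> (forall F, norm2 (V F) = norm2 F) ->
  exists S : L2 nu -> L2 nu, bounded_op S /\
    forall v v', inner (S v) v' = inner (V (tensor u v)) (tensor u' v').
Proof.
move=> lV nV; exists (fun v => contract u' (V (tensor u v))); split; last first.
  by move=> v v'; exact: inner_contract.
split=> [a v v'|].
  have e1 := tensorDr a u v v'.
  have e2 := congr1 V e1.
  have e3 := etrans e2 (lV a (tensor u v) (tensor u v')).
  have e4 := congr1 (contract u') e3.
  have e5 := contract_linear u' a (V (tensor u v)) (V (tensor u v')).
  exact: (etrans e4 e5).
exists (norm2 u' * norm2 u) => v; apply: le_trans (norm2_contract _ _) _.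
by rewrite nV norm2_tensor mulrA.
Qed.

(** * Slices by normal functionals *)

Section Slices.
Variables (R : realType) (q : R) (q01 : 0 < q < 1).
Local Notation I := (Iq q).
Local Notation T := (circle R).
Local Notation H := (L2 (mu_H q)).
Local Notation K := (L2 (mu_K q)).
Local Notation KK := (L2 (prod_measure (mu_K q) (mu_K q))).
Variable W : KK -> KK.
Hypothesis hW : multiplicative_unitary W.
Local Notation V := (adjoint_op W).
Local Notation fb m p t := (fbasis q m (val p) (val t)).
Local Notation approx := (@approx_form R q).

Lemma V_tensorDr (u : K) (a : R[i]) (x y : K) :
  V (tensor u (a *: x + y)) = a *: V (tensor u x) + V (tensor u y).
Proof. exact: etrans (congr1 V (tensorDr a u x y)) (V_linear hW a _ _). Qed.

(** A vector functional is normal with sequences that vanish after index 0. The second label is m -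
    bdegree, the one for which [basic_form] is not zero. *)
Lemma basic_slice (t y p w : I) (m : int) : W_slices W (pi_rep (basic_op t y p w m)).
Proof.
pose xi (n : nat) : K := if n is 0%N then fb m p t else 0.
pose eta (n : nat) : K := if n is 0%N then fb (m - bdegree t y p w) w y else 0.
exists (fun T' => inner (T' (fb m p t)) (fb (m - bdegree t y p w) w y)).
  exists xi, eta; split.
  - apply/cvg_ex; exists (norm2 (xi 0%N) ^+ 2).
    by apply: (@series_single R R^o) => n /=; rewrite norm20 expr0n.
  - apply/cvg_ex; exists (norm2 (eta 0%N) ^+ 2).
    by apply: (@series_single R R^o) => n /=; rewrite norm20 expr0n.
  - move=> T' [lT' _].
    apply: (@series_single _ (R[i]^o) (fun n => inner (T' (xi n)) (eta n))) => n.
    by rewrite /= inner0r.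
have bA : bounded_op (pi_rep (basic_op t y p w m)).
  exact: (@amplify_bounded R q _ _ (mu_H q) _ (basic_op_bounded q01 hW t y p w m)).
rewrite /is_slice; split; first exact: bA.
move=> u u'.
have [S [bS hS]] := slice_operator u u' (V_linear hW) (norm2_V hW).
exists S; split=> //; rewrite hS.
by have := basic_form q01 hW t y p w m (m - bdegree t y p w) u u'; rewrite eqxx mul1r => ->.
Qed.

(** An isometry of H into K for which [inner (pi_rep X (emb v)) (emb v')] equals [inner (X v) v'];
    estimates on K return to H through it. *)
Definition emb (v : H) : K := tensor v (delta q (val (point : I))).

Lemma norm2_emb v : norm2 (emb v) = norm2 v.
Proof. by rewrite /emb norm2_tensor norm2_delta mulr1. Qed.

Definition slice_form (xi eta : K) (v v' : H) : R[i] :=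
  inner (V (tensor (emb v) xi)) (tensor (emb v') eta).

Lemma slice_form_bound xi eta v v' :
  cabs (slice_form xi eta v v') <= norm2 xi * norm2 eta * (norm2 v * norm2 v').
Proof. by rewrite -(norm2_emb v) -(norm2_emb v'); exact: V_form_bound. Qed.

Lemma slice_formDl a x x' eta v v' : slice_form (a *: x + x') eta v v' =
  a * slice_form x eta v v' + slice_form x' eta v v'.
Proof. by rewrite /slice_form V_tensorDr innerDl. Qed.

Lemma slice_formDr a x x' xi v v' : slice_form xi (a *: x + x') v v' =
  conjc a * slice_form xi x v v' + slice_form xi x' v v'.
Proof. by rewrite /slice_form tensorDr innerAr innerZr. Qed.

Lemma approx_ext B B' : (forall v v', B v v' = B' v v') -> approx B -> approx B'.
Proof.
move=> h hB e /hB[X sX hX]; exists X => // v v'; rewrite -h; exact: hX.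
Qed.

Lemma approx_basis (t y p w : I) (m n : int) : approx (slice_form (fb m p t) (fb n w y)).
Proof.
have hX : approx (fun v v' => inner (basic_op t y p w m v) v').
  move=> e e0; exists (basic_op t y p w m).
    by apply: op_span_gen; exact: (basic_gens q01 hW).
  by move=> v v'; rewrite subrr cabs0 mulr_ge0 ?(ltW e0) // mulr_ge0 ?norm2_ge0.
apply: approx_ext (approx_form_lin (n == m - bdegree t y p w)%:R hX (@approx_form0 R q)).
move=> v v'; rewrite addr0 /slice_form (basic_form q01 hW); congr (_ * _).
rewrite /emb /pi_rep (amplify_tensor _ _ (basic_op_bounded q01 hW t y p w m)).
by rewrite inner_tensor inner_delta eqxx mulr1.
Qed.

Lemma approx_slice_form xi eta : approx (slice_form xi eta).
Proof.
(* A density argument for one variable: additivity, homogeneity up to a function [s] of the scalar,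
   and a bound. It is used with the identity in [xi], then with conjugation in [eta]. *)
have key (F : K -> H -> H -> R[i]) (s : R[i] -> R[i]) (C : R) : 0 <= C ->
  (forall a x x' v v', F (a *: x + x') v v' = s a * F x v v' + F x' v v') ->
  (forall x v v', cabs (F x v v') <= C * norm2 x * (norm2 v * norm2 v')) ->
  (forall m (p t : I), approx (F (fb m p t))) -> forall x, approx (F x).
  move=> C0 lF bF hF x; apply: approx_form_closed => e e0.
  have C1 : 0 < C + 1 by rewrite ltr_wpDl.
  have [l hl] := @total_fbasis R q x _ (divr_gt0 e0 C1).
  set z := \sum_(c <- l) _ in hl.
  have F0 v v' : F 0 v v' = 0.
    by apply/eqP; rewrite -cabs_eq0 eq_le cabs_ge0 andbT; have := bF 0 v v'; rewrite norm20 mulr0 mul0r.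
  exists (F z).
    rewrite /z; elim: (l) => [|c l' IH].
      by rewrite big_nil; apply: approx_ext (@approx_form0 R q) => v v'; rewrite F0.
    rewrite big_cons; apply: approx_ext (approx_form_lin (s c.1) (hF c.2.1.1 c.2.1.2 c.2.2) IH).
    by move=> v v'; rewrite lF.
  move=> v v'; have -> : F x v v' - F z v v' = F (x - z) v v'.
    have := lF 1 (x - z) z v v'; rewrite scale1r subrK => ->.
    have s1 : s 1 * F (x - z) v v' = F (x - z) v v'.
      by have := lF 1 (x - z) 0 v v'; rewrite scale1r addr0 F0 addr0.
    by rewrite s1 addrK.
  apply: le_trans (bF _ _ _) _; apply: ler_wpM2r; first by rewrite mulr_ge0 ?norm2_ge0.
  move: hl; rewrite ltr_pdivlMr // mulrC => hl; apply: le_trans (ltW hl).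
  by apply: ler_wpM2r; rewrite ?norm2_ge0 // lerDl.
have h1 (n : int) (w y : I) x : approx (slice_form x (fb n w y)).
  apply: (key (fun x => slice_form x (fb n w y)) id (norm2 (fb n w y))).
  - exact: norm2_ge0.
  - by move=> a x1 x2 v v'; rewrite slice_formDl.
  - by move=> x1 v v'; rewrite [_ * norm2 x1]mulrC; exact: slice_form_bound.
  - by move=> m p t; exact: approx_basis.
apply: (key (slice_form xi) conjc (norm2 xi)).
- exact: norm2_ge0.
- by move=> a x1 x2 v v'; rewrite slice_formDr.
- by move=> x1 v v'; exact: slice_form_bound.
- by move=> m p t; exact: h1.
Qed.

(** The operator T' depends on v and v', but the tail of the functional does not: it is bounded by
    half the sum of the tails of |xi_n|^2 and |eta_n|^2, times |v| |v'|. Truncation is therefore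
    uniform. *)
Lemma approx_slice S : W_slices W S -> approx (fun v v' => inner (S (emb v)) (emb v')).
Proof.
move=> [w [xi [eta [cxi ceta hw]]] [bS hS]].
apply: approx_form_closed => e e0.
have [N1 h1] := series_block_lt cxi e0; have [N2 h2] := series_block_lt ceta e0.
pose N := maxn N1 N2.
exists (fun v v' => \sum_(0 <= n < N) slice_form (xi n) (eta n) v v').
  elim: (N) => [|k IH].
    by apply: approx_ext (@approx_form0 R q) => v v'; rewrite big_geq.
  apply: approx_ext (approx_form_lin 1 (approx_slice_form (xi k) (eta k)) IH).
  by move=> v v'; rewrite big_nat_recr //= mul1r addrC.
move=> v v'; have [T' [bT' hT' ->]] := hS (emb v) (emb v').
have /cvgrPdist_lt hc := hw T' bT'.
have N0 : 0 <= norm2 v * norm2 v' by rewrite mulr_ge0 ?norm2_ge0.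
apply/ler_addgt0Pr => d d0.
have d0' : 0 < ((d%:C)%C : R[i]) by rewrite ltcR.
have [M _ hM] := hc _ d0'.
pose m := maxn N M; have := hM m (leq_maxr _ _).
rewrite cabsE ltcR => hm.
have Nm : (N <= m)%N := leq_maxl _ _.
have sE : series (fun n => inner (T' (xi n)) (eta n) : R[i]^o) m =
    \sum_(0 <= n < N) slice_form (xi n) (eta n) v v' +
    \sum_(N <= n < m) slice_form (xi n) (eta n) v v'.
  rewrite -(big_cat_nat (leq0n N) Nm) /series /=.
  by apply: eq_bigr => n _; rewrite hT'.
rewrite sE in hm; set A := \sum_(0 <= n < N) _ in hm *; set B := \sum_(N <= n < m) _ in hm.
have -> : w T' - A = (w T' - (A + B)) + B by ring.
apply: le_trans (cabsD _ _) _; rewrite addrC; apply: lerD; last exact: ltW.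
apply: le_trans (cabs_sum _ _ _) _.
apply: (@le_trans _ _ ((2^-1 * \sum_(N <= n < m) norm2 (xi n) ^+ 2 +
    2^-1 * \sum_(N <= n < m) norm2 (eta n) ^+ 2) * (norm2 v * norm2 v'))).
  rewrite !mulr_sumr -big_split mulr_suml /=; apply: ler_sum => n _.
  apply: le_trans (slice_form_bound _ _ _ _) _; apply: ler_wpM2r => //.
  by have := sqr_ge0 (norm2 (xi n) - norm2 (eta n)); rewrite sqrrB; lra.
apply: ler_wpM2r => //.
have := h1 N m (leq_maxl _ _) Nm; have := h2 N m (leq_maxr _ _) Nm; lra.
Qed.

(** Compression by [emb] carries the approximation from K to H, and [norm2_le_inner] turns closeness
    of forms into closeness in operator norm. *)
Lemma closure_of_slices (X : H -> H) : bounded_op X ->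
  op_closure (W_slices W) (pi_rep X) -> op_closure (op_span (@gens R q)) X.
Proof.
move=> bX [_ hX]; split=> // e e0.
have aX : approx (fun v v' => inner (X v) v').
  apply: approx_form_closed => d d0; have [S sS hS] := hX d d0.
  exists (fun v v' => inner (S (emb v)) (emb v')); first exact: approx_slice.
  move=> v v'; have -> : inner (X v) v' = inner (pi_rep X (emb v)) (emb v').
    by rewrite /pi_rep /emb (amplify_tensor _ _ bX) inner_tensor inner_delta eqxx mulr1.
  rewrite -innerBl; apply: le_trans (cauchy_schwarz _ _) _.
  rewrite mulrA -(norm2_emb v') -(norm2_emb v); apply: ler_wpM2r; first exact: norm2_ge0.
  exact: hS.
have [Y sY hY] := aX e e0; exists Y => // v.
apply: norm2_le_inner; first by rewrite mulr_ge0 ?norm2_ge0 // ltW.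
by move=> v'; rewrite innerBl -mulrA; exact: hY.
Qed.

End Slices.

(** * Generators of the reduced C*-algebra *)

Section Generation.
Variables (R : realType) (q : R) (q01 : 0 < q < 1).
Local Notation I := (Iq q).
Local Notation T := (circle R).
Local Notation H := (L2 (mu_H q)).
Local Notation K := (L2 (mu_K q)).
Local Notation KK := (L2 (prod_measure (mu_K q) (mu_K q))).
Local Notation qel := (qelt q).

(** I_q accumulates only at 0 and at oo, so limits at these two ends control a function outside a
    finite set of points. *)
Lemma Iq_band (r0 r1 : R) : 0 < r0 ->
  exists E : seq I, forall x : I, r0 <= `|val x| -> `|val x| <= r1 -> x \in E.
Proof.
move=> r00; have /andP[q0 q1] := q01.
have [n0 h0] := exprn_lt_eventually q01 r00.
have r10 : 0 < `|r1| + 1 by rewrite ltr_wpDl.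
have ri : 0 < (`|r1| + 1)^-1 by rewrite invr_gt0.
have [n1 h1] := exprn_lt_eventually q01 ri.
pose f (d : bool * nat) : option I := insub (qel d.1 (d.2%:Z - n1%:Z)).
exists (pmap f [seq (s, k) | s <- [:: true; false], k <- iota 0 (n0 + n1)]) => x xr0 xr1.
have [s [k [xE _]]] := Iq_qel q01 x.
rewrite xE norm_qel // in xr0 xr1.
have k0 : k < n0.
  rewrite -(@qz_lt R q q01); apply: lt_le_trans xr0; exact: h0.
have k1 : - n1%:Z < k.
  rewrite -(@qz_lt R q q01) -invr_expz; apply: le_lt_trans xr1 _.
  have h : r1 < `|r1| + 1 by have := ler_norm r1; lra.
  apply: lt_trans h _; rewrite -[ltLHS]invrK ltf_pV2 ?posrE ?exprz_gt0 //.
  exact: h1.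
rewrite mem_pmap; apply/mapP; exists (s, absz (k + n1%:Z)).
  apply/allpairsP; exists (s, absz (k + n1%:Z)); split=> //=; first by case: (s).
  by rewrite mem_iota; lia.
rewrite /f /= (_ : (absz (k + n1%:Z))%:Z - n1%:Z = k); last by lia.
by rewrite -xE valK.
Qed.

Variable W : KK -> KK.
Hypothesis hW : multiplicative_unitary W.
Variable A : set (H -> H).
Hypothesis hA : reduced_cstar_algebra W A.

Lemma algebra_bounded X : A X -> bounded_op X.
Proof. by have [_ [[h _] _ _ _ _] _] := hA; exact: h. Qed.

Lemma algebra0 : A (fun=> 0).
Proof. by have [_ [[_ h] _ _ _ _] _] := hA. Qed.

Lemma algebra_lin (a : R[i]) X Y : A X -> A Y -> A (fun u => a *: X u + Y u).
Proof. by have [_ [_ h _ _ _] _] := hA; exact: h. Qed.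

Lemma algebra_comp X Y : A X -> A Y -> A (X \o Y).
Proof. by have [_ [_ _ h _ _] _] := hA; exact: h. Qed.

Lemma algebra_closed X : bounded_op X -> (forall e : R, 0 < e ->
  exists2 Y, A Y & forall u, norm2 (X u - Y u) <= e * norm2 u) -> A X.
Proof. by have [_ [_ _ _ _ h] _] := hA => bX hX; apply: h. Qed.

Lemma algebra_sum (J : eqType) (s : seq J) (a : J -> R[i]) (F : J -> H -> H) :
  (forall j, j \in s -> A (F j)) -> A (fun u => \sum_(j <- s) a j *: F j u).
Proof.
elim: s => [|j s IH] h.
  by rewrite (_ : (fun u => _) = fun=> 0); [exact: algebra0|apply/funext => u; rewrite big_nil].
rewrite (_ : (fun u => _) = fun u => a j *: F j u + \sum_(j <- s) a j *: F j u).
  apply: algebra_lin; first by apply: h; rewrite mem_head.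
  by apply: IH => i si; apply: h; rewrite in_cons si orbT.
by apply/funext => u; rewrite big_cons.
Qed.

(** Only the image under [pi_rep] is known to lie in the closure of the slices; injectivity of the
    amplification identifies its preimage in [A]. *)
Lemma basic_in_algebra (t y p w : I) (m : int) : A (basic_op t y p w m).
Proof.
have bX := basic_op_bounded q01 hW t y p w m.
have [_ _ piA] := hA.
have : op_closure (W_slices W) (pi_rep (basic_op t y p w m)).
  split; first exact: (@amplify_bounded R q _ _ (mu_H q) _ bX).
  move=> e e0; exists (pi_rep (basic_op t y p w m)); first exact: (basic_slice q01 hW).
  by move=> u; rewrite subrr norm20 mulr_ge0 ?norm2_ge0 // ltW.
rewrite -piA => -[X AX Xe].
have <- : X = basic_op t y p w m; last exact: AX.
exact: (@amplify_inj R q _ _ (mu_H q) _ _ (algebra_bounded AX) bX Xe).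
Qed.

(** Real functions of x whose multiplication operator lies in A_q; they are stable under linear
    combinations, products and uniform limits. *)
Definition multiplier (b : I -> R) : Prop :=
  (exists M : R, forall x, `|b x| <= M) /\ A (shift_mul 1 (mono b 0)).

Lemma multiplier_lin a b b' : multiplier b -> multiplier b' ->
  multiplier (fun x => a * b x + b' x).
Proof.
move=> [[M hM] Ab] [[M' hM'] Ab']; split.
  exists (`|a| * M + M') => x; apply: le_trans (ler_normD _ _) _.
  by rewrite normrM; apply: lerD => //; apply: ler_wpM2l.
have -> : mono (fun x => a * b x + b' x) 0 = fun z => (a%:C)%C * mono b 0 z + mono b' 0 z.
  by apply/funext => z; rewrite /mono !expr0z !mulr1 rmorphD rmorphM.
rewrite (_ : shift_mul 1 _ = fun u => (a%:C)%C *: shift_mul 1 (mono b 0) u + shift_mul 1 (mono b' 0) u).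
  exact: algebra_lin.
apply/funext => u; apply: shift_mulDl; first exact: oner_neq0.
  by apply: mono_symbol; exists M.
by apply: mono_symbol; exists M'.
Qed.

Lemma multiplier_scale a b : multiplier b -> multiplier (fun x => a * b x).
Proof.
move=> hb; rewrite (_ : (fun x => _) = fun x => (a - 1) * b x + b x).
  exact: multiplier_lin.
by apply/funext => x; ring.
Qed.

Lemma multiplier_mul b b' : multiplier b -> multiplier b' -> multiplier (fun x => b x * b' x).
Proof.
move=> [[M hM] Ab] [[M' hM'] Ab'].
have n1 : (1 : R) != 0 := oner_neq0 R.
have hb : exists M : R, forall x, `|b x * b' x| <= M.
  by exists (M * M') => x; rewrite normrM; apply: ler_pM.
split; first exact: hb.
rewrite (_ : shift_mul 1 _ = shift_mul 1 (mono b 0) \o shift_mul 1 (mono b' 0)).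
  exact: algebra_comp.
apply: (@total_ext R _ _ (mu_H q) _ _ _ _ (@total_basis_H R q)).
- by apply: shift_mul_bounded => //; exact: mono_symbol.
- by apply: bounded_comp; exact: algebra_bounded.
move=> [j x] /=; have [hbM hbM'] : (exists M : R, forall x, `|b x| <= M) /\ (exists M : R, forall x, `|b' x| <= M).
  by split; [exists M|exists M'].
rewrite (shift_mul_basis _ _ _ n1 hb) (shift_mul_basis _ _ _ n1 hbM').
rewrite (linZ _ _ (algebra_bounded Ab).1) divr1 (shift_mul_basis _ _ _ n1 hbM).
rewrite scalerA divr1 !addr0; congr (_ *: _).
by apply: eq_cplx => /=; ring.
Qed.

Lemma multiplier_lim b : (exists M : R, forall x, `|b x| <= M) ->
  (forall e : R, 0 < e -> exists2 b', multiplier b' & forall x, `|b x - b' x| <= e) ->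
  multiplier b.
Proof.
move=> hb hl; split=> //.
have n1 : (1 : R) != 0 := oner_neq0 R; have sb := mono_symbol 0 hb.
apply: algebra_closed; first exact: shift_mul_bounded.
move=> e e0; have [b' [hb' Ab'] bb'] := hl e e0.
exists (shift_mul 1 (mono b' 0)) => // u; have sb' := mono_symbol 0 hb'.
have -> : shift_mul 1 (mono b 0) u - shift_mul 1 (mono b' 0) u =
    shift_mul 1 (fun z => -1 * mono b' 0 z + mono b 0 z) u.
  by rewrite (shift_mulDl (-1) u n1 sb' sb) scaleN1r addrC.
apply: norm2_shift_mul => //; [exact: symbolD|exact: ltW|].
move=> l y _; rewrite /mono /= expr0z !mulr1 mulN1r addrC -rmorphB cabs_real.
exact: bb'.
Qed.

Local Notation one := (point : I).

Lemma val_one : val one = qel false 0.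
Proof. by rewrite qel0 expr0z. Qed.

Lemma multiplier_afun (y : I) : multiplier (fun x => afun q 1 (val x) (val y) ^+ 2).
Proof.
have [s [Y [yE _]]] := Iq_qel q01 y.
have [bE kE] := bshift_qel q01 0 val_one yE val_one yE.
have b1 : bshift one y one y 0 = 1.
  rewrite bE (_ : _ (+) s = false); last by case: (s).
  by rewrite qel0 (_ : Y - Y - 0 = 0) ?expr0z //; lia.
have k0 : bdegree one y one y = 0 by rewrite kE; lia.
have := basic_in_algebra one y one y 0; rewrite /basic_op b1 invr1 k0 => Ab.
have hb := bcoef_bounded q01 hW one y one y 0.
(* The scalar |y| undoes the factor |t / y| of [W_coef] at t = 1. *)
have := multiplier_scale `|val y| (conj hb Ab); congr multiplier.
apply/funext => x; rewrite /bcoef b1 mul1r asboolT; last exact/set_mem/valP.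
rewrite /W_coef -[val one]/(1 : R).
have e : `|val y| * `|1 / val y| = 1 by rewrite -normrM mul1r divff ?Iq_neq0 // normr1.
by rewrite !mulrA e mul1r expr2.
Qed.

Lemma afun1_neq0_sign s k s' k' : afun q 1 (qel s k) (qel s' k') != 0 -> s = s'.
Proof.
move=> h; have : Num.sg (qel s k * qel s' k') = Num.sg (1 : R).
  by apply/eqP; apply: contraNT h => h; rewrite (afun_out q h).
rewrite qelM // sg_qel // sgr1 -[RHS](expr0 (-1)) => /(@sign_inj R _ false).
by case: (s) (s') => [] [].
Qed.

(* For g = a_1(., y)^2 with y <> 1, the set where g >= g x0 / 2 is finite; phi, a
   product of g with differences h - h x1, kills its points x1 <> x0, and then
   (g / g x0)^n phi / phi x0 tends to the indicator of x0 uniformly. *)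
Lemma multiplier_point (x0 : I) : multiplier (fun x => (x == x0)%:R).
Proof.
have [s [k [xE hs]]] := Iq_qel q01 x0.
have [N hN] := afun1_neq0 q01 hs.
have hY : N <= Num.max N 1 by rewrite le_max lexx.
(* An exponent at least 1 keeps y in I_q when s is the negative sign, and makes y <> 1, as
   [afun_off] requires. *)
have hY1 : 1 <= Num.max N 1 by rewrite le_max lexx orbT.
have yI : Iq_set q (qel s (Num.max N 1)).
  by apply/(Iq_setP q01); exists s, (Num.max N 1); split=> // _; lia.
have [y yE] := Iq_lift yI.
have y1 : y != one.
  apply/eqP => e; have := val_one; rewrite -e yE => /(qel_inj q01)[_]; lia.
pose g (x : I) := afun q 1 (val x) (val y) ^+ 2.
have Bg : multiplier g := multiplier_afun y.
have a0 : afun q 1 (val x0) (val y) != 0 by rewrite xE yE; exact: hN.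
have g0 : 0 < g x0 by rewrite /g lt_neqAle eq_sym sqrf_eq0 a0 sqr_ge0.
have d0 : 0 < `|afun q 1 (val x0) (val y)| / 2 by rewrite divr_gt0 // normr_gt0.
have [E hE] : exists E : seq I, forall x, x \notin E -> g x / g x0 <= 2^-1.
  have [r0 r00 h0] := afun_near0 q01 (set_mem (valP one)) (set_mem (valP y)) d0.
  have [r1 h1] := afun_off q01 hW y1 d0.
  have [E hE] := Iq_band r1 r00; exists E => x xE'.
  have : `|afun q 1 (val x) (val y)| < `|afun q 1 (val x0) (val y)| / 2.
    have [lt|ge] := ltP `|val x| r0; first exact: (h0 _ (set_mem (valP x)) lt).
    have [le|gt] := leP `|val x| r1; last exact: h1.
    by move: xE'; rewrite hE.
  rewrite ler_pdivrMr // /g -(real_normK (num_real (afun q 1 (val x) _))).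
  rewrite -(real_normK (num_real (afun q 1 (val x0) _))).
  move: (normr_ge0 (afun q 1 (val x) (val y))) (normr_ge0 (afun q 1 (val x0) (val y))).
  by move: `|_| `|afun _ _ (val x0) _| => u v; nra.
have [phi [Bphi phi0 phiE]] : exists phi, [/\ multiplier phi, phi x0 != 0 &
    forall x, x \in E -> x != x0 -> phi x = 0].
  elim: (E) => [|x1 E' [phi [Bphi phi0 phiE]]]; first by exists g; split=> //; rewrite gt_eqF.
  have step (h : I -> R) : multiplier (fun x => phi x * h x) -> h x0 != 0 ->
      (x1 != x0 -> h x1 = 0) -> exists phi, [/\ multiplier phi, phi x0 != 0 &
      forall x, x \in x1 :: E' -> x != x0 -> phi x = 0].
    move=> Bh h0 h1; exists (fun x => phi x * h x); split=> //; first exact: mulf_neq0.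
    move=> x; rewrite in_cons => /orP[/eqP->|xE'] xx0; first by rewrite h1 ?mulr0.
    by rewrite phiE ?mul0r.
  have [e|x10] := eqVneq x1 x0.
    apply: (step (fun=> 1)); rewrite ?oner_neq0 // ?e ?eqxx //.
    by under eq_fun do rewrite mulr1.
  have [z|nz] := eqVneq (afun q 1 (val x1) (val y)) 0.
    apply: (step g); [exact: multiplier_mul|by rewrite gt_eqF|].
    by rewrite /g z expr0n.
  have [s1 [k1 [x1E hs1]]] := Iq_qel q01 x1.
  have ss : s1 = s by move: nz; rewrite x1E yE => /afun1_neq0_sign.
  have kk : k != k1.
    apply: contra x10 => /eqP e; apply/eqP/val_inj.
    by rewrite xE x1E ss e.
  rewrite ss in hs1 x1E.
  have [Y Y1 sep] := afun1_sep q01 1 hs hs1 kk.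
  have y'I : Iq_set q (qel s Y) by apply/(Iq_setP q01); exists s, Y; split=> // _; lia.
  have [y' y'E] := Iq_lift y'I.
  pose hc := afun q 1 (val x1) (val y') ^+ 2.
  apply: (step (fun x => afun q 1 (val x) (val y') ^+ 2 - hc)).
  - have := multiplier_lin (- hc) Bphi (multiplier_mul Bphi (multiplier_afun y')).
    by congr multiplier; apply/funext => x; ring.
  - by rewrite subr_eq0 /hc y'E xE x1E.
  - by move=> _; rewrite subrr.
apply: multiplier_lim.
  by exists 1 => x; case: eqP => _; rewrite ?normr1 ?normr0.
have [[M hM] _] := Bphi; have M0 : 0 <= M := le_trans (normr_ge0 _) (hM x0).
move=> e e0; have C0 : 0 <= M / `|phi x0| by rewrite divr_ge0.
have half : 0 < (2^-1 : R) < 1 by apply/andP; split; lra.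
have [n hn] := geometric_beats_linear half e0 C0.
exists (fun x => (phi x0)^-1 * ((g x / g x0) ^+ n * phi x)).
  apply: multiplier_scale.
  elim: (n) => [|n' IH]; first by under eq_fun do rewrite expr0 mul1r.
  have := multiplier_scale (g x0)^-1 (multiplier_mul Bg IH); congr multiplier.
  by apply/funext => x; rewrite exprS; ring.
move=> x; have [->|xx0] := eqVneq x x0.
  by rewrite divff ?gt_eqF // expr1n mul1r mulVf // subrr normr0 ltW.
have [xE'|xE'] := boolP (x \in E).
  by rewrite (phiE x xE' xx0) !mulr0 subr0 normr0 ltW.
rewrite sub0r normrN !normrM normfV; apply: le_trans _ hn.
have gx : 0 <= g x / g x0 by rewrite divr_ge0 // ?sqr_ge0 // ltW.
have p1 : `|(g x / g x0) ^+ n| <= 2^-1 ^+ n.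
  rewrite ger0_norm ?exprn_ge0 //; apply: lerXn2r; rewrite ?nnegrE //.
  exact: hE.
apply: (@le_trans _ _ (`|phi x0|^-1 * (2^-1 ^+ n * M))).
  by apply: ler_wpM2l; rewrite ?invr_ge0 //; apply: ler_pM.
have -> : `|phi x0|^-1 * (2^-1 ^+ n * M) = M / `|phi x0| * 2^-1 ^+ n by ring.
apply: ler_wpM2r; first by rewrite exprn_ge0.
by rewrite -[leLHS]mulr1; apply: ler_wpM2l => //; rewrite ler1n.
Qed.

End Generation.

(** * The generators lie in A_q *)

Section GeneratorsInAlgebra.
Variables (R : realType) (q : R) (q01 : 0 < q < 1).
Local Notation I := (Iq q).
Local Notation T := (circle R).
Local Notation H := (L2 (mu_H q)).
Local Notation K := (L2 (mu_K q)).
Local Notation KK := (L2 (prod_measure (mu_K q) (mu_K q))).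
Local Notation qel := (qelt q).
Variable W : KK -> KK.
Hypothesis hW : multiplicative_unitary W.
Variable A : set (H -> H).
Hypothesis hA : reduced_cstar_algebra W A.
Local Notation one := (point : I).

(** The multiplier of x0 is composed with a basic operator of the right shift. For t = p = 1 its
    degree is chi(w) - chi(y), so any k is reached while y and w stay small enough for both
    coefficients at x0 to be nonzero; dividing by their product normalizes. *)
Lemma algebra_shift_point (p : R) (x0 : I) (k : int) : qpowers q p ->
  Iq_set q (val x0 / p) -> A (shift_mul p (mono (fun x => (x == x0)%:R) k)).
Proof.
move=> /(qpowersP q)[sp [P pE]] hI; have p0 : p != 0 by rewrite pE qel_neq0.
have [s [X [xE hs]]] := Iq_qel q01 x0.
have cE : val x0 / p = qel (s (+) sp) (X - P) by rewrite xE pE qelV // qelM.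
have hs' : (s (+) sp)%B -> 0 < X - P.
  move: hI; rewrite cE => /(Iq_setP q01)[s' [k' [/(qel_inj q01)[-> ->]]]].
  exact.
have [N1 h1] := afun1_neq0 q01 hs; have [N2 h2] := afun1_neq0 q01 hs'.
(* N1 and N2 secure nonvanishing at y and w; the bounds by 1 keep both points in I_q when they are
   negative. *)
pose Y := Num.max (Num.max N1 1) (Num.max (N2 - k) (1 - k)).
have [Y1 Y2 Y3 Y4] : [/\ N1 <= Y, 1 <= Y, N2 <= Y + k & 1 <= Y + k].
  by rewrite /Y; split; lia.
have yI : Iq_set q (qel s Y) by apply/(Iq_setP q01); exists s, Y; split=> // _; lia.
have wI : Iq_set q (qel (s (+) sp) (Y + k)).
  by apply/(Iq_setP q01); exists (s (+) sp), (Y + k); split=> // _; lia.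
have [y yE] := Iq_lift yI; have [w wE] := Iq_lift wI.
have [bE kE] := bshift_qel q01 (k + P) (val_one q) yE (val_one q) wE.
have bp : bshift one y one w (k + P) = p^-1.
  rewrite bE pE qelV //; congr (qel _ _); last by lia.
  by case: (s) (sp) => [] [].
have kk : bdegree one y one w = k by rewrite kE; lia.
have AX := basic_in_algebra q01 hW hA one y one w (k + P).
have AY := (multiplier_point q01 hW hA x0).2.
set b := bcoef one y one w (k + P).
have b0 : b x0 != 0.
  rewrite /b /bcoef bp mulrC asboolT // /W_coef cE wE xE yE.
  have -> : val one = 1 by [].
  have yn : `|1 / qel s Y| != 0 by rewrite normr_eq0 mulf_neq0 ?invr_eq0 ?oner_neq0 ?qel_neq0.
  by rewrite mulf_neq0 ?h2 // mulf_neq0 // h1.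
have n1 : (1 : R) != 0 := oner_neq0 R.
have hb := bcoef_bounded q01 hW one y one w (k + P).
have hpt : exists M : R, forall x, `|((x == x0)%:R : R)| <= M.
  by exists 1 => x; case: eqP => _; rewrite ?normr1 ?normr0.
rewrite (_ : shift_mul p _ = fun u => (((b x0)^-1)%:C)%C *:
    (basic_op one y one w (k + P) \o shift_mul 1 (mono (fun x => (x == x0)%:R) 0)) u + 0).
  by apply: (algebra_lin hA); [exact: (algebra_comp hA)|exact: (algebra0 hA)].
apply: (@total_ext R _ _ (mu_H q) _ _ _ _ (@total_basis_H R q)).
- by apply: shift_mul_bounded => //; exact: mono_symbol.
- apply: bounded_lincomb; last exact: bounded0.
  by apply: bounded_comp; [exact: (algebra_bounded hA AX)|exact: (algebra_bounded hA AY)].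
move=> [j x]; rewrite addr0 [X in _ = _ *: X]/= (shift_mul_basis _ _ _ p0 hpt).
rewrite (shift_mul_basis _ _ _ n1 hpt) (linZ _ _ (algebra_bounded hA AX).1) addr0 divr1.
rewrite /basic_op kk bp invrK (shift_mul_basis _ _ _ p0 hb) -/b !scalerA.
congr (_ *: _); have [->|_] := eqVneq x x0; last by rewrite mulr0 mul0r.
by apply: eq_cplx => /=; rewrite ?(mulr0, mul0r, subr0, addr0, mulr1) // mulVf.
Qed.

Lemma shift_mul_sum (p : R) (J : Type) (s : seq J) (a : J -> R[i]) (g : J -> T * I -> R[i]) u :
  p != 0 -> (forall j, symbol (g j)) ->
  symbol (fun z => \sum_(j <- s) a j * g j z) /\
  shift_mul p (fun z => \sum_(j <- s) a j * g j z) u = \sum_(j <- s) a j *: shift_mul p (g j) u.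
Proof.
move=> p0 sg; elim: s => [|j s [IH1 IH2]].
  have -> : (fun z => \sum_(j <- [::]) a j * g j z) = fun=> 0.
    by apply/funext => z; rewrite big_nil.
  have s0 : symbol (fun=> 0 : R[i]) (q := q).
    by split=> [x|]; [exact: cmeasurable_cst|exists 0 => z; rewrite cabs0].
  split=> //; rewrite big_nil; apply: norm2_eq0; apply/le_anti; rewrite norm2_ge0 andbT.
  have := @norm2_shift_mul R q p (fun=> 0) 0 u p0 s0 (lexx 0); rewrite mul0r; apply.
  by move=> l y _; rewrite cabs0.
have -> : (fun z => \sum_(j <- j :: s) a j * g j z) =
    fun z => a j * g j z + \sum_(j <- s) a j * g j z.
  by apply/funext => z; rewrite big_cons.
split; first exact: symbolD.
by rewrite big_cons (shift_mulDl (a j) u p0 (sg j) IH1) IH2.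
Qed.

(* A symbol vanishing at 0 and at oo along the range of the shift is uniformly
   close to a combination of characters on finitely many slices. *)
Lemma algebra_vanishing (p : R) (f : T * I -> R[i]) : qpowers q p -> symbol f ->
  (forall x : I, continuous ((fun l => f (l, x)) : T -> R[i]^o)) ->
  (forall e : R, 0 < e -> exists2 r : R, 0 < r &
     forall l (x : I), `|val x| < r -> cabs (f (l, x)) < e) ->
  (forall e : R, 0 < e -> exists r : R,
     forall l (x : I), Iq_set q (val x / p) -> r < `|val x| -> cabs (f (l, x)) < e) ->
  A (shift_mul p f).
Proof.
move=> hp sf cf f0 foo; have p0 : p != 0.
  by have [sp [P ->]] := (qpowersP q p).1 hp; exact: qel_neq0.
apply: (algebra_closed hA); first exact: shift_mul_bounded.
move=> e e0; have [r0 r00 h0] := f0 e e0; have [r1 h1] := foo e e0.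
have [E hE] := Iq_band q01 r1 r00.
have /choice[s hs] := fun x => laurent_approx (cf x) e0.
pose E' := [seq x <- undup E | `[< Iq_set q (val x / p) >]].
have uE' : uniq E' by apply: filter_uniq; exact: undup_uniq.
pose L : seq (R[i] * (I * int)) := flatten [seq [seq (c.1, (x, c.2)) | c <- s x] | x <- E'].
pose g (d : R[i] * (I * int)) := mono (fun x => (x == d.2.1)%:R : R) d.2.2.
have sg d : symbol (g d).
  by apply: mono_symbol; exists 1 => x; case: eqP => _; rewrite ?normr1 ?normr0.
pose f' z := \sum_(d <- L) d.1 * g d z.
have sf' : symbol f' := (shift_mul_sum L (fun d => d.1) 0 p0 sg).1.
have f'E l y : f' (l, y) = if y \in E' then \sum_(c <- s y) c.1 * (val l : R[i]) ^ c.2 else 0.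
  rewrite /f' /L big_flatten big_map /=.
  have inner_ x : \sum_(d <- [seq (c.1, (x, c.2)) | c <- s x]) d.1 * g d (l, y) =
      (y == x)%:R * \sum_(c <- s x) c.1 * (val l : R[i]) ^ c.2.
    rewrite big_map mulr_sumr; apply: eq_bigr => c _; rewrite /g /mono /=.
    by case: eqP => _ /=; rewrite ?mul1r ?mul0r ?mulr0.
  under eq_bigr do rewrite inner_.
  case: ifPn => yE'.
    rewrite (bigD1_seq y) //= eqxx mul1r [X in _ + X]big1 ?addr0 // => x /negPf xy.
    by rewrite eq_sym xy mul0r.
  rewrite big_seq big1 // => x xE'; case: eqP => [yx|_]; last by rewrite mul0r.
  by move: yE'; rewrite yx xE'.
exists (shift_mul p f').
  rewrite (_ : shift_mul p f' = fun u => \sum_(d <- L) d.1 *: shift_mul p (g d) u).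
    apply: (algebra_sum hA) => d /flattenP[_ /mapP[x xE' ->] /mapP[c _ ->]].
    apply: algebra_shift_point => //=.
    by move: xE'; rewrite mem_filter => /andP[/asboolP].
  by apply/funext => u; exact: (shift_mul_sum L (fun d => d.1) u p0 sg).2.
move=> u.
have -> : shift_mul p f u - shift_mul p f' u = shift_mul p (fun z => -1 * f' z + f z) u.
  by rewrite (shift_mulDl (-1) u p0 sf' sf) scaleN1r addrC.
apply: norm2_shift_mul => //; [exact: symbolD|exact: ltW|].
move=> l y yp; rewrite mulN1r addrC f'E; case: ifPn => yE'; first exact: hs.
rewrite subr0; apply: ltW.
have [lt|ge] := ltP `|val y| r0; first exact: h0.
have [le|gt] := leP `|val y| r1; last exact: h1.
by case/negP: yE'; rewrite mem_filter mem_undup hE // andbT; apply/asboolP.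
Qed.

(** The conditions at 0 and at oo bound [f] there; in between only finitely many circles remain,
    each compact. *)
Lemma C_algebra_symbol (f : T * I -> R[i]) : C_algebra f -> symbol f.
Proof.
move=> [cf f0 [c foo]].
have cs x : continuous ((fun l => f (l, x)) : T -> R[i]^o) by exact: continuous_section_Iq.
split=> [x|]; first exact: continuous_cmeasurable.
have [r0 r00 h0] := f0 1 ltr01; have [r1 h1] := foo 1 ltr01.
have [E hE] := Iq_band q01 r1 r00.
have [M hM] : exists M : R, forall l (x : I), x \in E -> cabs (f (l, x)) <= M.
  elim: (E) => [|x E' [M hM]]; first by exists 0.
  have [M' _ hM'] := circle_bounded (cs x).
  exists (Num.max M M') => l y; rewrite in_cons le_max => /orP[/eqP->|yE].
    by rewrite hM' orbT.
  by rewrite hM.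
exists (Num.max M (1 + cabs c)) => -[l x]; rewrite le_max.
have [lt|ge] := ltP `|val x| r0.
  by apply/orP; right; have := h0 l x lt; have := cabs_ge0 c; lra.
have [le|gt] := leP `|val x| r1; first by rewrite hM // hE.
apply/orP; right; rewrite -[f _](subrK c); apply: le_trans (cabsD _ _) _.
by apply: lerD => //; apply: ltW; exact: h1.
Qed.

Lemma gens_in_algebra : @gens R q `<=` A.
Proof.
move=> _ [f [p [Cf hp ->]]]; rewrite -shift_mulE.
have sf := C_algebra_symbol Cf; have [cf f0 [c foo]] := Cf.
have cs x : continuous ((fun l => f (l, x)) : T -> R[i]^o) by exact: continuous_section_Iq.
have [sp [P pE]] := (qpowersP q p).1 hp; have p0 : p != 0 by rewrite pE qel_neq0.
(* Negative p: for x > 1 the point x / p is negative, and it lies in I_q only if |x| < |p|. No large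
   x is left, so the condition at oo holds whatever the limit of [f]. *)
case: sp pE => pE.
  apply: algebra_vanishing => // e e0; exists (Num.max 1 `|p|) => l x xp.
  rewrite gt_max => /andP[x1 xP].
  have [k xE k0] := Iq_gt1 q01 x1.
  move: xp; rewrite xE pE qelV // qelM // => /(Iq_setP q01)[s' [k' [/(qel_inj q01)[<- <-]]]].
  move=> /(_ isT) kP; move: xP; rewrite xE pE !norm_qel // qz_lt //; lia.
(* Positive p: with all labels 1 and m = P the basic operator has exactly the shift [p], degree 0
   and a coefficient tending to 1; removing [c] times it leaves a symbol that vanishes at oo. *)
have [bE kE] := bshift_qel q01 P (val_one q) (val_one q) (val_one q) (val_one q).
have bp : bshift one one one one P = p^-1.
  by rewrite bE pE qelV //; congr (qel _ _); lia.
have [hoo k0] := basic_oo1 q01 hW P (erefl one) (erefl one).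
have h0 := basic_near0 q01 hW one one one one P.
have AX := basic_in_algebra q01 hW hA one one one one P.
have hb := bcoef_bounded q01 hW one one one one P.
rewrite /basic_op bp invrK k0 in AX.
set b := bcoef one one one one P in h0 hoo AX hb.
have sb := mono_symbol 0 hb.
pose f' z := - c * mono b 0 z + f z.
have sf' : symbol f' by exact: symbolD.
rewrite (_ : shift_mul p f = fun u => c *: shift_mul p (mono b 0) u + shift_mul p f' u); last first.
  apply/funext => u; rewrite -(shift_mulDl c u p0 sb sf'); congr (shift_mul p _ u).
  by apply/funext => z; rewrite /f'; ring.
apply: (algebra_lin hA) => //; have c1 : 0 < cabs c + 1 by rewrite ltr_wpDl // cabs_ge0.
have mE l x : mono b 0 (l, x) = ((b x)%:C)%C by rewrite /mono expr0z mulr1.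
apply: (algebra_vanishing hp sf').
- move=> x l; apply/cvg_cplxP => e e0.
  have := (cvg_cplxP _ l).1 (cs x l) e e0; apply: filterS => m.
  by rewrite /f' !mE opprD addrACA subrr add0r.
- move=> e e0; have e2 : 0 < e / 2 by lra.
  have [r r_0 hr] := f0 _ e2; have [r' r'_0 hr'] := h0 _ (divr_gt0 e2 c1).
  exists (Num.min r r'); first by rewrite lt_min r_0.
  move=> l x; rewrite lt_min => /andP[x1 x2]; rewrite /f' mE.
  apply: le_lt_trans (cabsD _ _) _; rewrite cabsM cabsN cabs_real [ltRHS]splitr.
  apply: ler_ltD; last exact: hr.
  have := hr' x x2; rewrite ltr_pdivlMr // mulrC => h; apply: le_trans (ltW h).
  by apply: ler_wpM2r => //; rewrite lerDl.
- move=> e e0; have e2 : 0 < e / 2 by lra.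
  have [r hr] := foo _ e2; have [r' hr'] := hoo _ (divr_gt0 e2 c1).
  exists (Num.max r r') => l x _; rewrite gt_max => /andP[x1 x2]; rewrite /f' mE.
  have -> : - c * ((b x)%:C)%C + f (l, x) = - c * ((b x - 1)%:C)%C + (f (l, x) - c).
    by rewrite rmorphB /=; ring.
  apply: le_lt_trans (cabsD _ _) _; rewrite cabsM cabsN cabs_real [ltRHS]splitr.
  apply: ler_ltD; last exact: hr.
  have := hr' x x2; rewrite ltr_pdivlMr // mulrC => h; apply: le_trans (ltW h).
  by apply: ler_wpM2r => //; rewrite lerDl.
Qed.

Lemma span_in_algebra : op_closure (op_span (@gens R q)) `<=` A.
Proof.
move=> X [bX hX]; apply: (algebra_closed hA) => // e e0.
have [_ [n [c [F [hF ->]]]] h] := hX e e0.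
exists (fun u => \sum_(i < n) c i *: F i u) => //.
by apply: (algebra_sum hA) => i _; apply: gens_in_algebra.
Qed.

End GeneratorsInAlgebra.

Theorem proposition4p15 (R : realType) (q : R) (hq : 0 < q < 1)
  (W : L2 (prod_measure (mu_K q) (mu_K q)) ->
       L2 (prod_measure (mu_K q) (mu_K q)))
  (hW : multiplicative_unitary W)
  (A_q : set (L2 (mu_H q) -> L2 (mu_H q)))
  (hA : reduced_cstar_algebra W A_q) :
  A_q = op_closure (op_span
    [set T : L2 (mu_H q) -> L2 (mu_H q) |
      exists (f : (circle R * Iq q)%type -> complex.complex R) (p : R),
        [/\ C_algebra f, qpowers q p & T = rho p \o mul_op (mu_H q) f]]).
Proof.
apply/seteqP; split; last exact: (span_in_algebra hq hW hA).
move=> X AX; apply: (closure_of_slices hq hW (algebra_bounded hA AX)).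
have [_ _ <-] := hA; by exists X.
Qed.
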